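(* Let $P\subset\overline{\mathbb{H}^3}$ be a Coxeter pyramid and let $G$ be the group generated by the set $S$ of the five reflections in the hyperplanes supporting the facets of $P$. Then the growth rate $\tau$ of $(G,S)$ is a Perron number.
   Context: A Coxeter pyramid is a convex polyhedron of finite volume in $\mathbb{H}^3$ with five facets (one quadrangular base facet and four triangular side facets sharing a common apex), all of whose dihedral angles are of the form $\pi/m$ with $m\ge2$ an integer, or $0$. For a group $G$ with finite generating set $S$, let $\ell_S(x)$ be the word length of $x\in G$ with respect to $S$, and let $a_k$ be the number of $g\in G$ with $\ell_S(g)=k$. The growth rate of $(G,S)$ is $\tau=\limsup_{k\to\infty}a_k^{1/k}$. A Perron number is a real algebraic integer $\tau>1$ all of whose other Galois conjugates have absolute value strictly less than $\tau$. *)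

(* Defs.v *)
From Stdlib Require Import Reals ZArith List.
Open Scope R_scope.

Record Vec4 := mkVec4 { c0 : R; c1 : R; c2 : R; c3 : R }.

(* Lorentzian form of signature (-,+,+,+);
   H^3 = { x | mink x x = -1, c0 x > 0 }, ideal points = future light rays. *)
Definition mink (x y : Vec4) : R :=
  - c0 x * c0 y + c1 x * c1 y + c2 x * c2 y + c3 x * c3 y.

Definition vadd (x y : Vec4) : Vec4 :=
  mkVec4 (c0 x + c0 y) (c1 x + c1 y) (c2 x + c2 y) (c3 x + c3 y).
Definition vscale (a : R) (x : Vec4) : Vec4 :=
  mkVec4 (a * c0 x) (a * c1 x) (a * c2 x) (a * c3 x).

(* Reflection in the hyperplane e^perp (for a unit spacelike e). *)
Definition refl (e : Vec4) (x : Vec4) : Vec4 :=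
  vadd x (vscale (- (2 * mink x e)) e).

(* Facets: base FB, sides F1..F4.  Vertices: apex, base vertices B1..B4.
   Side Fi contains Apex, Bi, B(i+1 mod 4); the base contains B1..B4. *)
Inductive facet := FB | F1 | F2 | F3 | F4.
Inductive vertex := Apex | B1 | B2 | B3 | B4.

Definition incident (p : vertex) (f : facet) : bool :=
  match f, p with
  | FB, Apex => false
  | FB, _ => true
  | F1, (Apex | B1 | B2) => true
  | F2, (Apex | B2 | B3) => true
  | F3, (Apex | B3 | B4) => true
  | F4, (Apex | B4 | B1) => true
  | _, _ => false
  end.

Definition adjacent (f g : facet) : bool :=
  match f, g with
  | FB, (F1 | F2 | F3 | F4) => true
  | (F1 | F2 | F3 | F4), FB => true
  | F1, (F2 | F4) => true
  | F2, (F1 | F3) => true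
  | F3, (F2 | F4) => true
  | F4, (F3 | F1) => true
  | _, _ => false
  end.

Definition lincomb (l : vertex -> R) (v : vertex -> Vec4) : Vec4 :=
  vadd (vscale (l Apex) (v Apex))
   (vadd (vscale (l B1) (v B1))
    (vadd (vscale (l B2) (v B2))
     (vadd (vscale (l B3) (v B3)) (vscale (l B4) (v B4))))).

(* P = { x in H^3 | mink x (e f) <= 0 for all facets f }, with outward unit
   normals e f, is a Coxeter pyramid of finite volume with (possibly ideal)
   vertices v p in the closure of H^3:
   - its closure is the hyperbolic convex hull of the vertices (cone equality),
     which gives finite volume;
   - vertex/facet incidences are those of a pyramid over a quadrilateral;
   - the dihedral angle theta between adjacent facets satisfies
     cos theta = - mink (e f) (e g), and theta = pi/m (m >= 2) or theta = 0. *)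
Definition is_coxeter_pyramid (e : facet -> Vec4) (v : vertex -> Vec4) : Prop :=
  (forall f, mink (e f) (e f) = 1) /\
  (forall p, 0 < c0 (v p) /\ mink (v p) (v p) <= 0) /\
  (forall p f, incident p f = true -> mink (v p) (e f) = 0) /\
  (forall p f, incident p f = false -> mink (v p) (e f) < 0) /\
  (forall x : Vec4, (forall f, mink x (e f) <= 0) <->
     exists l : vertex -> R, (forall p, 0 <= l p) /\ x = lincomb l v) /\
  (forall f g, adjacent f g = true ->
     (exists m : nat, (2 <= m)%nat /\ mink (e f) (e g) = - cos (PI / INR m))
     \/ mink (e f) (e g) = -1).

(* The element of G represented by a word in the generators S = {refl (e f)}.
   Since the generators are involutions, G = { act e w | w word }. *)
Definition act (e : facet -> Vec4) (w : list facet) : Vec4 -> Vec4 :=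
  fold_right (fun f g => fun x => refl (e f) (g x)) (fun x => x) w.

Definition has_word_length (e : facet -> Vec4) (g : Vec4 -> Vec4) (k : nat) : Prop :=
  (exists w, length w = k /\ act e w = g) /\
  (forall w, act e w = g -> (k <= length w)%nat).

Definition sphere_size (e : facet -> Vec4) (k n : nat) : Prop :=
  exists l : list (Vec4 -> Vec4), NoDup l /\
    (forall g, In g l <-> has_word_length e g k) /\ length l = n.

Definition kth_root (k n : nat) : R :=
  match n with O => 0 | _ => Rpower (INR n) (/ INR k) end.

Definition is_limsup (u : nat -> R) (l : R) : Prop :=
  forall eps, 0 < eps ->
    (forall N, exists k, (N <= k)%nat /\ l - eps < u k) /\
    (exists N, forall k, (N <= k)%nat -> u k < l + eps).

Definition growth_rate (e : facet -> Vec4) (tau : R) : Prop :=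
  exists a : nat -> nat, (forall k, sphere_size e k (a k)) /\
    is_limsup (fun k => kth_root k (a k)) tau.

(* integer polynomials as little-endian coefficient lists *)
Definition peval (p : list Z) (x : R) : R :=
  fold_right (fun a acc => IZR a + x * acc) 0 p.

Definition cmul (z w : R * R) : R * R :=
  (fst z * fst w - snd z * snd w, fst z * snd w + snd z * fst w).
Definition cadd (z w : R * R) : R * R := (fst z + fst w, snd z + snd w).
Definition cpeval (p : list Z) (z : R * R) : R * R :=
  fold_right (fun a acc => cadd (IZR a, 0) (cmul z acc)) (0, 0) p.
Definition cabs (z : R * R) : R := sqrt (fst z * fst z + snd z * snd z).

(* tau > 1 is a real algebraic integer (its minimal polynomial p is monic with
   integer coefficients) and every other Galois conjugate (complex root of p
   other than tau) has modulus < tau. *)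
Definition Perron (tau : R) : Prop :=
  1 < tau /\
  exists p : list Z,
    p <> nil /\ last p 0%Z = 1%Z /\ peval p tau = 0 /\
    (forall q : list Z, (exists c, In c q /\ c <> 0%Z) -> peval q tau = 0 ->
       (length p <= length q)%nat) /\
    (forall z : R * R, cpeval p z = (0, 0) -> z <> (tau, 0) -> cabs z < tau).

(* Main.v *)
Require Import Defs.
From Stdlib Require Import Reals ZArith List Lia Lra.
From Stdlib Require Import FunctionalExtensionality Classical ClassicalEpsilon.
From mathcomp Require all_boot all_algebra ssrZ.
(* Reals also has a projection named c1. *)
Import Defs ListNotations.
Open Scope R_scope.

(** The apex of a Coxeter pyramid is ideal: a linear relation between the normals of the four side
    facets forces neighbouring sides to be orthogonal and opposite ones to be parallel. The group is
    therefore determined by the four base angles [PI/m_i], and [2 <= m_i <= 6].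

    For every set [T] of generators, Tits' theorem (an element [g] is lengthened by [s] iff
    [g e_s] is a nonnegative combination of the normals of [T]) yields the unique length-additive
    factorization of elements into coset representatives and elements of parabolic subgroups.
    Inclusion-exclusion over descent sets then gives Steinberg's formula
    [1/W(t) = sum_U (-1)^|U| t^(N_U) / W_U(t)] over the spherical subsets [U], where [N_U] is the
    length of the longest element of [W_U].

    Multiplying by the least common multiple of the denominators brings the growth series of each
    of the finitely many pyramids into the form [P(t) / ((1 - t) (1 - B(t)))] where [B] has
    nonnegative integer coefficients, two consecutive ones being positive. Hence the growth rate is
    [1/t] for the root [t] in [(0, 1)] of [B(t) = 1], and equality in the triangle inequality shows
    that all other roots of the reciprocal polynomial of [1 - B] are smaller in modulus. Gauss's
    lemma passes this property on to the minimal polynomial. *)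

(** * Formal power series over the integers *)

Local Open Scope Z_scope.

(** Five normals in a four-dimensional space are linearly dependent, so coordinates cannot decide
    whether a root is positive or negative. The functional [lam], minus the product with an interior
    point, does it instead: it is positive on every normal and separates a cone of normals from its
    opposite. Lengths and descents are treated for every list of generators at once; an infinite
    parabolic subgroup drops out of Steinberg's formula because a null vector in its cone is fixed.
    The growth polynomials of the finite ones come from the same formula, which determines the
    series of a subset once a longest element is exhibited. The factor 1 - t reflects the vanishing
    of the Euler characteristic 1/W(1), as for every group acting on H^3 with finite covolume. The
    growth rate is reached without a radius of convergence: rescaled by the expected growth, the
    recurrence becomes a weighted mean, and this bounds the number of elements of length n from both
    sides. *)

Definition ser := nat -> Z.
Definition stl (f : ser) : ser := fun n => f (S n).
Definition scst (a : Z) : ser := fun n => match n with O => a | _ => 0 end.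
Definition sadd (f g : ser) : ser := fun n => f n + g n.
Definition sopp (f : ser) : ser := fun n => - f n.
Definition ssub (f g : ser) : ser := fun n => f n - g n.
Definition smul : ser -> ser -> ser :=
  fix smul f g n :=
    match n with
    | O => f O * g O
    | S k => f O * g (S k) + smul (stl f) g k
    end.
Definition sX (N : nat) : ser := fun n => if Nat.eqb n N then 1 else 0.

Lemma smul_0 f g : smul f g O = f O * g O.
Proof. reflexivity. Qed.

Lemma smul_S f g n : smul f g (S n) = f O * g (S n) + smul (stl f) g n.
Proof. reflexivity. Qed.

Lemma smul_S_r f g n : smul f g (S n) = smul f (stl g) n + f (S n) * g O.
Proof.
  revert f; induction n as [|n IH]; intros f; rewrite smul_S.
  - rewrite !smul_0; reflexivity.
  - rewrite IH, smul_S; unfold stl; ring.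
Qed.

Lemma smul_comm f g : smul f g = smul g f.
Proof.
  apply functional_extensionality; intros n; revert f g.
  induction n as [|n IH]; intros f g; [rewrite !smul_0 | rewrite smul_S, smul_S_r, IH]; ring.
Qed.

Lemma smul_add_l f g h : smul (sadd f g) h = sadd (smul f h) (smul g h).
Proof.
  apply functional_extensionality; intros n; revert f g.
  induction n as [|n IH]; intros f g.
  - unfold sadd; rewrite !smul_0; ring.
  - unfold sadd at 2; rewrite !smul_S.
    change (stl (sadd f g)) with (sadd (stl f) (stl g)).
    rewrite IH; unfold sadd; ring.
Qed.

Lemma smul_scale a f g n : smul (fun k => a * f k) g n = a * smul f g n.
Proof.
  revert f; induction n as [|n IH]; intros f; rewrite ?smul_0, ?smul_S; [ring|].
  change (stl (fun k => a * f k)) with (fun k => a * stl f k); rewrite IH; ring.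
Qed.

Lemma smul_assoc f g h : smul f (smul g h) = smul (smul f g) h.
Proof.
  apply functional_extensionality; intros n; revert f g h.
  induction n as [|n IH]; intros f g h; [rewrite !smul_0; ring|].
  rewrite !smul_S, smul_0, IH.
  assert (E : stl (smul f g) = sadd (fun k => f O * stl g k) (smul (stl f) g))
    by (apply functional_extensionality; intros k; reflexivity).
  rewrite E, smul_add_l; unfold sadd; rewrite smul_scale; ring.
Qed.

Lemma smul_cst a g n : smul (scst a) g n = a * g n.
Proof.
  destruct n as [|n]; [reflexivity|].
  rewrite smul_S; simpl (scst a O).
  replace (smul (stl (scst a)) g n) with 0; [ring|].
  assert (E : stl (scst a) = fun k => 0 * sX 0 k)
    by (apply functional_extensionality; intros k; reflexivity).
  rewrite E, smul_scale; ring.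
Qed.

Lemma ser_ring : ring_theory (scst 0) (scst 1) sadd smul ssub sopp eq.
Proof.
  constructor; intros; try apply smul_comm; try apply smul_add_l; try apply smul_assoc;
    apply functional_extensionality; intros n; rewrite ?smul_cst;
    unfold sadd, ssub, sopp; rewrite ?smul_cst; destruct n; cbv [scst]; ring.
Qed.

Add Ring ser_ring_inst : ser_ring.

Lemma sX_0 : sX 0 = scst 1.
Proof. apply functional_extensionality; intros [|n]; reflexivity. Qed.

Lemma smul_X_S N f n : smul (sX (S N)) f (S n) = smul (sX N) f n.
Proof. rewrite smul_S; simpl; unfold sX at 1; simpl; reflexivity. Qed.

Lemma sX_S N : sX (S N) = smul (sX 1) (sX N).
Proof.
  apply functional_extensionality; intros [|n]; [reflexivity|].
  rewrite smul_X_S, sX_0, smul_cst, Z.mul_1_l; reflexivity.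
Qed.

Lemma smul_cancel f g h : f O = 1 -> smul f g = smul f h -> g = h.
Proof.
  intros f0 E; apply functional_extensionality; intros n.
  induction n as [n IH] using (well_founded_induction Wf_nat.lt_wf).
  (* In the n-th coefficient only f(0) times g(n) is new; everything else involves earlier
     coefficients. The left factor is arbitrary because the recursion of [smul] shifts it. *)
  assert (aux : forall k f', (k < n)%nat -> smul f' g k = smul f' h k).
  { induction k as [|k IHk]; intros f' Hk; rewrite ?smul_0, ?smul_S, IH by lia; [ring|].
    rewrite IHk by lia; ring. }
  pose proof (f_equal (fun s => s n) E) as En; simpl in En.
  destruct n as [|n]; [rewrite !smul_0, f0 in En; lia|].
  rewrite !smul_S, f0, aux in En by lia; lia.
Qed.

(** The coefficients are stored latest first, so coefficient i sits at position n - i. *)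
Fixpoint sinv_list (f : ser) (n : nat) : list Z :=
  match n with
  | O => [1]
  | S k => let l := sinv_list f k in
           - smul (stl f) (fun i => nth (k - i) l 0) k :: l
  end.
Definition sinv (f : ser) : ser := fun n => hd 0 (sinv_list f n).

Lemma sinv_list_nth f n i : (i <= n)%nat -> nth (n - i) (sinv_list f n) 0 = sinv f i.
Proof.
  induction n as [|n IH]; intros Hi.
  - replace i with O by lia; reflexivity.
  - destruct (Nat.eq_dec i (S n)) as [->|]; [rewrite Nat.sub_diag; reflexivity|].
    replace (S n - i)%nat with (S (n - i)) by lia; simpl; apply IH; lia.
Qed.

Lemma smul_ext_le f g h n : (forall i, (i <= n)%nat -> g i = h i) -> smul f g n = smul f h n.
Proof.
  revert f; induction n as [|n IH]; intros f E; rewrite ?smul_0, ?smul_S, E by lia; auto.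
  rewrite IH; auto.
Qed.

Lemma sinv_spec f : f O = 1 -> smul f (sinv f) = scst 1.
Proof.
  intros f0; apply functional_extensionality; intros [|n].
  - rewrite smul_0, f0; reflexivity.
  - rewrite smul_S, f0.
    change (sinv f (S n)) with (- smul (stl f) (fun i => nth (n - i) (sinv_list f n) 0) n).
    change (scst 1 (S n)) with 0.
    rewrite (smul_ext_le _ _ (sinv f)); [ring|].
    intros i Hi; apply sinv_list_nth, Hi.
Qed.

(** * Polynomials as coefficient lists *)

Definition ps (l : list Z) : ser := fun n => nth n l 0.

Fixpoint padd (a b : list Z) : list Z :=
  match a, b with
  | [], _ => b
  | _, [] => a
  | x :: a', y :: b' => (x + y) :: padd a' b'
  end.
Definition pscale (c : Z) : list Z -> list Z := map (Z.mul c).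
Fixpoint pmul (a b : list Z) : list Z :=
  match a with
  | [] => []
  | x :: a' => padd (pscale x b) (0 :: pmul a' b)
  end.
Fixpoint pshift (n : nat) (a : list Z) : list Z :=
  match n with O => a | S k => 0 :: pshift k a end.

Lemma ps_nil : ps [] = scst 0.
Proof. apply functional_extensionality; intros [|n]; reflexivity. Qed.

Lemma ps_cons x l : ps (x :: l) = sadd (scst x) (smul (sX 1) (ps l)).
Proof.
  apply functional_extensionality; intros [|n]; unfold sadd.
  - rewrite smul_0; unfold sX, ps; simpl; ring.
  - rewrite smul_X_S, sX_0, smul_cst, Z.mul_1_l; reflexivity.
Qed.

Lemma ps_add a b : ps (padd a b) = sadd (ps a) (ps b).
Proof.
  apply functional_extensionality; intros n; revert b n; unfold sadd, ps.
  induction a as [|x a IH]; intros [|y b] [|n]; simpl; auto; lia.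
Qed.

Lemma ps_scale c a : ps (pscale c a) = smul (scst c) (ps a).
Proof.
  apply functional_extensionality; intros n; rewrite smul_cst; unfold ps, pscale.
  replace 0 with (c * 0) at 1 by ring; apply map_nth.
Qed.

Lemma ps_mul a b : ps (pmul a b) = smul (ps a) (ps b).
Proof.
  induction a as [|x a IH]; simpl.
  - rewrite ps_nil; ring.
  - rewrite ps_add, ps_scale, !ps_cons, IH; ring.
Qed.

Lemma ps_shift n a : ps (pshift n a) = smul (sX n) (ps a).
Proof.
  induction n as [|n IH]; simpl.
  - rewrite sX_0; ring.
  - rewrite ps_cons, IH, (sX_S n); ring.
Qed.

Local Close Scope Z_scope.

(** * Lorentzian vectors and reflections *)


Definition vzero : Vec4 := mkVec4 0 0 0 0.

Lemma vec_ext x y : c0 x = c0 y -> c1 x = c1 y -> c2 x = c2 y -> c3 x = c3 y -> x = y.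
Proof. destruct x, y; simpl; intros; subst; reflexivity. Qed.

Ltac vec := apply vec_ext; simpl; try ring.

Lemma mink_sym x y : mink x y = mink y x.
Proof. unfold mink; ring. Qed.

Lemma mink_add_l x y z : mink (vadd x y) z = mink x z + mink y z.
Proof. unfold mink, vadd; simpl; ring. Qed.

Lemma mink_scale_l a x y : mink (vscale a x) y = a * mink x y.
Proof. unfold mink, vscale; simpl; ring. Qed.

Lemma mink_add_r x y z : mink x (vadd y z) = mink x y + mink x z.
Proof. unfold mink, vadd; simpl; ring. Qed.

Lemma mink_scale_r a x y : mink x (vscale a y) = a * mink x y.
Proof. unfold mink, vscale; simpl; ring. Qed.

Lemma mink_zero_l y : mink vzero y = 0.
Proof. unfold mink, vzero; simpl; ring. Qed.

Definition vlinear (g : Vec4 -> Vec4) : Prop :=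
  forall a x y, g (vadd (vscale a x) y) = vadd (vscale a (g x)) (g y).

Lemma vscale_0_add x y : vadd (vscale 0 x) y = y.
Proof. vec. Qed.

Lemma vadd_zero x : vadd x vzero = x.
Proof. vec. Qed.

Lemma vlinear_zero g : vlinear g -> g vzero = vzero.
Proof.
  intros L; pose proof (L (-1) vzero vzero) as E.
  replace (vadd (vscale (-1) vzero) vzero) with vzero in E by vec.
  rewrite E; vec.
Qed.

Lemma vlinear_scale g a x : vlinear g -> g (vscale a x) = vscale a (g x).
Proof.
  intros L; rewrite <- (vadd_zero (vscale a x)), L, (vlinear_zero g L); apply vadd_zero.
Qed.

Lemma refl_linear u : vlinear (refl u).
Proof.
  intros a x y; unfold refl; rewrite mink_add_l, mink_scale_l; vec.
Qed.

Lemma refl_isometry u x y : mink u u = 1 -> mink (refl u x) (refl u y) = mink x y.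
Proof.
  intros Hu; unfold refl.
  rewrite !mink_add_l, !mink_scale_l, !mink_add_r, !mink_scale_r, Hu, (mink_sym u y); ring.
Qed.

Lemma refl_invol u x : mink u u = 1 -> refl u (refl u x) = x.
Proof.
  intros Hu; unfold refl; rewrite mink_add_l, mink_scale_l, Hu; vec.
Qed.

Lemma refl_self u : mink u u = 1 -> refl u u = vscale (-1) u.
Proof. intros Hu; unfold refl; rewrite Hu; vec. Qed.

(** * Groups generated by reflections: lengths, roots and descents *)

Lemma least_witness (P : nat -> Prop) n : P n ->
  exists j, (j <= n)%nat /\ P j /\ forall i, P i -> (j <= i)%nat.
Proof.
  induction n as [n IH] using (well_founded_induction Wf_nat.lt_wf); intros PH.
  destruct (classic (exists i, (i < n)%nat /\ P i)) as [[i [Hi HP]]|N].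
  - destruct (IH i Hi HP) as [j [Hj [HPj Hm]]]; exists j; repeat split; auto; lia.
  - exists n; repeat split; auto; intros i HP.
    destruct (Nat.le_gt_cases n i); auto; exfalso; apply N; exists i; auto.
Qed.

Section ReflectionGroup.

Variable e : facet -> Vec4.
Variable x0 : Vec4.
Hypothesis e_unit : forall s, mink (e s) (e s) = 1.
Hypothesis e_angle : forall s t, s <> t ->
  (exists m : nat, (2 <= m)%nat /\ mink (e s) (e t) = - cos (PI / INR m))
  \/ mink (e s) (e t) = -1.
Hypothesis e_neg : forall s, mink (e s) x0 < 0.

Notation fn := (Vec4 -> Vec4).
Definition comp (g h : fn) : fn := fun x => g (h x).
Definition idf : fn := fun x => x.
Notation rf s := (refl (e s)).

Lemma comp_assoc f g h : comp f (comp g h) = comp (comp f g) h.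
Proof. reflexivity. Qed.

Lemma comp_id_r g : comp g idf = g.
Proof. reflexivity. Qed.

Lemma comp_id_l g : comp idf g = g.
Proof. reflexivity. Qed.

Lemma rf_invol s : comp (rf s) (rf s) = idf.
Proof. apply functional_extensionality; intros x; apply refl_invol, e_unit. Qed.

Lemma comp_rf_rf g s : comp (comp g (rf s)) (rf s) = g.
Proof. rewrite <- comp_assoc, rf_invol; reflexivity. Qed.

Lemma act_app u w : act e (u ++ w) = comp (act e u) (act e w).
Proof. induction u as [|s u IH]; simpl; [reflexivity|rewrite IH; reflexivity]. Qed.

Lemma act_snoc w s : act e (w ++ [s]) = comp (act e w) (rf s).
Proof. rewrite act_app; reflexivity. Qed.

Lemma act_linear w : vlinear (act e w).
Proof.
  induction w as [|s w IH]; intros a x y; simpl; [reflexivity|].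
  rewrite IH, refl_linear; reflexivity.
Qed.

Lemma act_isometry w x y : mink (act e w x) (act e w y) = mink x y.
Proof.
  induction w as [|s w IH]; simpl; [reflexivity|].
  rewrite refl_isometry by apply e_unit; apply IH.
Qed.

Lemma act_rev_r w : comp (act e w) (act e (rev w)) = idf.
Proof.
  induction w as [|s w IH]; simpl; [reflexivity|].
  rewrite act_snoc, comp_assoc.
  change (comp (fun x => rf s (act e w x)) (act e (rev w)))
    with (comp (rf s) (comp (act e w) (act e (rev w)))).
  rewrite IH; apply rf_invol.
Qed.

Lemma act_rev_l w : comp (act e (rev w)) (act e w) = idf.
Proof. rewrite <- (rev_involutive w) at 2; apply act_rev_r. Qed.

Definition inG (T : list facet) (g : fn) : Prop := exists w, incl w T /\ act e w = g.

Definition is_ell (T : list facet) (g : fn) (n : nat) : Prop :=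
  (exists w, incl w T /\ act e w = g /\ length w = n) /\
  (forall w, incl w T -> act e w = g -> (n <= length w)%nat).

(** Length with respect to [T] itself. Outside the subgroup generated by [T] the value is an
    unspecified choice. *)
Definition ell (T : list facet) (g : fn) : nat := epsilon (inhabits O) (is_ell T g).

Lemma ell_spec T g : inG T g -> is_ell T g (ell T g).
Proof.
  intros [w [Hw Eg]]; unfold ell; apply epsilon_spec.
  destruct (least_witness (fun n => exists w, incl w T /\ act e w = g /\ length w = n) (length w))
    as [n [_ [H1 H2]]]; [exists w; auto|].
  exists n; split; auto; intros w' Hw' Eg'; apply H2; exists w'; auto.
Qed.

Lemma ell_le T w : incl w T -> (ell T (act e w) <= length w)%nat.
Proof. intros Hw; apply ell_spec; [exists w; auto|auto|reflexivity]. Qed.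

Lemma ell_word T g : inG T g -> exists w, incl w T /\ act e w = g /\ length w = ell T g.
Proof. intros Hg; apply ell_spec, Hg. Qed.

Lemma inG_id T : inG T idf.
Proof. exists []; split; [apply incl_nil_l|reflexivity]. Qed.

Lemma inG_rf T s : In s T -> inG T (rf s).
Proof. intros Hs; exists [s]; split; [apply incl_cons; auto using incl_nil_l|reflexivity]. Qed.

Lemma inG_comp T g h : inG T g -> inG T h -> inG T (comp g h).
Proof.
  intros [u [Hu <-]] [w [Hw <-]]; exists (u ++ w); split; [apply incl_app; auto|apply act_app].
Qed.

Lemma inG_incl T U g : incl U T -> inG U g -> inG T g.
Proof. intros HU [w [Hw <-]]; exists w; split; [eapply incl_tran; eauto|reflexivity]. Qed.

Lemma inG_linear T g : inG T g -> vlinear g.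
Proof. intros [w [_ <-]]; apply act_linear. Qed.

Lemma inG_isometry T g x y : inG T g -> mink (g x) (g y) = mink x y.
Proof. intros [w [_ <-]]; apply act_isometry. Qed.

Lemma ell_comp T g h : inG T g -> inG T h -> (ell T (comp g h) <= ell T g + ell T h)%nat.
Proof.
  intros Hg Hh; destruct (ell_word T g Hg) as [u [Hu [<- <-]]];
    destruct (ell_word T h Hh) as [w [Hw [<- <-]]].
  rewrite <- act_app, <- length_app; apply ell_le, incl_app; auto.
Qed.

Lemma ell_incl T U g : incl U T -> inG U g -> (ell T g <= ell U g)%nat.
Proof.
  intros HU Hg; destruct (ell_word U g Hg) as [u [Hu [<- <-]]].
  apply ell_le; eapply incl_tran; eauto.
Qed.

Lemma ell_id T : ell T idf = O.
Proof. pose proof (ell_le T [] (incl_nil_l T)); simpl in *; unfold idf; lia. Qed.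

Lemma ell_rf T s : In s T -> (ell T (rf s) <= 1)%nat.
Proof. intros Hs; apply (ell_le T [s]); apply incl_cons; auto using incl_nil_l. Qed.

Lemma ell_eq0 T g : inG T g -> ell T g = O -> g = idf.
Proof.
  intros Hg E; destruct (ell_word T g Hg) as [[|s w] [Hw [<- Hl]]]; [reflexivity|].
  rewrite E in Hl; discriminate.
Qed.

Lemma ell_last T g n : inG T g -> ell T g = S n ->
  exists g' s, inG T g' /\ In s T /\ ell T g' = n /\ g = comp g' (rf s).
Proof.
  intros Hg E; destruct (ell_word T g Hg) as [w [Hw [Ea Hl]]].
  induction w as [|s w' _] using rev_ind; [simpl in Hl; lia|].
  apply incl_app_inv in Hw as [Hw' Hs]; rewrite length_app in Hl; simpl in Hl.
  assert (Hs' : In s T) by (apply Hs; left; reflexivity).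
  assert (Hg' : inG T (act e w')) by (exists w'; auto).
  exists (act e w'), s; rewrite act_snoc in Ea; repeat split; auto.
  pose proof (ell_le T w' Hw').
  pose proof (ell_comp T _ _ Hg' (inG_rf T s Hs')); pose proof (ell_rf T s Hs').
  rewrite Ea in *; lia.
Qed.

Lemma inG_inv T g : inG T g ->
  exists h, inG T h /\ comp g h = idf /\ comp h g = idf /\ ell T h = ell T g.
Proof.
  intros Hg.
  assert (inv : forall f, inG T f -> exists h, inG T h /\ comp f h = idf /\ comp h f = idf /\
             (ell T h <= ell T f)%nat).
  { intros f Hf; destruct (ell_word T f Hf) as [w [Hw [<- <-]]].
    assert (Hr : incl (rev w) T) by (intros x Hx; apply Hw, in_rev, Hx).
    exists (act e (rev w)); repeat split; auto using act_rev_l, act_rev_r.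
    - exists (rev w); auto.
    - rewrite <- length_rev; apply ell_le, Hr. }
  destruct (inv g Hg) as [h [Hh [E1 [E2 Hl]]]].
  destruct (inv h Hh) as [k [Hk [F1 [F2 Hl']]]].
  assert (k = g).
  { rewrite <- (comp_id_l k), <- E1, <- comp_assoc, F1; reflexivity. }
  subst k; exists h; repeat split; auto; lia.
Qed.

(** * Cones of simple roots and their heights *)

Definition lam (x : Vec4) : R := - mink x x0.

Inductive cone (T : list facet) : Vec4 -> Prop :=
| cone_zero : cone T vzero
| cone_cons a s x : 0 <= a -> In s T -> cone T x -> cone T (vadd (vscale a (e s)) x).

Lemma cone_add T x y : cone T x -> cone T y -> cone T (vadd x y).
Proof.
  intros Hx Hy; induction Hx as [|a s x Ha Hs Hx IH].
  - replace (vadd vzero y) with y by vec; auto.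
  - replace (vadd (vadd (vscale a (e s)) x) y) with (vadd (vscale a (e s)) (vadd x y)) by vec.
    apply cone_cons; auto.
Qed.

Lemma cone_scale T a x : 0 <= a -> cone T x -> cone T (vscale a x).
Proof.
  intros Ha Hx; induction Hx as [|b s x Hb Hs Hx IH].
  - replace (vscale a vzero) with vzero by vec; constructor.
  - replace (vscale a (vadd (vscale b (e s)) x)) with (vadd (vscale (a * b) (e s)) (vscale a x))
      by vec.
    apply cone_cons; auto; apply Rmult_le_pos; auto.
Qed.

Lemma cone_e T s : In s T -> cone T (e s).
Proof.
  intros Hs; replace (e s) with (vadd (vscale 1 (e s)) vzero) by vec.
  apply cone_cons; auto; [lra|constructor].
Qed.

Lemma cone_map T U g x : vlinear g -> (forall s, In s U -> cone T (g (e s))) ->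
  cone U x -> cone T (g x).
Proof.
  intros L H Hx; induction Hx as [|b s x Hb Hs Hx IH].
  - rewrite vlinear_zero by auto; constructor.
  - rewrite L; apply cone_add; auto; apply cone_scale; auto.
Qed.

Lemma lam_add x y : lam (vadd x y) = lam x + lam y.
Proof. unfold lam; rewrite mink_add_l; ring. Qed.

Lemma lam_scale a x : lam (vscale a x) = a * lam x.
Proof. unfold lam; rewrite mink_scale_l; ring. Qed.

Lemma lam_e s : 0 < lam (e s).
Proof. unfold lam; pose proof (e_neg s); lra. Qed.

Lemma cone_lam T x : cone T x -> 0 <= lam x.
Proof.
  induction 1 as [|a s x Ha Hs Hx IH]; [unfold lam; rewrite mink_zero_l; lra|].
  rewrite lam_add, lam_scale; pose proof (lam_e s).
  assert (0 <= a * lam (e s)) by (apply Rmult_le_pos; lra); lra.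
Qed.

Lemma cone_lam_pos T x : cone T x -> x <> vzero -> 0 < lam x.
Proof.
  intros H; induction H as [|a s x Ha Hs Hx IH]; intros N; [congruence|].
  rewrite lam_add, lam_scale; pose proof (lam_e s); pose proof (cone_lam T x Hx).
  destruct Ha as [Ha|Ha].
  - assert (0 < a * lam (e s)) by (apply Rmult_lt_0_compat; lra); lra.
  - subst a; rewrite vscale_0_add in N; specialize (IH N); lra.
Qed.

Lemma root_nonzero T g s : inG T g -> g (e s) <> vzero.
Proof.
  intros Hg E; pose proof (inG_isometry T g (e s) (e s) Hg) as H.
  rewrite E, mink_zero_l, e_unit in H; lra.
Qed.

(** * Alternating words and dihedral subgroups *)

Fixpoint rt (k : nat) (s t : facet) : list facet :=
  match k with O => [] | S k => rt k t s ++ [t] end.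

Lemma length_rt k s t : length (rt k s t) = k.
Proof.
  revert s t; induction k as [|k IH]; intros; simpl; auto.
  rewrite length_app, IH; simpl; lia.
Qed.

Lemma rt_incl k s t : incl (rt k s t) [s; t].
Proof.
  revert s t; induction k as [|k IH]; intros s t; simpl; [apply incl_nil_l|].
  apply incl_app; intros x Hx.
  - apply IH in Hx; simpl in *; tauto.
  - simpl in *; tauto.
Qed.

Lemma rt_split j m s t : exists pre, incl pre [s; t] /\ length pre = j /\
  rt (j + m) s t = pre ++ rt m s t.
Proof.
  revert s t; induction m as [|m IH]; intros s t.
  - exists (rt j s t); rewrite Nat.add_0_r, app_nil_r, length_rt; auto using rt_incl.
  - destruct (IH t s) as [pre [Hi [Hl E]]]; exists pre; repeat split; auto.
    + intros x Hx; apply Hi in Hx; simpl in *; tauto.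
    + rewrite Nat.add_succ_r; simpl; rewrite E, app_assoc; reflexivity.
Qed.

(** The word ends in [t]. Each reflection shifts the coefficients (p_1, p_0) to (p_2, p_1) along the
    recurrence, which is solved by sin(j x)/sin x and its shifts when c = cos x, and by j when c =
    1. *)
Lemma act_rt s t c (p : nat -> R) k :
  mink (e s) (e t) = - c -> (forall j, p (S (S j)) = 2 * c * p (S j) - p j) ->
  act e (rt k s t) (vadd (vscale (p 1%nat) (e s)) (vscale (p O) (e t))) =
  let (a, b) := if Nat.even k then (s, t) else (t, s) in
  vadd (vscale (p (S k)) (e a)) (vscale (p k) (e b)).
Proof.
  revert s t p; induction k as [|k IH]; intros s t p Hc Hp; [reflexivity|].
  simpl rt; rewrite act_snoc; unfold comp.
  assert (E : rf t (vadd (vscale (p 1%nat) (e s)) (vscale (p O) (e t))) =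
              vadd (vscale (p 2%nat) (e t)) (vscale (p 1%nat) (e s))).
  { unfold refl; rewrite mink_add_l, !mink_scale_l, Hc, e_unit, (Hp O); vec. }
  rewrite E.
  pose proof (IH t s (fun j => p (S j))) as H; simpl in H.
  rewrite H; [|rewrite mink_sym; auto|intros; apply Hp].
  rewrite Nat.even_succ, <- Nat.negb_even; destruct (Nat.even k); reflexivity.
Qed.

Lemma act_rt_orth s t k x : mink x (e s) = 0 -> mink x (e t) = 0 -> act e (rt k s t) x = x.
Proof.
  revert s t; induction k as [|k IH]; intros s t Hs Ht; [reflexivity|].
  simpl; rewrite act_snoc; unfold comp.
  replace (rf t x) with x by (unfold refl; rewrite Ht; vec); apply IH; auto.
Qed.

Lemma angle_pos m : (2 <= m)%nat -> 0 < PI / INR m <= PI / 2.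
Proof.
  intros Hm; pose proof PI_RGT_0; pose proof (le_INR _ _ Hm) as H1; simpl in H1.
  split; [apply Rdiv_lt_0_compat; lra|].
  unfold Rdiv; apply Rmult_le_compat_l; [lra|]; apply Rinv_le_contravar; lra.
Qed.

Lemma sin_angle_pos m : (2 <= m)%nat -> 0 < sin (PI / INR m).
Proof.
  intros Hm; pose proof (angle_pos m Hm); pose proof PI_RGT_0; apply sin_gt_0; lra.
Qed.

Lemma sin_rec x j : sin (INR (S (S j)) * x) = 2 * cos x * sin (INR (S j) * x) - sin (INR j * x).
Proof.
  rewrite !S_INR.
  replace ((INR j + 1 + 1) * x) with ((INR j + 1) * x + x) by ring.
  replace (INR j * x) with ((INR j + 1) * x - x) by ring.
  rewrite sin_plus, sin_minus; ring.
Qed.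

(** Both words send e_s to the same vector, minus e_s for even m and minus e_t for odd m, because
    sin(m x) = 0. *)
Lemma act_rt_braid_root s t m : (2 <= m)%nat -> mink (e s) (e t) = - cos (PI / INR m) ->
  act e (rt m s t) (e s) = act e (rt m t s) (e s).
Proof.
  intros Hm Hc; set (x := PI / INR m) in *.
  pose proof (sin_angle_pos m Hm) as Sp; fold x in Sp.
  assert (Hmx : INR m * x = PI) by (unfold x; field; apply not_0_INR; lia).
  (* Coordinates of e_s in the two orders of the pair: p starts from (p_0, p_1) = (0, 1), q from (1,
     0). *)
  pose (p := fun j => sin (INR j * x) / sin x).
  pose (q := fun j => - (sin (INR j * x - x) / sin x)).
  assert (Ep : vadd (vscale (p 1%nat) (e s)) (vscale (p O) (e t)) = e s).
  { unfold p; simpl; rewrite Rmult_1_l, Rmult_0_l, sin_0; vec; field; lra. }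
  assert (Eq : vadd (vscale (q 1%nat) (e t)) (vscale (q O) (e s)) = e s).
  { unfold q; simpl; replace (1 * x - x) with 0 by ring.
    replace (0 * x - x) with (- x) by ring; rewrite sin_neg, sin_0; vec; field; lra. }
  rewrite <- Ep at 1; rewrite <- Eq at 2.
  rewrite (act_rt s t (cos x) p), (act_rt t s (cos x) q).
  - assert (p m = 0) by (unfold p; rewrite Hmx, sin_PI; unfold Rdiv; ring).
    assert (p (S m) = -1).
    { unfold p; rewrite S_INR, Rmult_plus_distr_r, Hmx, Rmult_1_l, Rplus_comm, neg_sin.
      field; lra. }
    assert (q m = -1).
    { unfold q; rewrite Hmx, sin_PI_x; field; lra. }
    assert (q (S m) = 0).
    { unfold q; rewrite S_INR; replace ((INR m + 1) * x - x) with (INR m * x) by ring.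
      rewrite Hmx, sin_PI; unfold Rdiv; ring. }
    destruct (Nat.even m); rewrite H, H0, H1, H2; vec.
  - rewrite mink_sym; auto.
  - intros j; unfold q.
    replace (INR (S (S j)) * x - x) with (INR (S j) * x) by (rewrite (S_INR (S j)); ring).
    replace (INR (S j) * x - x) with (INR j * x) by (rewrite (S_INR j); ring).
    replace (INR (S j) * x) with (INR j * x + x) by (rewrite (S_INR j); ring).
    rewrite sin_plus, sin_minus; field; lra.
  - auto.
  - intros j; unfold p; rewrite sin_rec; field; lra.
Qed.

(** The Gram determinant 1 - c^2 is nonzero, so a vector splits into a part in the plane of e_s and
    e_t, settled by [act_rt_braid_root], and a part orthogonal to both, which the words fix. *)
Lemma act_rt_braid s t m : (2 <= m)%nat -> mink (e s) (e t) = - cos (PI / INR m) ->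
  act e (rt m s t) = act e (rt m t s).
Proof.
  intros Hm Hc; apply functional_extensionality; intros x.
  pose proof (sin_angle_pos m Hm) as Sp; pose proof (sin2_cos2 (PI / INR m)) as SC.
  set (c := cos (PI / INR m)) in *; set (d := sin (PI / INR m)) in *.
  unfold Rsqr in SC; assert (D : 1 - c * c <> 0) by nra.
  (* Coefficients of the projection to the plane, by Cramer's rule for the Gram matrix. *)
  pose (a := (mink x (e s) + c * mink x (e t)) / (1 - c * c)).
  pose (b := (mink x (e t) + c * mink x (e s)) / (1 - c * c)).
  pose (y := vadd x (vadd (vscale (- a) (e s)) (vscale (- b) (e t)))).
  assert (Ex : x = vadd (vscale a (e s)) (vadd (vscale b (e t)) y)) by (unfold y; vec).
  assert (Hys : mink y (e s) = 0).
  { unfold y; rewrite !mink_add_l, !mink_scale_l, e_unit, (mink_sym (e t)), Hc.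
    unfold a, b; field; auto. }
  assert (Hyt : mink y (e t) = 0).
  { unfold y; rewrite !mink_add_l, !mink_scale_l, e_unit, Hc.
    unfold a, b; field; auto. }
  rewrite Ex, !act_linear, !(act_rt_orth _ _ _ y) by auto.
  rewrite (act_rt_braid_root s t m) by auto.
  rewrite (act_rt_braid_root t s m); auto; rewrite mink_sym; auto.
Qed.

Lemma dihedral_normal_form s t w : incl w [s; t] ->
  exists k, (k <= length w)%nat /\ (act e w = act e (rt k s t) \/ act e w = act e (rt k t s)).
Proof.
  assert (step : forall a b k, exists k', (k' <= S k)%nat /\
    (act e (rt k a b ++ [b]) = act e (rt k' b a) \/ act e (rt k a b ++ [b]) = act e (rt k' a b))).
  { intros a b [|k]; [exists 1%nat; split; auto|].
    exists k; split; [lia|left]; simpl.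
    rewrite !act_snoc, comp_rf_rf; reflexivity. }
  induction w as [|r w IH] using rev_ind; intros Hi; [exists O; simpl; auto|].
  apply incl_app_inv in Hi as [Hi Hr]; destruct (IH Hi) as [k [Hk E]].
  rewrite act_snoc, length_app; simpl.
  assert (Hr' : r = s \/ r = t).
  { destruct (Hr r (or_introl eq_refl)) as [|[|[]]]; auto. }
  destruct E as [E|E]; rewrite E, <- act_snoc; destruct Hr'; subst r.
  - exists (S k); split; [lia|right; reflexivity].
  - destruct (step s t k) as [k' [Hk' H]]; exists k'; split; [lia|tauto].
  - destruct (step t s k) as [k' [Hk' H]]; exists k'; split; [lia|tauto].
  - exists (S k); split; [lia|left; reflexivity].
Qed.

(** A shortest expression of x is alternating and cannot end in s. For the angle pi/m it has fewer
    than m letters, since otherwise the braid relation would produce an expression ending in s. In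
    this range the coefficients sin(j pi/m)/sin(pi/m), or j for parallel planes, are nonnegative. *)
Lemma dihedral_root s t x : s <> t -> inG [s; t] x ->
  (ell [s; t] x <= ell [s; t] (comp x (rf s)))%nat ->
  exists a b, 0 <= a /\ 0 <= b /\ x (e s) = vadd (vscale a (e s)) (vscale b (e t)).
Proof.
  intros Nst Hx Hl; destruct (ell_word _ _ Hx) as [w [Hw [Ew Lw]]].
  destruct (dihedral_normal_form s t w Hw) as [k [Hk E]]; rewrite Ew, Lw in *.
  assert (Hst : incl (rt k t s) [s; t]) by (intros y Hy; apply rt_incl in Hy; simpl in *; tauto).
  assert (Hts : incl (rt k s t) [s; t]) by apply rt_incl.
  assert (E' : x = act e (rt k s t)).
  { destruct E as [E|E]; auto; destruct k as [|k]; auto; exfalso.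
    simpl in E; rewrite act_snoc in E; rewrite E, comp_rf_rf in Hl.
    pose proof (ell_le [s; t] (rt k s t) (rt_incl k s t)) as H; rewrite length_rt in H.
    pose proof (ell_le [s; t] (rt (S k) t s) Hst) as H'.
    simpl in H'; rewrite act_snoc, <- E in H'; rewrite E in *; lia. }
  assert (K : ell [s; t] x = k).
  { pose proof (ell_le [s; t] (rt k s t) Hts) as H; rewrite length_rt, <- E' in H; lia. }
  clear E Hk Ew Lw Hw w Hst.
  assert (fin : forall (p : nat -> R) c, mink (e s) (e t) = - c ->
    (forall j, p (S (S j)) = 2 * c * p (S j) - p j) -> p O = 0 -> p 1%nat = 1 ->
    0 <= p k -> 0 <= p (S k) ->
    exists a b, 0 <= a /\ 0 <= b /\ x (e s) = vadd (vscale a (e s)) (vscale b (e t))).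
  { intros p c Hc Hp P0 P1 Hk Hk1; pose proof (act_rt s t c p k Hc Hp) as A.
    rewrite P0, P1, <- E' in A.
    replace (vadd (vscale 1 (e s)) (vscale 0 (e t))) with (e s) in A by vec.
    rewrite A; destruct (Nat.even k).
    - exists (p (S k)), (p k); auto.
    - exists (p k), (p (S k)); repeat split; auto; vec. }
  destruct (e_angle s t Nst) as [[m [Hm Hc]]|Hc].
  - pose proof (sin_angle_pos m Hm) as Sp; pose proof (angle_pos m Hm).
    assert (Hkm : (k < m)%nat).
    { destruct (Nat.le_gt_cases m k) as [Hmk|]; auto; exfalso.
      destruct (rt_split (k - m) m s t) as [pre [Hi [Lp Er]]].
      replace (k - m + m)%nat with k in Er by lia.
      destruct m as [|m]; [lia|].
      assert (Ex : comp x (rf s) = act e (pre ++ rt m s t)).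
      { rewrite E', Er, act_app, (act_rt_braid s t (S m) Hm Hc).
        simpl rt; rewrite act_snoc, <- comp_assoc, comp_rf_rf, act_app; reflexivity. }
      rewrite Ex in Hl.
      pose proof (ell_le [s; t] (pre ++ rt m s t) (incl_app Hi (rt_incl m s t))) as H1.
      rewrite length_app, length_rt in H1; lia. }
    assert (Hs : forall j, (j <= m)%nat -> 0 <= sin (INR j * (PI / INR m)) / sin (PI / INR m)).
    { intros j Hj; apply Rmult_le_pos; [|left; apply Rinv_0_lt_compat; auto].
      apply sin_ge_0; [apply Rmult_le_pos; [apply pos_INR|lra]|].
      replace PI with (INR m * (PI / INR m)) at 2 by (field; apply not_0_INR; lia).
      apply Rmult_le_compat_r; [lra|apply le_INR; auto]. }
    apply (fin (fun j => sin (INR j * (PI / INR m)) / sin (PI / INR m)) _ Hc).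
    + intros j; rewrite sin_rec; field; lra.
    + simpl; rewrite Rmult_0_l, sin_0; unfold Rdiv; ring.
    + simpl; rewrite Rmult_1_l; field; lra.
    + apply Hs; lia.
    + apply Hs; lia.
  - apply (fin INR 1); auto using pos_INR.
    intros j; rewrite !S_INR; ring.
Qed.

(* Tits' theorem in Humphreys' form. Peeling off the largest possible dihedral
   factor on the right reduces the claim to shorter elements and to the dihedral
   group generated by s and the last letter of g. *)
Theorem root_in_cone T g s : inG T g -> In s T ->
  (ell T g <= ell T (comp g (rf s)))%nat -> cone T (g (e s)).
Proof.
  remember (ell T g) as n eqn:En; revert g s En.
  induction n as [n IH] using (well_founded_induction Wf_nat.lt_wf); intros g s En Hg Hs Hl.
  destruct n as [|n].
  { rewrite (ell_eq0 T g) by auto; apply cone_e, Hs. }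
  destruct (ell_last T g n Hg (eq_sym En)) as [g' [t [Hg' [Ht [Lg' Eg]]]]].
  assert (Nst : s <> t).
  { intros <-; rewrite Eg, comp_rf_rf in Hl; lia. }
  assert (HI : incl [s; t] T) by (intros y [<-|[<-|[]]]; auto).
  pose (P := fun j => exists v x, inG T v /\ inG [s; t] x /\ g = comp v x /\
               (ell T v + ell [s; t] x <= S n)%nat /\ ell T v = j).
  assert (PH : P n).
  { exists g', (rf t).
    pose proof (ell_rf [s; t] t (or_intror (or_introl eq_refl))).
    repeat split; auto; [apply inG_rf; simpl; auto|lia]. }
  assert (Pmin : exists j, (j <= n)%nat /\ P j /\ forall i, P i -> (j <= i)%nat).
  { exact (least_witness P n PH). }
  destruct Pmin as [j [Hj [[v [x [Hv [Hx [Egv [Hvx Lv]]]]]] Hmin]]].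
  assert (Hroot : forall r, In r [s; t] -> cone T (v (e r))).
  { intros r Hr; apply (IH j); auto; [lia|].
    destruct (Nat.le_gt_cases j (ell T (comp v (rf r)))) as [|Hlt]; auto; exfalso.
    assert (HP : P (ell T (comp v (rf r)))).
    { exists (comp v (rf r)), (comp (rf r) x).
      pose proof (ell_comp [s; t] (rf r) x (inG_rf _ _ Hr) Hx).
      pose proof (ell_rf [s; t] r Hr).
      repeat split; auto.
      - apply inG_comp; auto; apply inG_rf; auto.
      - apply inG_comp; auto; apply inG_rf; auto.
      - rewrite comp_assoc, comp_rf_rf; auto.
      - lia. }
    apply Hmin in HP; lia. }
  destruct (dihedral_root s t x Nst Hx) as [a [b [Ha [Hb Ex]]]].
  { destruct (Nat.le_gt_cases (ell [s; t] x) (ell [s; t] (comp x (rf s)))) as [|Hlt]; auto.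
    exfalso.
    assert (Hxs : inG [s; t] (comp x (rf s))) by (apply inG_comp; auto; apply inG_rf; simpl; auto).
    assert (Eq : comp g (rf s) = comp v (comp x (rf s))) by (rewrite Egv; reflexivity).
    pose proof (ell_comp T v _ Hv (inG_incl T _ _ HI Hxs)).
    pose proof (ell_incl T _ _ HI Hxs); rewrite Eq in Hl; lia. }
  rewrite Egv; unfold comp; rewrite Ex, (inG_linear T v Hv), (vlinear_scale v) by
    (apply (inG_linear T v Hv)).
  apply cone_add; apply cone_scale; auto; apply Hroot; simpl; auto.
Qed.

(** Equal lengths of g and g s are impossible: [root_in_cone], applied to both, would put g e_s and
    its negative into the cone, against [lam]. This takes the place of the usual parity argument. *)
Lemma root_sign T g s : inG T g -> In s T ->
  (ell T (comp g (rf s)) = S (ell T g) /\ cone T (g (e s)) /\ 0 < lam (g (e s))) \/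
  (ell T g = S (ell T (comp g (rf s))) /\ cone T (vscale (-1) (g (e s))) /\ lam (g (e s)) < 0).
Proof.
  intros Hg Hs; assert (Hgs : inG T (comp g (rf s))) by (apply inG_comp; auto; apply inG_rf; auto).
  pose proof (ell_comp T g _ Hg (inG_rf T s Hs)) as U1.
  pose proof (ell_comp T _ _ Hgs (inG_rf T s Hs)) as U2; rewrite comp_rf_rf in U2.
  pose proof (ell_rf T s Hs).
  assert (Ev : comp g (rf s) (e s) = vscale (-1) (g (e s))).
  { unfold comp; rewrite refl_self, vlinear_scale; auto; eapply inG_linear; eauto. }
  assert (pos : (ell T g <= ell T (comp g (rf s)))%nat -> cone T (g (e s)) /\ 0 < lam (g (e s))).
  { intros L; pose proof (root_in_cone T g s Hg Hs L) as C; split; auto.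
    eapply cone_lam_pos; eauto; eapply root_nonzero; eauto. }
  assert (neg : (ell T (comp g (rf s)) <= ell T g)%nat ->
            cone T (vscale (-1) (g (e s))) /\ lam (g (e s)) < 0).
  { intros L.
    assert (C : cone T (vscale (-1) (g (e s)))).
    { rewrite <- Ev; apply root_in_cone; auto; rewrite comp_rf_rf; auto. }
    split; auto; apply cone_lam_pos in C; [rewrite lam_scale in C; lra|].
    rewrite <- Ev; eapply root_nonzero; eauto. }
  destruct (Nat.lt_trichotomy (ell T g) (ell T (comp g (rf s)))) as [L|[L|L]].
  - left; split; [lia|apply pos; lia].
  - exfalso; destruct pos as [_ p], neg as [_ q]; try lia; lra.
  - right; split; [lia|apply neg; lia].
Qed.

(** * Parabolic factorization *)

(** By [root_sign] these conditions say that no generator in [U], respectively each of them,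
    shortens g from the right. The ascending elements are the shortest ones in their cosets g
    W_U. *)
Definition ascending (U : list facet) (g : fn) : Prop := forall s, In s U -> 0 < lam (g (e s)).
Definition descending (U : list facet) (g : fn) : Prop := forall s, In s U -> lam (g (e s)) < 0.

Lemma ascending_cone T U v y : incl U T -> inG T v -> ascending U v -> cone U y -> cone T (v y).
Proof.
  intros HU Hv Ha; apply cone_map; [eapply inG_linear; eauto|].
  intros s Hs; destruct (root_sign T v s Hv (HU s Hs)) as [[_ [C _]]|[_ [_ N]]]; auto.
  specialize (Ha s Hs); lra.
Qed.

(** As v maps the cone of [U] into that of [T], it keeps the sign of every root of the subgroup of
    [U]; hence the descents of v x in [U] are those of x. *)
Lemma factor_sign T U v x s : incl U T -> inG T v -> ascending U v -> inG U x -> In s U ->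
  (0 < lam (v (x (e s))) <-> 0 < lam (x (e s))) /\ (lam (v (x (e s))) < 0 <-> lam (x (e s)) < 0).
Proof.
  intros HU Hv Ha Hx Hs.
  assert (Hc : inG T (comp v x)) by (apply inG_comp; auto; eapply inG_incl; eauto).
  destruct (root_sign T _ s Hc (HU s Hs)) as [[_ [C1 P1]]|[_ [C1 P1]]]; unfold comp in *;
    destruct (root_sign U x s Hx Hs) as [[_ [C2 P2]]|[_ [C2 P2]]]; try (split; split; lra);
    exfalso; apply (ascending_cone T U v) in C2; auto; apply cone_lam in C2.
  - rewrite vlinear_scale, lam_scale in C2 by (eapply inG_linear; eauto); lra.
  - lra.
Qed.

(** Induction on x: its last letter s lengthens the prefix x', so x' e_s is positive, and by
    [factor_sign] so is v x' e_s. *)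
Lemma factor_ell T U v x : incl U T -> inG T v -> ascending U v -> inG U x ->
  ell T (comp v x) = (ell T v + ell U x)%nat.
Proof.
  intros HU Hv Ha; remember (ell U x) as n eqn:En; revert x En.
  induction n as [|n IH]; intros x En Hx.
  - rewrite (ell_eq0 U x), comp_id_r by auto; lia.
  - destruct (ell_last U x n Hx (eq_sym En)) as [x' [s [Hx' [Hs [L E]]]]].
    assert (Hc : inG T (comp v x')) by (apply inG_comp; auto; eapply inG_incl; eauto).
    assert (Hp : 0 < lam (x' (e s))).
    { destruct (root_sign U x' s Hx' Hs) as [[_ [_ P]]|[L' _]]; auto.
      rewrite <- E, <- En, L in L'; lia. }
    apply (factor_sign T U v x' s) in Hp; auto.
    rewrite E, comp_assoc.
    destruct (root_sign T _ s Hc (HU s Hs)) as [[L' _]|[_ [_ P]]]; [|unfold comp in P; lra].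
    rewrite L', (IH x') by auto; lia.
Qed.

Lemma factor_exists T U g : incl U T -> inG T g ->
  exists v x, inG T v /\ ascending U v /\ inG U x /\ g = comp v x.
Proof.
  intros HU; remember (ell T g) as n eqn:En; revert g En.
  induction n as [n IH] using (well_founded_induction Wf_nat.lt_wf); intros g En Hg.
  destruct (classic (ascending U g)) as [Ha|N].
  { exists g, idf; repeat split; auto using inG_id. }
  apply not_all_ex_not in N as [s N]; apply imply_to_and in N as [Hs N].
  assert (Hgs : inG T (comp g (rf s))) by (apply inG_comp; auto; apply inG_rf; auto).
  destruct (root_sign T g s Hg (HU s Hs)) as [[_ [_ P]]|[L _]]; [lra|].
  destruct (IH (ell T (comp g (rf s))) ltac:(lia) _ eq_refl Hgs) as [v [x [Hv [Ha [Hx E]]]]].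
  exists v, (comp x (rf s)); repeat split; auto.
  - apply inG_comp; auto; apply inG_rf; auto.
  - rewrite comp_assoc, <- E, comp_rf_rf; reflexivity.
Qed.

(** The quotients of v by v' and of v' by v lie in the subgroup of [U]; additivity of lengths in
    both directions makes them trivial. *)
Lemma factor_unique T U v x v' x' : incl U T -> inG T v -> inG T v' ->
  ascending U v -> ascending U v' -> inG U x -> inG U x' ->
  comp v x = comp v' x' -> v = v' /\ x = x'.
Proof.
  intros HU Hv Hv' Ha Ha' Hx Hx' E.
  destruct (inG_inv U x Hx) as [y [Hy [xy [yx _]]]].
  destruct (inG_inv U x' Hx') as [y' [Hy' [xy' [yx' _]]]].
  assert (E1 : v = comp v' (comp x' y)) by (rewrite comp_assoc, <- E, <- comp_assoc, xy; reflexivity).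
  assert (E2 : v' = comp v (comp x y')) by (rewrite comp_assoc, E, <- comp_assoc, xy'; reflexivity).
  assert (Hz : inG U (comp x' y)) by (apply inG_comp; auto).
  pose proof (factor_ell T U v' _ HU Hv' Ha' Hz) as L1; rewrite <- E1 in L1.
  pose proof (factor_ell T U v _ HU Hv Ha (inG_comp U _ _ Hx Hy')) as L2; rewrite <- E2 in L2.
  assert (Z : comp x' y = idf) by (apply (ell_eq0 U); auto; lia).
  rewrite Z, comp_id_r in E1; split; auto.
  rewrite <- (comp_id_l x), <- Z, <- comp_assoc, yx; reflexivity.
Qed.

(** The inverse z of y sends the simple roots of [U] to the negative cone, and x turns this cone
    into the positive one. So x z has no descent and is the identity. *)
Lemma descending_unique U x y : inG U x -> inG U y -> descending U x -> descending U y -> x = y.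
Proof.
  intros Hx Hy Dx Dy; destruct (inG_inv U y Hy) as [z [Hz [yz [zy _]]]].
  assert (Dz : forall s, In s U -> cone U (vscale (-1) (z (e s)))).
  { intros s Hs; destruct (root_sign U z s Hz Hs) as [[_ [C _]]|[_ [C _]]]; auto; exfalso.
    assert (Cy : cone U (vscale (-1) (y (z (e s))))).
    { apply (cone_map U U (fun u => vscale (-1) (y u))); auto.
      - intros a u w; rewrite (inG_linear U y Hy); vec.
      - intros r Hr; destruct (root_sign U y r Hy Hr) as [[_ [_ P]]|[_ [C' _]]]; auto.
        specialize (Dy r Hr); lra. }
    change (y (z (e s))) with (comp y z (e s)) in Cy; rewrite yz in Cy.
    apply cone_lam in Cy; rewrite lam_scale in Cy; pose proof (lam_e s); unfold idf in Cy; lra. }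
  assert (Axz : forall s, In s U -> cone U (x (z (e s)))).
  { intros s Hs.
    replace (x (z (e s))) with (vscale (-1) (x (vscale (-1) (z (e s)))))
      by (rewrite (vlinear_scale x) by (eapply inG_linear; eauto); vec).
    apply (cone_map U U (fun u => vscale (-1) (x u))); auto.
    - intros a u w; rewrite (inG_linear U x Hx); vec.
    - intros r Hr; destruct (root_sign U x r Hx Hr) as [[_ [_ P]]|[_ [C' _]]]; auto.
      specialize (Dx r Hr); lra. }
  assert (Hxz : inG U (comp x z)) by (apply inG_comp; auto).
  assert (Z : comp x z = idf).
  { apply (ell_eq0 U); auto.
    destruct (ell U (comp x z)) as [|n] eqn:En; auto; exfalso.
    destruct (ell_last U _ n Hxz En) as [h [s [Hh [Hs [Lh Eh]]]]].
    destruct (root_sign U _ s Hxz Hs) as [[L _]|[_ [_ P]]].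
    - rewrite Eh, comp_rf_rf, Lh, <- Eh, En in L; lia.
    - pose proof (cone_lam _ _ (Axz s Hs)); unfold comp in P; lra. }
  rewrite <- (comp_id_r x), <- zy, comp_assoc, Z; reflexivity.
Qed.


(** * Counting elements by length *)

Definition decb (P : Prop) : bool := if excluded_middle_informative P then true else false.

Lemma decb_true P : decb P = true <-> P.
Proof. unfold decb; destruct (excluded_middle_informative P); split; congruence || auto. Qed.

Definition ind (P : Prop) : Z := if decb P then 1%Z else 0%Z.

Lemma ind_true (P : Prop) : P -> ind P = 1%Z.
Proof. intros H; unfold ind; rewrite (proj2 (decb_true P) H); reflexivity. Qed.

Lemma ind_false (P : Prop) : ~ P -> ind P = 0%Z.
Proof.
  intros H; unfold ind; destruct (decb P) eqn:E; auto; apply (proj1 (decb_true P)) in E; contradiction.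
Qed.

Definition zsum {A} (f : A -> Z) (l : list A) : Z := fold_right Z.add 0%Z (map f l).

Lemma zsum_ext {A} (f g : A -> Z) l : (forall x, In x l -> f x = g x) -> zsum f l = zsum g l.
Proof. intros H; unfold zsum; rewrite (map_ext_in f g); auto. Qed.

Lemma zsum_cons {A} (f : A -> Z) x l : zsum f (x :: l) = (f x + zsum f l)%Z.
Proof. reflexivity. Qed.

Lemma zsum_app {A} (f : A -> Z) l l' : zsum f (l ++ l') = (zsum f l + zsum f l')%Z.
Proof. induction l as [|x l IH]; unfold zsum in *; simpl; [|rewrite IH]; lia. Qed.

Lemma zsum_scale {A} c (f : A -> Z) l : zsum (fun x => c * f x)%Z l = (c * zsum f l)%Z.
Proof. induction l as [|x l IH]; unfold zsum in *; simpl; [|rewrite IH]; lia. Qed.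

Lemma zsum_map {A B} (h : A -> B) (f : B -> Z) l : zsum f (map h l) = zsum (fun x => f (h x)) l.
Proof. unfold zsum; rewrite map_map; reflexivity. Qed.

Lemma zsum_exchange {A B} (f : A -> B -> Z) l l' :
  zsum (fun x => zsum (f x) l') l = zsum (fun y => zsum (fun x => f x y) l) l'.
Proof.
  induction l as [|x l IH]; unfold zsum in *; simpl.
  - induction l' as [|y l' IH']; simpl in *; lia.
  - rewrite IH; clear IH; induction l' as [|y l' IH']; simpl in *; lia.
Qed.

Lemma length_filter_zsum {A} (P : A -> Prop) l :
  Z.of_nat (length (filter (fun x => decb (P x)) l)) = zsum (fun x => ind (P x)) l.
Proof.
  induction l as [|x l IH]; unfold zsum in *; simpl; auto.
  unfold ind at 1; destruct (decb (P x)); simpl length; lia.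
Qed.

Lemma smul_zsum f g n : smul f g n = zsum (fun i => f i * g (n - i)%nat)%Z (seq 0 (S n)).
Proof.
  revert f; induction n as [|n IH]; intros f; [unfold zsum; simpl; lia|].
  rewrite smul_S, IH; change (seq 0 (S (S n))) with (0%nat :: seq 1 (S n)).
  rewrite <- seq_shift, zsum_cons, zsum_map; reflexivity.
Qed.

Lemma NoDup_flat_map {A B} (f : A -> list B) l : NoDup l -> (forall x, In x l -> NoDup (f x)) ->
  (forall x y z, In x l -> In y l -> In z (f x) -> In z (f y) -> x = y) -> NoDup (flat_map f l).
Proof.
  induction l as [|x l IH]; simpl; intros Hl Hf Hd; [constructor|].
  inversion Hl as [|? ? Hx Hl']; subst; apply NoDup_app; auto.
  - apply IH; auto; intros; eapply Hd; eauto.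
  - intros z Hz Hz'; apply in_flat_map in Hz' as [y [Hy Hz']].
    apply Hx; rewrite (Hd x y z); auto.
Qed.

Lemma length_flat_map_zsum {A B} (f : A -> list B) l :
  Z.of_nat (length (flat_map f l)) = zsum (fun x => Z.of_nat (length (f x))) l.
Proof.
  induction l as [|x l IH]; unfold zsum in *; simpl; auto; rewrite length_app; lia.
Qed.

Lemma NoDup_same_length {A} (l l' : list A) : NoDup l -> NoDup l' ->
  (forall x, In x l <-> In x l') -> length l = length l'.
Proof.
  intros N N' H; apply Nat.le_antisymm; apply NoDup_incl_length; auto; intros x; apply H.
Qed.

Fixpoint words (n : nat) : list (list facet) :=
  match n with
  | O => [[]]
  | S k => flat_map (fun w => map (fun s => s :: w) [FB; F1; F2; F3; F4]) (words k)
  end.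

Lemma in_words w : In w (words (length w)).
Proof.
  induction w as [|s w IH]; simpl; auto.
  apply in_flat_map; exists w; split; auto; destruct s; simpl; auto 10.
Qed.

(** Finite because every element of length n comes from a word of length n in the five letters;
    membership, length and equality of maps are decided classically. *)
Definition sph (T : list facet) (n : nat) : list fn :=
  filter (fun g => decb (inG T g /\ ell T g = n))
    (nodup (fun f g => excluded_middle_informative (f = g)) (map (act e) (words n))).

Lemma in_sph T n g : In g (sph T n) <-> inG T g /\ ell T g = n.
Proof.
  unfold sph; rewrite filter_In, decb_true; split; [tauto|].
  intros H; split; auto; apply nodup_In; destruct H as [Hg <-].
  destruct (ell_word T g Hg) as [w [_ [<- <-]]]; apply in_map, in_words.
Qed.

Lemma sph_NoDup T n : NoDup (sph T n).
Proof. apply NoDup_filter, NoDup_nodup. Qed.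

Definition cnt (T : list facet) (P : fn -> Prop) : ser :=
  fun n => Z.of_nat (length (filter (fun g => decb (P g)) (sph T n))).

(** The coset factorization is a length-additive bijection, which a product of generating functions
    encodes; the property counted depends on the factor x alone. *)
Lemma cnt_factor T U (P Q : fn -> Prop) : incl U T ->
  (forall v x, inG T v -> ascending U v -> inG U x -> (P (comp v x) <-> Q x)) ->
  cnt T P = smul (cnt T (ascending U)) (cnt U Q).
Proof.
  intros HU HPQ; apply functional_extensionality; intros n; rewrite smul_zsum.
  set (A := fun i => filter (fun g => decb (ascending U g)) (sph T i)).
  set (B := fun i => filter (fun g => decb (Q g)) (sph U i)).
  assert (HA : forall i v, In v (A i) <-> (inG T v /\ ell T v = i) /\ ascending U v)
    by (intros; unfold A; rewrite filter_In, decb_true, in_sph; tauto).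
  assert (HB : forall i v, In v (B i) <-> (inG U v /\ ell U v = i) /\ Q v)
    by (intros; unfold B; rewrite filter_In, decb_true, in_sph; tauto).
  set (F := fun i => map (fun vx => comp (fst vx) (snd vx)) (list_prod (A i) (B (n - i)%nat))).
  assert (HF : forall i g, In g (F i) <-> exists v x, In v (A i) /\ In x (B (n - i)%nat) /\
             g = comp v x).
  { intros i g; unfold F; rewrite in_map_iff; split.
    - intros [[v x] [<- H]]; apply in_prod_iff in H as [H1 H2]; exists v, x; auto.
    - intros [v [x [Hv [Hx ->]]]]; exists (v, x); split; auto; apply in_prod; auto. }
  transitivity (Z.of_nat (length (flat_map F (seq 0 (S n))))).
  - unfold cnt; f_equal; apply NoDup_same_length.
    + apply NoDup_filter, sph_NoDup.
    + apply NoDup_flat_map; [apply seq_NoDup| |].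
      * intros i _; unfold F; apply NoDup_map_NoDup_ForallPairs.
        -- intros [v x] [v' x'] H H' E; apply in_prod_iff in H as [H1 H2], H' as [H1' H2'].
           apply HA in H1, H1'; apply HB in H2, H2'; simpl in E.
           destruct (factor_unique T U v x v' x') as [-> ->]; tauto.
        -- assert (NoDup (A i)) by (apply NoDup_filter, sph_NoDup).
           assert (NB : NoDup (B (n - i)%nat)) by (apply NoDup_filter, sph_NoDup).
           induction H as [|v l Hv Hl IH]; simpl; [constructor|].
           apply NoDup_app; auto.
           ++ apply NoDup_map_NoDup_ForallPairs; auto; intros ? ? _ _ E; congruence.
           ++ intros [v' x'] H1 H2; apply in_map_iff in H1 as [y [E _]].
              apply in_prod_iff in H2; destruct H2; congruence.
      * intros i j g _ _ Hi Hj; apply HF in Hi as [v [x [H1 [H2 ->]]]].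
        apply HF in Hj as [v' [x' [H1' [H2' E]]]].
        apply HA in H1, H1'; apply HB in H2, H2'.
        destruct (factor_unique T U v x v' x') as [-> _]; try tauto.
        destruct H1 as [[_ <-] _], H1' as [[_ <-] _]; reflexivity.
    + intros g; rewrite filter_In, decb_true, in_sph, in_flat_map; split.
      * intros [[Hg Lg] Pg]; destruct (factor_exists T U g HU Hg) as [v [x [Hv [Ha [Hx E]]]]].
        pose proof (factor_ell T U v x HU Hv Ha Hx) as L; rewrite <- E, Lg in L.
        exists (ell T v); split; [apply in_seq; lia|].
        apply HF; exists v, x; rewrite HA, HB; repeat split; auto; [lia|].
        apply (HPQ v x); auto; rewrite <- E; auto.
      * intros [i [Hi H]]; apply HF in H as [v [x [H1 [H2 ->]]]].
        apply HA in H1 as [[H1 L1] Ha]; apply HB in H2 as [[H2 L2] HQ].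
        rewrite (factor_ell T U), L1, L2; auto.
        apply in_seq in Hi; split; [split; [|lia]|apply HPQ; auto].
        apply inG_comp; auto; eapply inG_incl; eauto.
  - rewrite length_flat_map_zsum; apply zsum_ext; intros i _; unfold F, cnt.
    fold (A i) (B (n - i)%nat); rewrite length_map, length_prod; lia.
Qed.

(** * Inclusion-exclusion over descent sets *)

Fixpoint sublists (T : list facet) : list (list facet) :=
  match T with
  | [] => [[]]
  | s :: T' => sublists T' ++ map (cons s) (sublists T')
  end.

Lemma sublists_incl T V : In V (sublists T) -> incl V T.
Proof.
  revert V; induction T as [|s T IH]; simpl; intros V HV.
  - destruct HV as [<-|[]]; apply incl_refl.
  - apply in_app_or in HV as [HV|HV].
    + apply incl_tl, IH, HV.
    + apply in_map_iff in HV as [V' [<- HV]]; apply incl_cons; [left; auto|].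
      apply incl_tl, IH, HV.
Qed.

Definition parity (V : list facet) : Z := if Nat.even (length V) then 1%Z else (-1)%Z.

Lemma parity_cons s V : parity (s :: V) = (- parity V)%Z.
Proof.
  unfold parity; simpl length; rewrite Nat.even_succ, <- Nat.negb_even.
  destruct (Nat.even (length V)); reflexivity.
Qed.

(** Only subsets of the descent set D contribute, and the sum of (-1)^|V| over them is (1 -
    1)^|D|. *)
Lemma alternating_descents T g :
  zsum (fun V => parity V * ind (descending V g))%Z (sublists T) =
  ind (forall s, In s T -> ~ lam (g (e s)) < 0).
Proof.
  induction T as [|s T IH].
  - unfold zsum; simpl; rewrite !ind_true; [reflexivity|intros s []|intros s []].
  - simpl sublists; rewrite zsum_app, zsum_map, IH.
    destruct (classic (lam (g (e s)) < 0)) as [D|D].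
    + rewrite (zsum_ext _ (fun V => -1 * (parity V * ind (descending V g)))%Z).
      * rewrite zsum_scale, IH, (ind_false (forall r, In r (s :: T) -> _)); [lia|].
        intros H; apply (H s); simpl; auto.
      * intros V _; rewrite parity_cons.
        replace (ind (descending (s :: V) g)) with (ind (descending V g)); [ring|].
        unfold ind; replace (decb (descending (s :: V) g)) with (decb (descending V g)); auto.
        apply Bool.eq_true_iff_eq; rewrite !decb_true; split.
        -- intros H r [<-|Hr]; auto.
        -- intros H r Hr; apply H; right; auto.
    + rewrite (zsum_ext _ (fun V => 0 * 0)%Z), zsum_scale.
      * unfold ind; replace (decb (forall r, In r (s :: T) -> _))
          with (decb (forall r, In r T -> ~ lam (g (e r)) < 0)); [lia|].
        apply Bool.eq_true_iff_eq; rewrite !decb_true; split.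
        -- intros H r [<-|Hr]; auto.
        -- intros H r Hr; apply H; right; auto.
      * intros V _; rewrite ind_false; [ring|].
        intros H; apply D, (H s); left; auto.
Qed.

Lemma no_descent T g : inG T g -> (forall s, In s T -> ~ lam (g (e s)) < 0) -> g = idf.
Proof.
  intros Hg N; apply (ell_eq0 T); auto; destruct (ell T g) as [|n] eqn:En; auto; exfalso.
  destruct (ell_last T _ n Hg En) as [h [s [Hh [Hs [Lh Eh]]]]].
  destruct (root_sign T _ s Hg Hs) as [[L _]|[_ [_ P]]].
  - rewrite Eh, comp_rf_rf, Lh, <- Eh, En in L; lia.
  - apply (N s); auto.
Qed.

Lemma ascending_idf T s : In s T -> ~ lam (idf (e s)) < 0.
Proof. intros _; unfold idf; pose proof (lam_e s); lra. Qed.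

Definition ssum (l : list ser) : ser := fold_right sadd (scst 0) l.

Lemma ssum_zsum {A} (f : A -> ser) l n : ssum (map f l) n = zsum (fun x => f x n) l.
Proof.
  induction l as [|x l IH]; [destruct n; reflexivity|].
  unfold zsum in *; simpl; unfold sadd; rewrite IH; reflexivity.
Qed.

Lemma sph_0 T : sph T 0 = [idf].
Proof.
  assert (H : forall g, In g (sph T 0) <-> In g [idf]).
  { intros g; rewrite in_sph; simpl; split.
    - intros [Hg E]; left; symmetry; apply (ell_eq0 T); auto.
    - intros [<-|[]]; split; [apply inG_id|apply ell_id]. }
  pose proof (NoDup_same_length _ _ (sph_NoDup T 0) (NoDup_cons idf (@in_nil _ _) (NoDup_nil _)) H) as L.
  destruct (sph T 0) as [|g [|]]; try discriminate.
  f_equal; destruct (proj1 (H g) (or_introl eq_refl)) as [|[]]; auto.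
Qed.

(** Summed over a sphere, [alternating_descents] counts the elements without descents, and the
    identity is the only one. *)
Lemma inclusion_exclusion T :
  ssum (map (fun V => smul (scst (parity V)) (cnt T (descending V))) (sublists T)) = scst 1.
Proof.
  apply functional_extensionality; intros n; rewrite ssum_zsum.
  rewrite (zsum_ext _ (fun V => zsum (fun g => parity V * ind (descending V g))%Z (sph T n))).
  2:{ intros V _; rewrite smul_cst; unfold cnt; rewrite length_filter_zsum, zsum_scale; auto. }
  rewrite zsum_exchange, (zsum_ext _ _ _ (fun g _ => alternating_descents T g)).
  destruct n as [|n].
  - rewrite sph_0; unfold zsum; simpl; rewrite ind_true; [reflexivity|apply ascending_idf].
  - rewrite (zsum_ext _ (fun g => 0 * 0)%Z), zsum_scale; [simpl; lia|].
    intros g Hg; apply in_sph in Hg as [Hg L]; apply ind_false; intros N.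
    rewrite (no_descent T g Hg N), ell_id in L; discriminate.
Qed.

Definition wser (T : list facet) : ser := cnt T (fun _ => True).
Definition vser (T : list facet) : ser := sinv (wser T).
Definition lser (T : list facet) : ser := cnt T (descending T).

Lemma wser_0 T : wser T O = 1%Z.
Proof.
  unfold wser, cnt; rewrite length_filter_zsum, sph_0; unfold zsum; simpl.
  rewrite ind_true; auto.
Qed.

Lemma wser_length T n : wser T n = Z.of_nat (length (sph T n)).
Proof.
  unfold wser, cnt; f_equal; f_equal.
  apply forallb_filter_id, forallb_forall; intros; apply decb_true; exact I.
Qed.

Lemma wser_vser T : smul (wser T) (vser T) = scst 1.
Proof. apply sinv_spec, wser_0. Qed.

(* Steinberg's formula: the term of V is (-1)^|V| t^N / W_V(t) with N the length of
   the longest element of W_V, and vanishes when there is none. *)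
Theorem growth_inverse T :
  vser T = ssum (map (fun V => smul (scst (parity V)) (smul (lser V) (vser V))) (sublists T)).
Proof.
  apply (smul_cancel (wser T)); [apply wser_0|].
  rewrite wser_vser, <- (inclusion_exclusion T).
  assert (H : forall V, In V (sublists T) ->
    smul (scst (parity V)) (cnt T (descending V)) =
    smul (wser T) (smul (scst (parity V)) (smul (lser V) (vser V)))).
  { intros V HV; apply sublists_incl in HV.
    (* An element descending on V is a coset representative times an element of W_V descending on V.
       The series of representatives is thus a common factor of both counts. *)
    assert (E1 : cnt T (descending V) = smul (cnt T (ascending V)) (lser V)).
    { apply cnt_factor; auto; intros v x Hv Ha Hx; unfold comp.
      split; intros D s Hs; apply (factor_sign T V v x s); auto; apply D; auto. }
    assert (E2 : wser T = smul (cnt T (ascending V)) (wser V))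
      by (apply cnt_factor; auto; tauto).
    rewrite E1, E2.
    transitivity (smul (smul (scst (parity V)) (smul (cnt T (ascending V)) (lser V)))
                       (smul (wser V) (vser V))); [rewrite wser_vser; ring|ring]. }
  rewrite (map_ext_in _ _ _ H); clear H.
  induction (sublists T) as [|V l IH]; simpl; [|rewrite IH]; ring.
Qed.

Lemma lser_longest U x : inG U x -> descending U x -> lser U = sX (ell U x).
Proof.
  intros Hx Dx; apply functional_extensionality; intros n.
  unfold lser, cnt, sX.
  destruct (Nat.eqb_spec n (ell U x)) as [->|N].
  - rewrite (NoDup_same_length _ [x]); [reflexivity|apply NoDup_filter, sph_NoDup| |].
    + repeat constructor; auto.
    + intros g; rewrite filter_In, decb_true, in_sph; simpl; split.
      * intros [[Hg _] Dg]; left; apply (descending_unique U); auto.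
      * intros [<-|[]]; auto.
  - rewrite (NoDup_same_length _ (@nil fn)); [reflexivity|apply NoDup_filter, sph_NoDup|constructor|].
    intros g; rewrite filter_In, decb_true, in_sph; simpl; split; [|tauto].
    intros [[Hg L] Dg]; apply N; rewrite <- L; f_equal; apply (descending_unique U); auto.
Qed.

Lemma lser_none U : (forall x, inG U x -> ~ descending U x) -> lser U = scst 0.
Proof.
  intros H; apply functional_extensionality; intros n; unfold lser, cnt.
  rewrite (NoDup_same_length _ (@nil fn)); [destruct n; reflexivity
    |apply NoDup_filter, sph_NoDup|constructor|].
  intros g; rewrite filter_In, decb_true, in_sph; simpl; split; [|tauto].
  intros [[Hg L] Dg]; apply (H g); auto.
Qed.

(* A vector of the cone of I that is orthogonal to I is fixed by the group of I, but an
   element with all descents would send it to the opposite cone. *)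
Lemma lser_degenerate I U n : incl I U -> cone I n -> 0 < lam n ->
  (forall s, In s I -> mink n (e s) = 0) -> lser U = scst 0.
Proof.
  intros HI Hn Ln On; apply lser_none; intros g Hg Dg.
  destruct (factor_exists U I g HI Hg) as [v [x [Hv [Ha [Hx ->]]]]].
  assert (Fx : x n = n).
  { destruct Hx as [w [Hw <-]]; clear -Hw On; induction w as [|s w IH]; simpl; auto.
    rewrite IH by (intros r Hr; apply Hw; right; auto).
    unfold refl; rewrite On by (apply Hw; left; auto); vec. }
  assert (C : cone I (vscale (-1) (x n))).
  { apply (cone_map I I (fun u => vscale (-1) (x u))); auto.
    - intros a u w; rewrite (inG_linear I x Hx); vec.
    - intros s Hs; destruct (root_sign I x s Hx Hs) as [[_ [_ P]]|[_ [C' _]]]; auto.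
      apply (factor_sign U I v x s) in P; auto.
      specialize (Dg s (HI s Hs)); unfold comp in Dg; lra. }
  rewrite Fx in C; apply cone_lam in C; rewrite lam_scale in C; lra.
Qed.

(** A certificate that a word is reduced: each prefix sends the next simple root to positive height,
    so each letter adds one to the length. *)
Lemma ell_rising U w : incl w U ->
  (forall p s q, w = p ++ s :: q -> 0 < lam (act e p (e s))) -> ell U (act e w) = length w.
Proof.
  induction w as [|s w IH] using rev_ind; intros Hw H; [apply ell_id|].
  apply incl_app_inv in Hw as [Hw Hs]; specialize (Hs s (or_introl eq_refl)).
  assert (L : ell U (act e w) = length w).
  { apply IH; auto; intros p r q E; apply (H p r (q ++ [s])); rewrite E, <- app_assoc; auto. }
  rewrite act_snoc, length_app; simpl.
  destruct (root_sign U (act e w) s) as [[L' _]|[_ [_ P]]]; auto; [exists w; auto|lia|].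
  specialize (H w s [] eq_refl); lra.
Qed.

End ReflectionGroup.

(** * The Gram matrix of a Coxeter pyramid *)

Definition causal (w : Vec4) : Prop := 0 < c0 w /\ mink w w <= 0.

(** Lagrange's identity for the spatial parts: for x orthogonal to w, c0(w)^2 <x,x> equals -<w,w>
    |x|^2 plus the squared length of the spatial cross product. *)
Lemma causal_orth_nonneg w x : causal w -> mink x w = 0 -> 0 <= mink x x.
Proof.
  intros [W0 W] O.
  assert (H : 0 <= c0 w * c0 w * mink x x).
  { replace (c0 w * c0 w * mink x x) with
      (- mink w w * (c1 x * c1 x + c2 x * c2 x + c3 x * c3 x)
       + ((c1 x * c2 w - c2 x * c1 w) * (c1 x * c2 w - c2 x * c1 w)
          + (c1 x * c3 w - c3 x * c1 w) * (c1 x * c3 w - c3 x * c1 w)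
          + (c2 x * c3 w - c3 x * c2 w) * (c2 x * c3 w - c3 x * c2 w))
       + mink x w * (mink x w + 2 * (c0 x * c0 w))) by (unfold mink; ring).
    rewrite O, Rmult_0_l, Rplus_0_r; apply Rplus_le_le_0_compat.
    - apply Rmult_le_pos; [lra|].
      repeat apply Rplus_le_le_0_compat; apply Rle_0_sqr.
    - repeat apply Rplus_le_le_0_compat; apply Rle_0_sqr. }
  destruct (Rle_lt_dec 0 (mink x x)) as [|N]; auto; exfalso.
  assert (0 < c0 w * c0 w) by nra; nra.
Qed.

(** The spatial part d of c0(w) n - c0(n) w has squared length at most 0, so n is proportional to
    w. *)
Lemma causal_null_parallel w n y : causal w -> mink n w = 0 -> mink n n = 0 ->
  c0 w * mink n y = c0 n * mink w y.
Proof.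
  intros [W0 W] O N.
  set (d1 := c0 w * c1 n - c0 n * c1 w); set (d2 := c0 w * c2 n - c0 n * c2 w);
    set (d3 := c0 w * c3 n - c0 n * c3 w).
  assert (S : d1 * d1 + d2 * d2 + d3 * d3 <= 0).
  { replace (d1 * d1 + d2 * d2 + d3 * d3) with
      (c0 w * c0 w * mink n n - 2 * c0 w * c0 n * mink n w + c0 n * c0 n * mink w w)
      by (unfold d1, d2, d3, mink; ring).
    rewrite O, N; nra. }
  assert (d1 = 0) by nra; assert (d2 = 0) by nra; assert (d3 = 0) by nra.
  apply Rminus_diag_uniq.
  replace (c0 w * mink n y - c0 n * mink w y) with (d1 * c1 y + d2 * c2 y + d3 * c3 y)
    by (unfold d1, d2, d3, mink; ring).
  rewrite H, H0, H1; ring.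
Qed.

Definition det3 (a1 a2 a3 b1 b2 b3 d1 d2 d3 : R) : R :=
  a1 * (b2 * d3 - b3 * d2) - a2 * (b1 * d3 - b3 * d1) + a3 * (b1 * d2 - b2 * d1).

Definition sdet (x y z : Vec4) : R :=
  det3 (c1 x) (c2 x) (c3 x) (c1 y) (c2 y) (c3 y) (c1 z) (c2 z) (c3 z).

(** Cramer's relation among four vectors of the three-dimensional complement of w. Spatial minors
    suffice as coefficients because orthogonality to w determines c0. *)
Lemma orth_dependency w x1 x2 x3 x4 y : causal w ->
  mink x1 w = 0 -> mink x2 w = 0 -> mink x3 w = 0 -> mink x4 w = 0 ->
  sdet x2 x3 x4 * mink x1 y - sdet x1 x3 x4 * mink x2 y
  + sdet x1 x2 x4 * mink x3 y - sdet x1 x2 x3 * mink x4 y = 0.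
Proof.
  intros [W0 _] O1 O2 O3 O4.
  assert (T : forall x, mink x w = 0 ->
            c0 x = (c1 x * c1 w + c2 x * c2 w + c3 x * c3 w) / c0 w).
  { intros x O; unfold mink in O; field_simplify_eq; lra. }
  unfold mink; rewrite (T x1), (T x2), (T x3), (T x4) by auto.
  unfold sdet, det3; field; lra.
Qed.

Lemma det3_mul a1 a2 a3 b1 b2 b3 d1 d2 d3 p1 p2 p3 q1 q2 q3 r1 r2 r3 :
  det3 a1 a2 a3 b1 b2 b3 d1 d2 d3 * det3 p1 p2 p3 q1 q2 q3 r1 r2 r3 =
  det3 (a1*p1+a2*p2+a3*p3) (a1*q1+a2*q2+a3*q3) (a1*r1+a2*r2+a3*r3)
       (b1*p1+b2*p2+b3*p3) (b1*q1+b2*q2+b3*q3) (b1*r1+b2*r2+b3*r3)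
       (d1*p1+d2*p2+d3*p3) (d1*q1+d2*q2+d3*q3) (d1*r1+d2*r2+d3*r3).
Proof. unfold det3; ring. Qed.

(** The products of x, y, z with p, q, r form a triangular matrix with nonzero diagonal, whose
    determinant is a multiple of [sdet x y z]. *)
Lemma sdet_nonzero w x y z p q r : causal w ->
  mink x w = 0 -> mink y w = 0 -> mink z w = 0 ->
  mink x q = 0 -> mink x r = 0 -> mink y r = 0 ->
  mink x p <> 0 -> mink y q <> 0 -> mink z r <> 0 -> sdet x y z <> 0.
Proof.
  intros [W0 _] Ox Oy Oz Xq Xr Yr Xp Yq Zr D.
  (* Subtracting [h b] times w removes the time coordinate of b and keeps its products with vectors
     orthogonal to w, so that [det3_mul] applies. *)
  pose (h := fun b : Vec4 => c0 b / c0 w).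
  pose proof (det3_mul (c1 x) (c2 x) (c3 x) (c1 y) (c2 y) (c3 y) (c1 z) (c2 z) (c3 z)
    (c1 p - h p * c1 w) (c2 p - h p * c2 w) (c3 p - h p * c3 w)
    (c1 q - h q * c1 w) (c2 q - h q * c2 w) (c3 q - h q * c3 w)
    (c1 r - h r * c1 w) (c2 r - h r * c2 w) (c3 r - h r * c3 w)) as E.
  fold (sdet x y z) in E; rewrite D, Rmult_0_l in E.
  assert (K : forall u b, mink u w = 0 ->
    c1 u * (c1 b - h b * c1 w) + c2 u * (c2 b - h b * c2 w) + c3 u * (c3 b - h b * c3 w)
    = mink u b).
  { intros u b O; unfold h.
    replace (mink u b) with (mink u b - c0 b / c0 w * mink u w) by (rewrite O; ring).
    unfold mink; field; lra. }
  rewrite !K, Xq, Xr, Yr in E by auto; unfold det3 in E.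
  assert (F : mink x p * (mink y q * mink z r) = 0) by lra.
  apply Rmult_integral in F as [|F]; auto; apply Rmult_integral in F as [|]; auto.
Qed.

Lemma opposite_sign a b x y : a * x + b * y = 0 -> x < 0 -> y < 0 ->
  (0 < a -> b < 0) /\ (a < 0 -> 0 < b).
Proof. intros; split; intros; nra. Qed.

Lemma angle_cos_nonneg m : (2 <= m)%nat -> 0 <= cos (PI / INR m).
Proof. intros Hm; pose proof (angle_pos m Hm); pose proof PI_RGT_0; apply cos_ge_0; lra. Qed.

Section PyramidGram.

Variable e : facet -> Vec4.
Variable v : vertex -> Vec4.
Hypothesis HP : is_coxeter_pyramid e v.

Let e_unit : forall f, mink (e f) (e f) = 1 := proj1 HP.
Let v_causal : forall p, causal (v p) := proj1 (proj2 HP).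
Let v_inc : forall p f, incident p f = true -> mink (v p) (e f) = 0 := proj1 (proj2 (proj2 HP)).
Let v_out : forall p f, incident p f = false -> mink (v p) (e f) < 0
  := proj1 (proj2 (proj2 (proj2 HP))).
Let v_angle : forall f g, adjacent f g = true ->
     (exists m : nat, (2 <= m)%nat /\ mink (e f) (e g) = - cos (PI / INR m))
     \/ mink (e f) (e g) = -1 := proj2 (proj2 (proj2 (proj2 (proj2 HP)))).

(** Interior because each facet misses at least one vertex; it serves as the base point of [lam]. *)
Definition center : Vec4 :=
  vadd (v Apex) (vadd (v B1) (vadd (v B2) (vadd (v B3) (v B4)))).

Lemma center_neg f : mink (e f) center < 0.
Proof.
  unfold center; rewrite !mink_add_r, !(mink_sym (e f)).
  assert (H : forall p, mink (v p) (e f) <= 0).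
  { intros p; destruct (incident p f) eqn:E; [rewrite (v_inc p f E)|pose proof (v_out p f E)]; lra. }
  pose proof (H Apex); pose proof (H B1); pose proof (H B2); pose proof (H B3); pose proof (H B4).
  destruct f.
  - pose proof (v_out Apex FB eq_refl); lra.
  - pose proof (v_out B3 F1 eq_refl); lra.
  - pose proof (v_out B4 F2 eq_refl); lra.
  - pose proof (v_out B1 F3 eq_refl); lra.
  - pose proof (v_out B2 F4 eq_refl); lra.
Qed.

Lemma adjacent_nonpos f g : adjacent f g = true -> mink (e f) (e g) <= 0.
Proof.
  intros H; destruct (v_angle f g H) as [[m [Hm ->]]| -> ]; [|lra].
  pose proof (angle_cos_nonneg m Hm); lra.
Qed.

(** Four normals orthogonal to the apex are dependent. At a base vertex two of the terms vanish and
    the other two must balance, which fixes the signs of the coefficients. *)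
Lemma side_dependency : exists p1 p2 p3 p4, 0 < p1 /\ 0 < p2 /\ 0 < p3 /\ 0 < p4 /\
  forall y, p1 * mink (e F1) y + p3 * mink (e F3) y = p2 * mink (e F2) y + p4 * mink (e F4) y.
Proof.
  assert (A : forall f, f <> FB -> mink (e f) (v Apex) = 0).
  { intros f Hf; rewrite mink_sym; apply v_inc; destruct f; auto; congruence. }
  set (a1 := sdet (e F2) (e F3) (e F4)); set (a2 := sdet (e F1) (e F3) (e F4));
    set (a3 := sdet (e F1) (e F2) (e F4)); set (a4 := sdet (e F1) (e F2) (e F3)).
  assert (D : forall y, a1 * mink (e F1) y - a2 * mink (e F2) y + a3 * mink (e F3) y
                        - a4 * mink (e F4) y = 0).
  { intros y; apply (orth_dependency (v Apex)); auto; apply A; discriminate. }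
  (* The vertices B4, B1, B2 make the matrix of products with the normals of F1, F2, F3
     triangular. *)
  assert (N4 : a4 <> 0).
  { apply (sdet_nonzero (v Apex) (e F1) (e F2) (e F3) (v B4) (v B1) (v B2)); auto;
      try (apply A; discriminate); rewrite mink_sym;
      try (apply v_inc; reflexivity); apply Rlt_not_eq, v_out; reflexivity. }
  assert (I : forall p f, incident p f = true -> mink (e f) (v p) = 0)
    by (intros; rewrite mink_sym; auto).
  assert (O : forall p f, incident p f = false -> mink (e f) (v p) < 0)
    by (intros; rewrite mink_sym; auto).
  pose proof (D (v B2)) as D2; rewrite (I B2 F1), (I B2 F2) in D2 by reflexivity.
  pose proof (D (v B3)) as D3; rewrite (I B3 F2), (I B3 F3) in D3 by reflexivity.
  pose proof (D (v B4)) as D4; rewrite (I B4 F3), (I B4 F4) in D4 by reflexivity.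
  pose proof (opposite_sign a3 (- a4) (mink (e F3) (v B2)) (mink (e F4) (v B2))
    ltac:(lra) (O B2 F3 eq_refl) (O B2 F4 eq_refl)) as S34.
  pose proof (opposite_sign (- a4) a1 (mink (e F4) (v B3)) (mink (e F1) (v B3))
    ltac:(lra) (O B3 F4 eq_refl) (O B3 F1 eq_refl)) as S41.
  pose proof (opposite_sign (- a4) a3 (mink (e F4) (v B2)) (mink (e F3) (v B2))
    ltac:(lra) (O B2 F4 eq_refl) (O B2 F3 eq_refl)) as S43.
  pose proof (opposite_sign a1 (- a2) (mink (e F1) (v B4)) (mink (e F2) (v B4))
    ltac:(lra) (O B4 F1 eq_refl) (O B4 F2 eq_refl)) as S12.
  destruct (Rtotal_order a4 0) as [L|[L|L]]; [|contradiction|].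
  - exists (- a1), (- a2), (- a3), (- a4); repeat split; try lra.
    intros y; specialize (D y); lra.
  - exists a1, a2, a3, a4; repeat split; try lra.
    intros y; specialize (D y); lra.
Qed.

(** The vector u, given by either side of the dependency, is orthogonal to the apex, so <u,u> >= 0.
    Pairing one expression of u with the other gives a sum of nonpositive adjacent terms. Hence u is
    null and these terms vanish; then p^2 + q^2 + 2 p q x = 0 with x >= -1 gives x = -1. *)
Lemma side_gram : mink (e F1) (e F2) = 0 /\ mink (e F2) (e F3) = 0 /\ mink (e F3) (e F4) = 0 /\
  mink (e F4) (e F1) = 0 /\ mink (e F1) (e F3) = -1 /\ mink (e F2) (e F4) = -1.
Proof.
  destruct side_dependency as [p1 [p2 [p3 [p4 [P1 [P2 [P3 [P4 D]]]]]]]].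
  assert (A : forall f, f <> FB -> mink (e f) (v Apex) = 0).
  { intros f Hf; rewrite mink_sym; apply v_inc; destruct f; auto; congruence. }
  assert (opp : forall f g, f <> FB -> g <> FB -> -1 <= mink (e f) (e g)).
  { intros f g Hf Hg.
    assert (0 <= mink (vadd (e f) (e g)) (vadd (e f) (e g))) as H.
    { apply (causal_orth_nonneg (v Apex)); auto; rewrite mink_add_l, !A; auto; ring. }
    rewrite !mink_add_l, !mink_add_r, !e_unit, (mink_sym (e g)) in H; lra. }
  set (u := vadd (vscale p1 (e F1)) (vscale p3 (e F3))).
  assert (Hu : 0 <= mink u u).
  { apply (causal_orth_nonneg (v Apex)); auto; unfold u.
    rewrite mink_add_l, !mink_scale_l, !A by discriminate; ring. }
  assert (Eu : mink u u = p1 * p1 + p3 * p3 + 2 * (p1 * p3) * mink (e F1) (e F3)).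
  { unfold u; rewrite !mink_add_l, !mink_scale_l, !mink_add_r, !mink_scale_r, !e_unit,
      (mink_sym (e F3)); ring. }
  assert (uy : forall y, mink u y = p2 * mink (e F2) y + p4 * mink (e F4) y).
  { intros y; rewrite <- D; unfold u; rewrite mink_add_l, !mink_scale_l; ring. }
  assert (Eu' : mink u u = p2 * p2 + p4 * p4 + 2 * (p2 * p4) * mink (e F2) (e F4)).
  { rewrite uy, (mink_sym _ u), (mink_sym _ u), !uy, !e_unit, (mink_sym (e F4) (e F2)); ring. }
  assert (Ec : mink u u = p1 * p2 * mink (e F1) (e F2) + p2 * p3 * mink (e F2) (e F3)
                          + p3 * p4 * mink (e F3) (e F4) + p4 * p1 * mink (e F4) (e F1)).
  { rewrite uy; unfold u; rewrite !mink_add_r, !mink_scale_r, (mink_sym (e F2) (e F1)),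
      (mink_sym (e F4) (e F3)); ring. }
  assert (Q12 : 0 < p1 * p2) by nra; assert (Q23 : 0 < p2 * p3) by nra;
    assert (Q34 : 0 < p3 * p4) by nra; assert (Q41 : 0 < p4 * p1) by nra;
    assert (Q13 : 0 < p1 * p3) by nra; assert (Q24 : 0 < p2 * p4) by nra.
  pose proof (adjacent_nonpos F1 F2 eq_refl); pose proof (adjacent_nonpos F2 F3 eq_refl);
    pose proof (adjacent_nonpos F3 F4 eq_refl); pose proof (adjacent_nonpos F4 F1 eq_refl).
  pose proof (opp F1 F3 ltac:(discriminate) ltac:(discriminate)) as O13.
  pose proof (opp F2 F4 ltac:(discriminate) ltac:(discriminate)) as O24.
  assert (p1 * p2 * mink (e F1) (e F2) <= 0) by nra.
  assert (p2 * p3 * mink (e F2) (e F3) <= 0) by nra.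
  assert (p3 * p4 * mink (e F3) (e F4) <= 0) by nra.
  assert (p4 * p1 * mink (e F4) (e F1) <= 0) by nra.
  assert (Z : mink u u = 0) by lra.
  assert (zero : forall k x, 0 < k -> k * x = 0 -> x = 0).
  { intros k x Hk E; apply Rmult_integral in E as [|]; lra. }
  assert (opp_eq : forall p q x, 0 < p * q -> -1 <= x ->
            p * p + q * q + 2 * (p * q) * x = 0 -> x = -1).
  { intros p q x Hpq Hx E.
    assert (p * q * (x + 1) <= 0) by (pose proof (Rle_0_sqr (p - q)) as S; unfold Rsqr in S; nra).
    destruct Hx as [Hx|]; auto; exfalso.
    assert (0 < p * q * (x + 1)) by (apply Rmult_lt_0_compat; lra); lra. }
  repeat split.
  - apply (zero (p1 * p2)); lra.
  - apply (zero (p2 * p3)); lra.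
  - apply (zero (p3 * p4)); lra.
  - apply (zero (p4 * p1)); lra.
  - apply (opp_eq p1 p3); lra.
  - apply (opp_eq p2 p4); lra.
Qed.

(** The sum of the two parallel normals is null and orthogonal to the apex, hence a nonzero multiple
    of it; if it were orthogonal to e_FB, the apex would lie on the base plane. *)
Lemma base_not_orthogonal f g : f <> FB -> g <> FB -> mink (e f) (e g) = -1 ->
  ~ (mink (e FB) (e f) = 0 /\ mink (e FB) (e g) = 0).
Proof.
  intros Hf Hg Hfg [Zf Zg].
  assert (A : forall f, f <> FB -> mink (e f) (v Apex) = 0).
  { intros h Hh; rewrite mink_sym; apply v_inc; destruct h; auto; congruence. }
  set (n := vadd (e f) (e g)).
  assert (On : mink n (v Apex) = 0) by (unfold n; rewrite mink_add_l, !A by auto; ring).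
  assert (Nn : mink n n = 0)
    by (unfold n; rewrite !mink_add_l, !mink_add_r, !e_unit, (mink_sym (e g)), Hfg; ring).
  pose proof (causal_null_parallel (v Apex) n (e FB) (v_causal Apex) On Nn) as P1.
  pose proof (causal_null_parallel (v Apex) n center (v_causal Apex) On Nn) as P2.
  assert (Z : mink n (e FB) = 0)
    by (unfold n; rewrite mink_add_l, (mink_sym (e f)), (mink_sym (e g)), Zf, Zg; ring).
  rewrite Z, Rmult_0_r in P1.
  pose proof (v_out Apex FB eq_refl) as O.
  assert (c0 n = 0) by (symmetry in P1; apply Rmult_integral in P1 as [|]; auto; lra).
  assert (mink n center < 0)
    by (unfold n; rewrite mink_add_l; pose proof (center_neg f); pose proof (center_neg g); lra).
  destruct (v_causal Apex) as [W0 _]; rewrite H, Rmult_0_l in P2.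
  apply Rmult_integral in P2 as [|]; lra.
Qed.

(** The complement of the vertex is semidefinite, and y, the part of e_FB orthogonal to e_f and e_g,
    has square 1 - a^2 - b^2. *)
Lemma base_vertex_bound p f g : incident p FB = true -> incident p f = true ->
  incident p g = true -> mink (e f) (e g) = 0 ->
  mink (e FB) (e f) * mink (e FB) (e f) + mink (e FB) (e g) * mink (e FB) (e g) <= 1.
Proof.
  intros IB If Ig O.
  set (a := mink (e FB) (e f)); set (b := mink (e FB) (e g)).
  set (y := vadd (e FB) (vadd (vscale (- a) (e f)) (vscale (- b) (e g)))).
  assert (0 <= mink y y) as H.
  { apply (causal_orth_nonneg (v p)); auto; unfold y.
    rewrite !mink_add_l, !mink_scale_l, (mink_sym (e FB)), (mink_sym (e f)), (mink_sym (e g)).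
    rewrite !v_inc by auto; ring. }
  unfold y in H; rewrite !mink_add_l, !mink_scale_l, !mink_add_r, !mink_scale_r, !e_unit,
    (mink_sym (e g) (e f)), (mink_sym (e f) (e FB)), (mink_sym (e g) (e FB)), O in H.
  fold a b in H; lra.
Qed.

End PyramidGram.

(** * The numbers 2 cos(pi/m) and the possible base angles *)

Lemma cos_angle_lt m k : (2 <= m < k)%nat -> cos (PI / INR m) < cos (PI / INR k).
Proof.
  intros [Hm Hk]; pose proof (angle_pos m Hm); pose proof (angle_pos k ltac:(lia)).
  pose proof PI_RGT_0; apply cos_decreasing_1; try lra.
  unfold Rdiv; apply Rmult_lt_compat_l; [lra|].
  pose proof (lt_INR _ _ Hk); pose proof (le_INR _ _ Hm) as H4; simpl in H4.
  apply Rinv_lt_contravar; [nra|lra].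
Qed.

Definition theta (m : nat) : R := 2 * cos (PI / INR m).

Lemma theta_2 : theta 2 = 0.
Proof. unfold theta; replace (INR 2) with 2 by (simpl; ring); rewrite cos_PI2; ring. Qed.

Lemma theta_3 : theta 3 = 1.
Proof. unfold theta; replace (INR 3) with 3 by (simpl; ring); rewrite cos_PI3; field. Qed.

Lemma theta_4 : theta 4 * theta 4 = 2.
Proof.
  unfold theta; replace (INR 4) with 4 by (simpl; ring); rewrite cos_PI4.
  pose proof (sqrt_lt_R0 2 ltac:(lra)).
  replace (2 * (1 / sqrt 2) * (2 * (1 / sqrt 2))) with (4 / (sqrt 2 * sqrt 2)) by (field; lra).
  rewrite sqrt_sqrt by lra; field.
Qed.

(* With a = pi/5 one has sin 3a = sin 2a. *)
Lemma theta_5 : theta 5 * theta 5 = theta 5 + 1.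
Proof.
  pose proof (sin_angle_pos 5 ltac:(lia)) as S; unfold theta.
  set (a := PI / INR 5) in *.
  assert (E : sin (2 * a + a) = sin (2 * a)).
  { rewrite <- sin_PI_x; f_equal; unfold a; replace (INR 5) with 5 by (simpl; ring); field. }
  rewrite sin_plus, sin_2a, cos_2a_cos in E.
  apply (Rmult_eq_reg_l (sin a)); [|lra].
  pose proof (sin2_cos2 a) as SC; unfold Rsqr in SC; nra.
Qed.

Lemma theta_6 : theta 6 * theta 6 = 3.
Proof.
  unfold theta; replace (INR 6) with 6 by (simpl; ring); rewrite cos_PI6.
  replace (2 * (sqrt 3 / 2) * (2 * (sqrt 3 / 2))) with (sqrt 3 * sqrt 3) by field.
  apply sqrt_sqrt; lra.
Qed.

Lemma theta_nonneg m : (2 <= m)%nat -> 0 <= theta m.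
Proof. intros Hm; unfold theta; pose proof (angle_cos_nonneg m Hm); lra. Qed.

Lemma theta_lt m k : (2 <= m < k)%nat -> theta m < theta k.
Proof. intros H; unfold theta; pose proof (cos_angle_lt m k H); lra. Qed.

Lemma theta_ge_1 m : (3 <= m)%nat -> 1 <= theta m.
Proof.
  intros Hm; destruct (Nat.eq_dec m 3) as [->|]; [rewrite theta_3; lra|].
  pose proof (theta_lt 3 m ltac:(lia)); rewrite theta_3 in *; lra.
Qed.

(** That is 1/a + 1/b >= 1/2: at a base vertex the angles pi/2, pi/a, pi/b add up to at least pi. *)
Definition okpair (a b : nat) : bool := Nat.leb (a * b) (2 * (a + b)).
Definition inrange (a : nat) : bool := Nat.leb 2 a && Nat.leb a 6.
(** For entries from 2 on, a sum above 4 says that two opposite base angles are not both right. *)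
Definition admissible (a b c d : nat) : bool :=
  inrange a && inrange b && inrange c && inrange d &&
  okpair a b && okpair b c && okpair c d && okpair d a &&
  Nat.ltb 4 (a + c) && Nat.ltb 4 (b + d).

Lemma inrange_cases a : inrange a = true -> a = 2%nat \/ a = 3%nat \/ a = 4%nat \/ a = 5%nat \/ a = 6%nat.
Proof.
  intros H; apply Bool.andb_true_iff in H as [H1 H2]; apply Nat.leb_le in H1, H2; lia.
Qed.

Lemma theta_okpair a b : inrange a = true -> inrange b = true ->
  theta a * theta a + theta b * theta b <= 4 -> okpair a b = true.
Proof.
  intros Ra Rb H.
  pose proof theta_4; pose proof theta_5; pose proof theta_6.
  pose proof (theta_nonneg 4 ltac:(lia)); pose proof (theta_nonneg 5 ltac:(lia)).
  pose proof (theta_lt 4 5 ltac:(lia)).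
  destruct (inrange_cases a Ra) as [ | [ | [ | [ | ]]]]; subst a;
    destruct (inrange_cases b Rb) as [ | [ | [ | [ | ]]]]; subst b;
    try reflexivity; exfalso; nra.
Qed.

(* The m_i are bounded because each base angle has a non-right neighbour. *)
Lemma theta_bound m x : (2 <= m)%nat -> 1 <= x -> theta m * theta m + x * x <= 4 -> (m <= 6)%nat.
Proof.
  intros Hm Hx H; destruct (Nat.le_gt_cases m 6) as [|L]; auto; exfalso.
  pose proof (theta_lt 6 m ltac:(lia)); pose proof theta_6.
  pose proof (theta_nonneg 6 ltac:(lia)); nra.
Qed.

Record pyramid_data (e : facet -> Vec4) (x0 : Vec4) (a b c d : nat) : Prop := {
  pd_unit : forall s, mink (e s) (e s) = 1;
  pd_neg : forall s, mink (e s) x0 < 0;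
  pd_12 : mink (e F1) (e F2) = 0;
  pd_23 : mink (e F2) (e F3) = 0;
  pd_34 : mink (e F3) (e F4) = 0;
  pd_14 : mink (e F1) (e F4) = 0;
  pd_13 : mink (e F1) (e F3) = -1;
  pd_24 : mink (e F2) (e F4) = -1;
  pd_B1 : mink (e FB) (e F1) = - cos (PI / INR a);
  pd_B2 : mink (e FB) (e F2) = - cos (PI / INR b);
  pd_B3 : mink (e FB) (e F3) = - cos (PI / INR c);
  pd_B4 : mink (e FB) (e F4) = - cos (PI / INR d);
  pd_adm : admissible a b c d = true
}.

Lemma pyramid_classification e v : is_coxeter_pyramid e v ->
  exists x0 a b c d, pyramid_data e x0 a b c d.
Proof.
  intros HP.
  destruct (side_gram e v HP) as [G12 [G23 [G34 [G41 [G13 G24]]]]].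
  pose proof (base_vertex_bound e v HP B2 F1 F2 eq_refl eq_refl eq_refl G12) as V12.
  pose proof (base_vertex_bound e v HP B3 F2 F3 eq_refl eq_refl eq_refl G23) as V23.
  pose proof (base_vertex_bound e v HP B4 F3 F4 eq_refl eq_refl eq_refl G34) as V34.
  pose proof (base_vertex_bound e v HP B1 F4 F1 eq_refl eq_refl eq_refl G41) as V41.
  pose proof (base_not_orthogonal e v HP F1 F3 ltac:(discriminate) ltac:(discriminate) G13) as N13.
  pose proof (base_not_orthogonal e v HP F2 F4 ltac:(discriminate) ltac:(discriminate) G24) as N24.
  pose proof (proj2 (proj2 (proj2 (proj2 (proj2 HP))))) as ang.
  (* A base angle that is not right has cosine at least cos(pi/3) = 1/2. *)
  assert (pos : forall f, adjacent FB f = true -> mink (e FB) (e f) = 0 \/ mink (e FB) (e f) <= -1/2).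
  { intros f Hf; destruct (ang FB f Hf) as [[m [Hm ->]]|E]; [|right; lra].
    destruct (Nat.eq_dec m 2) as [->|].
    - pose proof theta_2 as T; unfold theta in T; left; lra.
    - pose proof (theta_ge_1 m ltac:(lia)) as T; unfold theta in T; right; lra. }
  pose proof (pos F1 eq_refl) as Q1; pose proof (pos F2 eq_refl) as Q2;
    pose proof (pos F3 eq_refl) as Q3; pose proof (pos F4 eq_refl) as Q4.
  assert (W13 : mink (e FB) (e F1) <= -1/2 \/ mink (e FB) (e F3) <= -1/2).
  { destruct Q1, Q3; auto; exfalso; apply N13; auto. }
  assert (W24 : mink (e FB) (e F2) <= -1/2 \/ mink (e FB) (e F4) <= -1/2).
  { destruct Q2, Q4; auto; exfalso; apply N24; auto. }
  (* The witness x belongs to a neighbouring side: the two neighbours of a side are opposite to each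
     other, so one of them is not orthogonal to the base. As x^2 >= 1/4, the angle 0 is impossible
     and m <= 6. *)
  assert (get : forall f, adjacent FB f = true ->
    (exists x, x <= -1/2 /\ mink (e FB) (e f) * mink (e FB) (e f) + x * x <= 1) ->
    exists m, (2 <= m <= 6)%nat /\ mink (e FB) (e f) = - cos (PI / INR m)).
  { intros f Hf [x [Hx Hb]]; destruct (ang FB f Hf) as [[m [Hm E]]|E].
    - exists m; split; auto; split; auto.
      rewrite E in Hb; apply (theta_bound m (-2 * x)); auto; unfold theta; nra.
    - exfalso; rewrite E in Hb; nra. }
  destruct (get F1 eq_refl) as [a [Ra Ea]].
  { destruct W24; eexists; split; eauto; lra. }
  destruct (get F2 eq_refl) as [b [Rb Eb]].
  { destruct W13; eexists; split; eauto; lra. }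
  destruct (get F3 eq_refl) as [c [Rc Ec]].
  { destruct W24; eexists; split; eauto; lra. }
  destruct (get F4 eq_refl) as [d [Rd Ed]].
  { destruct W13; eexists; split; eauto; lra. }
  exists (center v), a, b, c, d; constructor; auto.
  - apply HP.
  - apply (center_neg e v HP).
  - rewrite mink_sym; auto.
  - assert (rg : forall m, (2 <= m <= 6)%nat -> inrange m = true).
    { intros m Hm; apply Bool.andb_true_iff; split; apply Nat.leb_le; lia. }
    rewrite Ea, Eb in V12; rewrite Eb, Ec in V23; rewrite Ec, Ed in V34; rewrite Ed, Ea in V41.
    assert (wide : forall f g k l, mink (e FB) (e f) = - cos (PI / INR k) ->
      mink (e FB) (e g) = - cos (PI / INR l) -> (2 <= k)%nat -> (2 <= l)%nat ->
      mink (e FB) (e f) <= -1/2 \/ mink (e FB) (e g) <= -1/2 -> (4 <? k + l)%nat = true).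
    { intros f g k l Ek El Hk Hl W; apply Nat.ltb_lt.
      destruct (Nat.le_gt_cases (k + l) 4) as [L|]; auto; exfalso.
      replace k with 2%nat in * by lia; replace l with 2%nat in * by lia.
      pose proof theta_2 as T; unfold theta in T; rewrite Ek, El in W; lra. }
    unfold admissible; rewrite !rg by lia.
    rewrite !theta_okpair by (auto; unfold theta; lra).
    rewrite (wide F1 F3 a c), (wide F2 F4 b d) by (auto; lia); reflexivity.
Qed.

(** * Longest elements of the vertex groups *)

Inductive letter := LB | Lf | Lg.

(* Coordinates on e_B, e_f, e_g in Z[theta] where theta^2 = al * theta + be; the pair (p, q)
   stands for p + q * theta. *)
Definition zt := (Z * Z)%type.
Definition ztadd (x y : zt) : zt := (fst x + fst y, snd x + snd y)%Z.
Definition ztopp (x : zt) : zt := (- fst x, - snd x)%Z.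
Definition ztmul (al be : Z) (x y : zt) : zt :=
  (fst x * fst y + be * (snd x * snd y),
   fst x * snd y + snd x * fst y + al * (snd x * snd y))%Z.
(** Sufficient for a nonnegative value, as theta is nonnegative, but not necessary. *)
Definition ztnonneg (x : zt) : bool := Z.leb 0 (fst x) && Z.leb 0 (snd x).
Definition ztev (th : R) (x : zt) : R := IZR (fst x) + IZR (snd x) * th.

Definition coords := (zt * zt * zt)%type.

Definition crefl (al be : Z) (tf tg : zt) (l : letter) (x : coords) : coords :=
  let '(b, f, g) := x in
  match l with
  | LB => (ztadd (ztopp b) (ztadd (ztmul al be tf f) (ztmul al be tg g)), f, g)
  | Lf => (b, ztadd (ztopp f) (ztmul al be tf b), g)
  | Lg => (b, f, ztadd (ztopp g) (ztmul al be tg b))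
  end.

Definition cbasis (l : letter) : coords :=
  let o : zt := (0, 0)%Z in let i : zt := (1, 0)%Z in
  match l with LB => (i, o, o) | Lf => (o, i, o) | Lg => (o, o, i) end.

Definition croot (al be : Z) (tf tg : zt) (w : list letter) (l : letter) : coords :=
  fold_right (crefl al be tf tg) (cbasis l) w.

Definition cnonneg (x : coords) : bool :=
  let '(b, f, g) := x in ztnonneg b && ztnonneg f && ztnonneg g.
Definition copp (x : coords) : coords := let '(b, f, g) := x in (ztopp b, ztopp f, ztopp g).

Fixpoint crising (al be : Z) (tf tg : zt) (p w : list letter) : bool :=
  match w with
  | [] => true
  | l :: q => cnonneg (croot al be tf tg p l) && crising al be tf tg (p ++ [l]) q
  end.

Definition letter_eqb (x y : letter) : bool :=
  match x, y with LB, LB | Lf, Lf | Lg, Lg => true | _, _ => false end.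

Definition clongest (al be : Z) (tf tg : zt) (U w : list letter) : bool :=
  forallb (fun l => existsb (letter_eqb l) U) w && crising al be tf tg [] w &&
  forallb (fun l => cnonneg (copp (croot al be tf tg w l))) U.

Definition minpoly_theta (m : nat) : Z * Z :=
  match m with
  | 3%nat => (0, 1)%Z | 4%nat => (0, 2)%Z | 5%nat => (1, 1)%Z | 6%nat => (0, 3)%Z
  | _ => (0, 0)%Z
  end.
Definition zt_theta (m : nat) : zt :=
  match m with 2%nat => (0, 0)%Z | 3%nat => (1, 0)%Z | _ => (0, 1)%Z end.

(** One quadratic ring suffices: in an [okpair] within range whose larger entry is at least 4, the
    other entry is 2 or 3, with rational theta, or equal to it. *)
Definition longest_check (mf mg : nat) (U w : list letter) : bool :=
  let (al, be) := minpoly_theta (Nat.max mf mg) in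
  clongest al be (zt_theta mf) (zt_theta mg) U w.

Lemma ztev_add th x y : ztev th (ztadd x y) = ztev th x + ztev th y.
Proof. unfold ztev, ztadd; simpl; rewrite !plus_IZR; ring. Qed.

Lemma ztev_opp th x : ztev th (ztopp x) = - ztev th x.
Proof. unfold ztev, ztopp; simpl; rewrite !opp_IZR; ring. Qed.

Lemma ztev_mul th al be x y : th * th = IZR al * th + IZR be ->
  ztev th (ztmul al be x y) = ztev th x * ztev th y.
Proof.
  intros H; unfold ztev, ztmul; simpl; rewrite !plus_IZR, !mult_IZR.
  replace ((IZR (fst x) + IZR (snd x) * th) * (IZR (fst y) + IZR (snd y) * th)) with
    (IZR (fst x) * IZR (fst y) + (IZR (fst x) * IZR (snd y) + IZR (snd x) * IZR (fst y)) * th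
     + IZR (snd x) * IZR (snd y) * (th * th)) by ring.
  rewrite H; ring.
Qed.

Lemma ztev_nonneg th x : 0 <= th -> ztnonneg x = true -> 0 <= ztev th x.
Proof.
  intros Hth H; apply Bool.andb_true_iff in H as [H1 H2].
  apply Z.leb_le, IZR_le in H1, H2; unfold ztev.
  assert (0 <= IZR (snd x) * th) by (apply Rmult_le_pos; auto); lra.
Qed.

Lemma theta_minpoly m : inrange m = true ->
  let (al, be) := minpoly_theta m in theta m * theta m = IZR al * theta m + IZR be.
Proof.
  intros H; destruct (inrange_cases m H) as [ | [ | [ | [ | ]]]]; subst m; simpl.
  - rewrite theta_2; ring.
  - rewrite theta_3; ring.
  - rewrite theta_4; ring.
  - rewrite theta_5; ring.
  - rewrite theta_6; ring.
Qed.

Lemma ztev_theta mf mg : inrange mf = true -> inrange mg = true -> okpair mf mg = true ->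
  ztev (theta (Nat.max mf mg)) (zt_theta mf) = theta mf /\
  ztev (theta (Nat.max mf mg)) (zt_theta mg) = theta mg.
Proof.
  intros Hf Hg; pose proof theta_2; pose proof theta_3.
  destruct (inrange_cases mf Hf) as [ | [ | [ | [ | ]]]]; subst mf;
    destruct (inrange_cases mg Hg) as [ | [ | [ | [ | ]]]]; subst mg;
    intros E; try discriminate E; unfold ztev; simpl; lra.
Qed.

(** * Cyclotomic denominators *)

Fixpoint ppow (p : list Z) (n : nat) : list Z :=
  match n with O => [1%Z] | S k => pmul p (ppow p k) end.

(* The cyclotomic polynomials of index 2, 3, 4, 5, 6, 10. *)
Definition phis : list (list Z) :=
  [[1; 1]; [1; 1; 1]; [1; 0; 1]; [1; 1; 1; 1; 1]; [1; -1; 1]; [1; -1; 1; -1; 1]]%Z.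

Definition cyc (x : list nat) : list Z :=
  fold_right (fun pe acc => pmul (ppow (fst pe) (snd pe)) acc) [1%Z] (combine phis x).

(** The triple (s, n, x) stands for s t^n divided by the product of the polynomials [phis] with
    exponents x. *)
Definition term := (Z * nat * list nat)%type.

Definition exps_map2 (f : nat -> nat -> nat) (x y : list nat) : list nat :=
  map (fun p => f (fst p) (snd p)) (combine x y).

Definition exps_lcm (ts : list term) : list nat :=
  fold_right (fun t acc => exps_map2 Nat.max (snd t) acc) [0; 0; 0; 0; 0; 0]%nat ts.

Definition numer (L : list nat) (ts : list term) : list Z :=
  fold_right (fun t acc => let '(s, n, x) := t in
     padd (pscale s (pshift n (cyc (exps_map2 Nat.sub L x)))) acc) [] ts.

Fixpoint peqb (a b : list Z) : bool :=
  match a, b with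
  | [], _ => forallb (Z.eqb 0) b
  | _, [] => forallb (Z.eqb 0) a
  | x :: a', y :: b' => Z.eqb x y && peqb a' b'
  end.

(** Confirms that the truncated subtraction of exponents in [numer] gives genuine cofactors. *)
Definition divides_check (L : list nat) (ts : list term) : bool :=
  forallb (fun t => peqb (cyc L) (pmul (cyc (snd t)) (cyc (exps_map2 Nat.sub L (snd t))))) ts.

Lemma peqb_nil a : forallb (Z.eqb 0) a = true -> ps a = ps [].
Proof.
  intros H; apply functional_extensionality; intros n; unfold ps.
  revert n; induction a as [|x a IH]; intros [|n]; auto;
    cbn [forallb] in H; apply Bool.andb_true_iff in H as [H1 H2].
  - apply Z.eqb_eq in H1; auto.
  - simpl nth at 1; rewrite (IH H2 n); destruct n; reflexivity.
Qed.

Lemma peqb_ps a b : peqb a b = true -> ps a = ps b.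
Proof.
  revert b; induction a as [|x a IH]; intros b H.
  - symmetry; apply peqb_nil; destruct b; auto.
  - destruct b as [|y b]; [apply peqb_nil, H|].
    simpl in H; apply Bool.andb_true_iff in H as [H1 H2]; apply Z.eqb_eq in H1.
    rewrite !ps_cons, H1, (IH b H2); reflexivity.
Qed.

(** For v = 1/W this says W = [cyc x]; sign and power of t matter only in [tsum]. *)
Definition inverts (t : term) (v : ser) : Prop := smul (ps (cyc (snd t))) v = scst 1.

Definition tsum (ts : list term) (vs : list ser) : ser :=
  fold_right (fun tv acc =>
    sadd (smul (scst (fst (fst (fst tv)))) (smul (sX (snd (fst (fst tv)))) (snd tv))) acc)
    (scst 0) (combine ts vs).

Lemma tsum_numer L ts vs : divides_check L ts = true -> Forall2 inverts ts vs ->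
  smul (ps (cyc L)) (tsum ts vs) = ps (numer L ts).
Proof.
  intros C F; induction F as [|[[s n] x] v ts vs Hi F IH].
  - unfold tsum; simpl; rewrite ps_nil; ring.
  - cbn [divides_check forallb] in C; apply Bool.andb_true_iff in C as [C1 C2].
    cbn [numer fold_right]; fold (numer L ts); rewrite ps_add, ps_scale, ps_shift, <- (IH C2).
    unfold tsum; cbn [combine fold_right]; fold (tsum ts vs).
    apply peqb_ps in C1; rewrite ps_mul in C1; unfold inverts in Hi; cbn [fst snd] in *.
    set (y := ps (cyc (exps_map2 Nat.sub L x))) in *.
    assert (A : smul (ps (cyc L)) (smul (scst s) (smul (sX n) v)) = smul (scst s) (smul (sX n) y)).
    { rewrite C1.
      transitivity (smul (smul (ps (cyc x)) v) (smul (scst s) (smul (sX n) y))); [ring|].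
      rewrite Hi; ring. }
    rewrite <- A; ring.
Qed.

(** For a finite group the unknown v = 1/W occurs on both sides of Steinberg's formula: v is the sum
    over proper subsets plus s t^n v. The check solves this with d = 1 - s t^n and compares with
    1/[cyc x]; the constant term 1 permits cancellation. *)
Definition solve_check (ts : list term) (s : Z) (n : nat) (x : list nat) : bool :=
  let L := exps_lcm ts in
  let d := padd [1%Z] (pscale (- s) (pshift n [1%Z])) in
  divides_check L ts &&
  peqb (pmul (cyc x) (numer L ts)) (pmul d (cyc L)) &&
  Z.eqb (hd 0%Z (pmul d (cyc L))) 1.

Lemma solve_inverts ts vs v s n x : Forall2 inverts ts vs ->
  v = sadd (tsum ts vs) (smul (scst s) (smul (sX n) v)) ->
  solve_check ts s n x = true -> inverts (s, n, x) v.
Proof.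
  intros F E C; unfold solve_check in C; set (L := exps_lcm ts) in *.
  apply Bool.andb_true_iff in C as [C C3]; apply Bool.andb_true_iff in C as [C1 C2].
  set (d := padd [1%Z] (pscale (- s) (pshift n [1%Z]))) in *.
  apply peqb_ps in C2; rewrite !ps_mul, <- (tsum_numer L ts vs C1 F) in C2.
  apply Z.eqb_eq in C3.
  assert (D : ps d = ssub (scst 1) (smul (scst s) (sX n))).
  { unfold d; rewrite ps_add, ps_scale, ps_shift, ps_cons, ps_nil.
    replace (scst (- s)) with (sopp (scst s))
      by (apply functional_extensionality; intros [|k]; reflexivity).
    ring. }
  assert (T : tsum ts vs = smul (ps d) v).
  { rewrite D, E at 1; set (y := tsum ts vs) in *.
    transitivity (ssub v (smul (scst s) (smul (sX n) v))); [rewrite E at 1; ring|].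
    rewrite <- E; ring. }
  unfold inverts; cbn [snd]; apply (smul_cancel (smul (ps d) (ps (cyc L)))).
  - rewrite <- ps_mul; unfold ps; destruct (pmul d (cyc L)); auto.
  - rewrite T in C2; transitivity (smul (ps (cyc x)) (smul (ps (cyc L)) (smul (ps d) v))); [ring|].
    rewrite C2; ring.
Qed.

(** * Growth polynomials and longest words of the vertex groups *)

Definition exps_1 : list nat := [1; 0; 0; 0; 0; 0]%nat.
(** The dihedral polynomial [2][m], with [k] = 1 + t + ... + t^(k-1), factored into cyclotomic
    polynomials. *)
Definition exps_pair (m : nat) : list nat :=
  match m with
  | 2 => [2; 0; 0; 0; 0; 0]
  | 3 => [1; 1; 0; 0; 0; 0]
  | 4 => [2; 0; 1; 0; 0; 0]
  | 5 => [1; 0; 0; 1; 0; 0]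
  | _ => [2; 1; 0; 0; 1; 0]
  end%nat.
(** A reducible group contributes a further factor [2]. The other cases are A3, B3, H3 with degrees
    2, 3, 4, then 2, 4, 6 and 2, 6, 10. *)
Definition exps_triple (mf mg : nat) : list nat :=
  if Nat.eqb mf 2 then exps_map2 Nat.add exps_1 (exps_pair mg)
  else if Nat.eqb mg 2 then exps_map2 Nat.add exps_1 (exps_pair mf)
  else match (mf + mg)%nat with
       | 6 => [2; 1; 1; 0; 0; 0]
       | 7 => [3; 1; 1; 0; 1; 0]
       | _ => [3; 1; 0; 1; 1; 1]
       end%nat.

Fixpoint alternating (n : nat) (x y : letter) : list letter :=
  match n with O => [] | S k => x :: alternating k y x end.
Fixpoint coxeter_power (n : nat) : list letter :=
  match n with O => [] | S k => Lf :: Lg :: LB :: coxeter_power k end.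

(* In the irreducible cases the longest element is the (h/2)-th power of the bipartite
   Coxeter element, h = 4, 6, 10 being the Coxeter number of A3, B3, H3. *)
Definition triple_word (mf mg : nat) : list letter :=
  if Nat.eqb mf 2 then Lf :: alternating mg LB Lg
  else if Nat.eqb mg 2 then Lg :: alternating mf LB Lf
  else coxeter_power (match (mf + mg)%nat with 6 => 2 | 7 => 3 | _ => 5 end%nat).

(** The strict form of [okpair]: the angle sum exceeds pi and the vertex group is finite. *)
Definition spherical (mf mg : nat) : bool := Nat.ltb (mf * mg) (2 * (mf + mg)).
Definition triple_len (mf mg : nat) : nat := length (triple_word mf mg).

Definition one_term : term := (1%Z, 0%nat, [0; 0; 0; 0; 0; 0]%nat).
Definition t1 : term := ((-1)%Z, 1%nat, exps_1).
Definition t2 (m : nat) : term := (1%Z, m, exps_pair m).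
Definition t3 (mf mg : nat) : term := ((-1)%Z, triple_len mf mg, exps_triple mf mg).

Definition words_check (mf mg : nat) : bool :=
  longest_check mf mg [LB] [LB] && longest_check mf mg [Lf] [Lf] &&
  longest_check mf mg [Lg] [Lg] && longest_check mf mg [Lf; Lg] [Lf; Lg] &&
  longest_check mf mg [LB; Lf] (alternating mf LB Lf) &&
  longest_check mf mg [LB; Lg] (alternating mg LB Lg) &&
  (negb (spherical mf mg) || longest_check mf mg [LB; Lf; Lg] (triple_word mf mg)).

Definition pairs_check (m : nat) : bool := solve_check [one_term; t1; t1] 1 m (exps_pair m).

(** In the order of [sublists [FB; f; g]], without the full set, whose term is the unknown. *)
Definition triple_terms (mf mg : nat) : list term :=
  [one_term; t1; t1; t2 2; t1; t2 mg; t2 mf].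
Definition triples_check (mf mg : nat) : bool :=
  negb (spherical mf mg) ||
  solve_check (triple_terms mf mg) (-1) (triple_len mf mg) (exps_triple mf mg).

Lemma triple_checks mf mg : inrange mf = true -> inrange mg = true -> okpair mf mg = true ->
  (words_check mf mg && pairs_check mf && pairs_check mg && triples_check mf mg)%bool = true.
Proof.
  intros Hf Hg.
  destruct (inrange_cases mf Hf) as [ | [ | [ | [ | ]]]]; subst mf;
    destruct (inrange_cases mg Hg) as [ | [ | [ | [ | ]]]]; subst mg;
    intros E; try discriminate E; vm_compute; reflexivity.
Qed.

Section VertexGroup.

Variable e : facet -> Vec4.
Variable x0 : Vec4.
Hypothesis e_unit : forall s, mink (e s) (e s) = 1.
Hypothesis e_angle : forall s t, s <> t ->
  (exists m : nat, (2 <= m)%nat /\ mink (e s) (e t) = - cos (PI / INR m))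
  \/ mink (e s) (e t) = -1.
Hypothesis e_neg : forall s, mink (e s) x0 < 0.
Variables f g : facet.
Variables mf mg : nat.
Hypothesis Rf : inrange mf = true.
Hypothesis Rg : inrange mg = true.
Hypothesis Rfg : okpair mf mg = true.
Hypothesis Gfg : mink (e f) (e g) = 0.
Hypothesis GBf : mink (e FB) (e f) = - cos (PI / INR mf).
Hypothesis GBg : mink (e FB) (e g) = - cos (PI / INR mg).

Definition interp (l : letter) : facet := match l with LB => FB | Lf => f | Lg => g end.

Definition cvec (th : R) (x : coords) : Vec4 :=
  let '(b, y, z) := x in
  vadd (vscale (ztev th b) (e FB)) (vadd (vscale (ztev th y) (e f)) (vscale (ztev th z) (e g))).

Lemma crefl_cvec th al be tf tg l x : th * th = IZR al * th + IZR be ->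
  ztev th tf = theta mf -> ztev th tg = theta mg ->
  refl (e (interp l)) (cvec th x) = cvec th (crefl al be tf tg l x).
Proof.
  intros Hth Ef Eg; destruct x as [[b y] z]; unfold cvec, refl.
  assert (Hf : mink (e f) (e FB) = - (theta mf / 2)) by (rewrite mink_sym, GBf; unfold theta; field).
  assert (Hg : mink (e g) (e FB) = - (theta mg / 2)) by (rewrite mink_sym, GBg; unfold theta; field).
  destruct l; simpl interp; simpl crefl; rewrite !mink_add_l, !mink_scale_l, ?e_unit,
    ?(mink_sym (e FB)), ?(mink_sym (e g) (e f)), ?Gfg, ?Hf, ?Hg;
    rewrite !ztev_add, !ztev_opp, !(ztev_mul th al be), ?Ef, ?Eg by auto; vec; field.
Qed.

Lemma croot_cvec th al be tf tg w l : th * th = IZR al * th + IZR be ->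
  ztev th tf = theta mf -> ztev th tg = theta mg ->
  act e (map interp w) (e (interp l)) = cvec th (croot al be tf tg w l).
Proof.
  intros Hth Ef Eg; induction w as [|k w IH]; simpl.
  - unfold cvec; destruct l; simpl; unfold ztev; simpl; vec.
  - rewrite IH; apply crefl_cvec; auto.
Qed.

Lemma cnonneg_cone th x : 0 <= th -> cnonneg x = true -> cone e [FB; f; g] (cvec th x).
Proof.
  intros Hth; destruct x as [[b y] z]; simpl; intros H.
  apply Bool.andb_true_iff in H as [H H3]; apply Bool.andb_true_iff in H as [H1 H2].
  repeat apply cone_add; apply cone_scale; try (apply ztev_nonneg; auto);
    apply cone_e; simpl; auto.
Qed.

Lemma crising_prefix al be tf tg w : forall p, crising al be tf tg p w = true ->
  forall q1 l q2, w = q1 ++ l :: q2 -> cnonneg (croot al be tf tg (p ++ q1) l) = true.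
Proof.
  induction w as [|k w IH]; intros p H q1 l q2 E; [destruct q1; discriminate|].
  simpl in H; apply Bool.andb_true_iff in H as [H1 H2].
  destruct q1 as [|k' q1]; simpl in E; inversion E; subst.
  - rewrite app_nil_r; auto.
  - specialize (IH _ H2 q1 l q2 eq_refl); rewrite <- app_assoc in IH; auto.
Qed.

(** Through [cvec] the coordinates become actual roots; those with nonnegative coordinates lie in
    the cone and, being nonzero, have positive height. So the certificate shows that w is reduced
    and makes all roots of [U] negative. *)
Lemma longest_lser U w : longest_check mf mg U w = true ->
  lser e x0 (map interp U) = sX (length w).
Proof.
  unfold longest_check; pose proof (ztev_theta mf mg Rf Rg Rfg) as [Ef Eg].
  set (M := Nat.max mf mg) in *.
  assert (RM : inrange M = true) by (unfold M; destruct (Nat.max_dec mf mg) as [-> | ->]; auto).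
  pose proof (theta_minpoly M RM) as Hth; destruct (minpoly_theta M) as [al be].
  assert (Pth : 0 <= theta M).
  { apply theta_nonneg; destruct (inrange_cases M RM); lia. }
  unfold clongest; intros H; apply Bool.andb_true_iff in H as [H H3].
  apply Bool.andb_true_iff in H as [H1 H2].
  assert (Hw : incl (map interp w) (map interp U)).
  { intros s Hs; apply in_map_iff in Hs as [l [<- Hl]]; apply in_map.
    rewrite forallb_forall in H1; specialize (H1 l Hl); apply existsb_exists in H1 as [k [Hk E]].
    destruct l, k; try discriminate E; auto. }
  assert (HG : inG e (map interp U) (act e (map interp w))) by (exists (map interp w); auto).
  assert (pos : forall p l, cnonneg (croot al be (zt_theta mf) (zt_theta mg) p l) = true ->
            0 < lam x0 (act e (map interp p) (e (interp l)))).
  { intros p l Hp; apply (cone_lam_pos e x0 e_neg [FB; f; g]).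
    - rewrite (croot_cvec (theta M) al be (zt_theta mf) (zt_theta mg)) by auto.
      apply cnonneg_cone; auto.
    - apply (root_nonzero e e_unit (map interp p)); exists (map interp p); auto using incl_refl. }
  rewrite (lser_longest e x0 e_unit e_angle e_neg (map interp U) (act e (map interp w))); auto.
  - f_equal; rewrite (ell_rising e x0 e_unit e_angle e_neg); auto; [apply length_map|].
    intros p s q E; apply map_eq_app in E as [p' [q' [-> [<- E]]]].
    apply map_eq_cons in E as [l [q'' [-> [<- _]]]].
    apply pos; apply (crising_prefix _ _ _ _ _ [] H2 p' l q'' eq_refl).
  - intros s Hs; apply in_map_iff in Hs as [l [<- Hl]].
    rewrite forallb_forall in H3; specialize (H3 l Hl).
    apply (cnonneg_cone (theta M)) in H3; auto.
    apply (cone_lam_pos e x0 e_neg) in H3.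
    + destruct (croot al be (zt_theta mf) (zt_theta mg) w l) as [[b y] z] eqn:E.
      rewrite (croot_cvec (theta M) al be (zt_theta mf) (zt_theta mg)), E by auto.
      replace (cvec (theta M) (copp (b, y, z))) with (vscale (-1) (cvec (theta M) (b, y, z))) in H3
        by (unfold cvec; simpl; rewrite !ztev_opp; vec).
      rewrite lam_scale in H3; lra.
    + destruct (croot al be (zt_theta mf) (zt_theta mg) w l) as [[b y] z] eqn:E.
      intros Z.
      assert (Z' : cvec (theta M) (b, y, z) = vzero).
      { replace (cvec (theta M) (b, y, z)) with (vscale (-1) (cvec (theta M) (copp (b, y, z))))
          by (unfold cvec; simpl; rewrite !ztev_opp; vec).
        rewrite Z; vec. }
      rewrite <- E, <- croot_cvec in Z' by auto.
      apply (root_nonzero e e_unit (map interp w)) in Z'; auto.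
      exists (map interp w); auto using incl_refl.
Qed.

Lemma vertex_words : words_check mf mg = true /\ pairs_check mf = true /\
  pairs_check mg = true /\ triples_check mf mg = true.
Proof.
  pose proof (triple_checks mf mg Rf Rg Rfg) as H.
  apply Bool.andb_true_iff in H as [H H4]; apply Bool.andb_true_iff in H as [H H3].
  apply Bool.andb_true_iff in H as [H1 H2]; auto.
Qed.

Lemma alternating_length n x y : length (alternating n x y) = n.
Proof. revert x y; induction n; intros; simpl; auto. Qed.

Lemma vertex_lser :
  lser e x0 [FB] = sX 1 /\ lser e x0 [f] = sX 1 /\ lser e x0 [g] = sX 1 /\
  lser e x0 [f; g] = sX 2 /\ lser e x0 [FB; f] = sX mf /\ lser e x0 [FB; g] = sX mg /\
  (spherical mf mg = true -> lser e x0 [FB; f; g] = sX (triple_len mf mg)).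
Proof.
  destruct vertex_words as [W _]; unfold words_check in W.
  repeat (apply Bool.andb_true_iff in W; destruct W as [W ?]).
  repeat split.
  - apply (longest_lser [LB] [LB]); auto.
  - apply (longest_lser [Lf] [Lf]); auto.
  - apply (longest_lser [Lg] [Lg]); auto.
  - apply (longest_lser [Lf; Lg] [Lf; Lg]); auto.
  - rewrite <- (alternating_length mf LB Lf); apply (longest_lser [LB; Lf]); auto.
  - rewrite <- (alternating_length mg LB Lg); apply (longest_lser [LB; Lg]); auto.
  - intros S; rewrite S in *; apply (longest_lser [LB; Lf; Lg]); auto.
Qed.

Lemma lser_nil : lser e x0 [] = sX 0.
Proof.
  rewrite (lser_longest e x0 e_unit e_angle e_neg [] idf).
  - rewrite ell_id; reflexivity.
  - apply inG_id.
  - intros s [].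
Qed.

Lemma vser_nil : vser e [] = scst 1.
Proof.
  pose proof (wser_vser e []) as H.
  assert (E : wser e [] = scst 1).
  { rewrite <- sX_0, <- lser_nil; unfold wser, lser, cnt.
    apply functional_extensionality; intros n; f_equal; f_equal; f_equal.
    apply functional_extensionality; intros x; apply Bool.eq_true_iff_eq; rewrite !decb_true.
    split; auto; intros _ s []. }
  rewrite E in H; rewrite <- H; ring.
Qed.

Lemma inverts_nil : inverts one_term (vser e []).
Proof.
  unfold inverts; rewrite vser_nil; replace (ps (cyc (snd one_term))) with (scst 1); [ring|].
  vm_compute cyc; rewrite ps_cons, ps_nil; ring.
Qed.

Lemma scst_opp1 : scst (-1) = sopp (scst 1).
Proof. apply functional_extensionality; intros [|n]; reflexivity. Qed.

Ltac expand_growth U :=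
  let E := fresh "E" in
  pose proof (growth_inverse e x0 e_unit e_angle e_neg U) as E;
  cbn [sublists app map ssum fold_right parity length Nat.even] in E;
  unfold parity in E; cbn [length Nat.even] in E;
  rewrite ?lser_nil, ?vser_nil, ?sX_0, ?scst_opp1 in E.

Lemma inverts_single s : lser e x0 [s] = sX 1 -> inverts t1 (vser e [s]).
Proof.
  intros L; expand_growth [s]; rewrite L in E.
  apply (solve_inverts [one_term] [vser e []]).
  - constructor; [apply inverts_nil|constructor].
  - unfold tsum; cbn [combine fold_right one_term fst snd]; rewrite vser_nil, sX_0, scst_opp1.
    rewrite E at 1; ring.
  - vm_compute; reflexivity.
Qed.

Lemma inverts_pair s t m : lser e x0 [s] = sX 1 -> lser e x0 [t] = sX 1 ->
  lser e x0 [s; t] = sX m -> pairs_check m = true -> inverts (t2 m) (vser e [s; t]).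
Proof.
  intros Ls Lt L C; expand_growth [s; t]; rewrite L, Ls, Lt in E.
  apply (solve_inverts [one_term; t1; t1] [vser e []; vser e [t]; vser e [s]]); auto.
  - repeat constructor; auto using inverts_nil, inverts_single.
  - unfold tsum; cbn [combine fold_right one_term t1 fst snd]; rewrite vser_nil, sX_0, scst_opp1.
    rewrite E at 1; ring.
Qed.

Lemma pairs_check_2 : pairs_check 2 = true.
Proof. vm_compute; reflexivity. Qed.

Lemma vertex_inverts :
  inverts t1 (vser e [FB]) /\ inverts t1 (vser e [f]) /\ inverts t1 (vser e [g]) /\
  inverts (t2 2) (vser e [f; g]) /\ inverts (t2 mf) (vser e [FB; f]) /\
  inverts (t2 mg) (vser e [FB; g]) /\
  (spherical mf mg = true -> inverts (t3 mf mg) (vser e [FB; f; g])).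
Proof.
  destruct vertex_lser as [LB [Lf [Lg [Lfg [LBf [LBg LBfg]]]]]].
  destruct vertex_words as [_ [Cf [Cg Cfg]]].
  assert (I1 : inverts t1 (vser e [FB])) by (apply inverts_single; auto).
  assert (I2 : inverts t1 (vser e [f])) by (apply inverts_single; auto).
  assert (I3 : inverts t1 (vser e [g])) by (apply inverts_single; auto).
  assert (I4 : inverts (t2 2) (vser e [f; g])) by (apply inverts_pair; auto using pairs_check_2).
  assert (I5 : inverts (t2 mf) (vser e [FB; f])) by (apply inverts_pair; auto).
  assert (I6 : inverts (t2 mg) (vser e [FB; g])) by (apply inverts_pair; auto).
  repeat (split; auto); intros S; specialize (LBfg S).
  unfold triples_check in Cfg; rewrite S in Cfg; cbn [negb orb] in Cfg.
  expand_growth [FB; f; g]; rewrite LBfg, LB, Lf, Lg, Lfg, LBf, LBg in E.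
  apply (solve_inverts (triple_terms mf mg)
    [vser e []; vser e [g]; vser e [f]; vser e [f; g]; vser e [FB]; vser e [FB; g]; vser e [FB; f]]);
    auto.
  - unfold triple_terms; repeat constructor; auto using inverts_nil.
  - unfold tsum, triple_terms; cbn [combine fold_right one_term t1 t2 fst snd].
    rewrite vser_nil, sX_0, scst_opp1; rewrite E at 1; ring.
Qed.

(** At an ideal vertex the Gram matrix of the three normals is singular; n is a vector of its
    radical with nonnegative coefficients, as [lser_degenerate] requires. *)
Lemma vertex_degenerate U : incl [FB; f; g] U -> spherical mf mg = false ->
  lser e x0 U = scst 0.
Proof.
  intros HU NS.
  assert (T : theta mf * theta mf + theta mg * theta mg = 4).
  { pose proof theta_2; pose proof theta_3; pose proof theta_4; pose proof theta_6.
    destruct (inrange_cases mf Rf) as [ | [ | [ | [ | ]]]]; subst mf;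
      destruct (inrange_cases mg Rg) as [ | [ | [ | [ | ]]]]; subst mg;
      try discriminate NS; try discriminate Rfg; rewrite ?theta_3; lra. }
  assert (Tf : theta mf = 2 * cos (PI / INR mf)) by reflexivity.
  assert (Tg : theta mg = 2 * cos (PI / INR mg)) by reflexivity.
  assert (Pf : 0 <= theta mf) by (apply theta_nonneg; destruct (inrange_cases mf Rf); lia).
  assert (Pg : 0 <= theta mg) by (apply theta_nonneg; destruct (inrange_cases mg Rg); lia).
  set (n := vadd (vscale 1 (e FB)) (vadd (vscale (theta mf / 2) (e f))
              (vadd (vscale (theta mg / 2) (e g)) vzero))).
  apply (lser_degenerate e x0 e_unit e_angle e_neg [FB; f; g] U n); auto.
  - unfold n; repeat (apply cone_cons; [lra|simpl; auto|]); apply cone_zero.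
  - unfold n; rewrite !lam_add, !lam_scale.
    pose proof (lam_e e x0 e_neg FB); pose proof (lam_e e x0 e_neg f);
      pose proof (lam_e e x0 e_neg g).
    assert (lam x0 vzero = 0) by (unfold lam; rewrite mink_zero_l; ring).
    assert (0 <= theta mf / 2 * lam x0 (e f)) by (apply Rmult_le_pos; lra).
    assert (0 <= theta mg / 2 * lam x0 (e g)) by (apply Rmult_le_pos; lra); lra.
  - intros s Hs; unfold n; rewrite !mink_add_l, !mink_scale_l, mink_zero_l.
    destruct Hs as [<-|[<-|[<-|[]]]]; rewrite ?e_unit, ?(mink_sym (e f) (e FB)),
      ?(mink_sym (e g) (e FB)), ?(mink_sym (e g) (e f)), ?Gfg, ?GBf, ?GBg; nra.
Qed.

Lemma opposite_degenerate s t U : incl [s; t] U -> mink (e s) (e t) = -1 -> lser e x0 U = scst 0.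
Proof.
  intros HU G.
  apply (lser_degenerate e x0 e_unit e_angle e_neg [s; t] U (vadd (e s) (e t))); auto.
  - apply cone_add; apply cone_e; simpl; auto.
  - rewrite lam_add; pose proof (lam_e e x0 e_neg s); pose proof (lam_e e x0 e_neg t); lra.
  - intros r Hr; rewrite mink_add_l; destruct Hr as [<-|[<-|[]]];
      rewrite ?e_unit, ?(mink_sym (e t) (e s)), ?G; lra.
Qed.

End VertexGroup.

(** * The growth series of a pyramid group *)

Definition facets : list facet := [FB; F1; F2; F3; F4].

(** An ideal vertex has an infinite group and contributes nothing; the zero term gives the lists of
    all pyramids the same shape. *)
Definition vertex_term (mf mg : nat) : term :=
  if spherical mf mg then t3 mf mg else (0%Z, 0%nat, [0; 0; 0; 0; 0; 0]%nat).

(** In the order of [sublists facets], leaving out the subsets with two opposite sides. *)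
Definition pyramid_terms (a b c d : nat) : list term :=
  [one_term; t1; t1; t2 2; t1; t2 2; t1; t2 2; t2 2; t1;
   t2 d; t2 c; vertex_term c d; t2 b; vertex_term b c; t2 a; vertex_term a d; vertex_term a b].

Lemma admissible_iff a b c d : admissible a b c d = true ->
  inrange a = true /\ inrange b = true /\ inrange c = true /\ inrange d = true /\
  okpair a b = true /\ okpair b c = true /\ okpair c d = true /\ okpair a d = true.
Proof.
  unfold admissible; intros H.
  do 9 (apply Bool.andb_true_iff in H; destruct H as [H ?]).
  repeat split; auto.
  unfold okpair in *; rewrite Nat.mul_comm, Nat.add_comm; auto.
Qed.

Section PyramidGrowth.

Variable e : facet -> Vec4.
Variable x0 : Vec4.
Variables a b c d : nat.
Hypothesis H : pyramid_data e x0 a b c d.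

Let e_unit := pd_unit _ _ _ _ _ _ H.
Let e_neg := pd_neg _ _ _ _ _ _ H.

Lemma pd_angle s t : s <> t ->
  (exists m : nat, (2 <= m)%nat /\ mink (e s) (e t) = - cos (PI / INR m))
  \/ mink (e s) (e t) = -1.
Proof.
  destruct (admissible_iff _ _ _ _ (pd_adm _ _ _ _ _ _ H)) as [Ra [Rb [Rc [Rd _]]]].
  assert (two : forall m, inrange m = true -> (2 <= m)%nat)
    by (intros m Hm; destruct (inrange_cases m Hm); lia).
  assert (right : forall x, x = 0 -> exists m : nat, (2 <= m)%nat /\ x = - cos (PI / INR m)).
  { intros x ->; exists 2%nat; split; auto; pose proof theta_2 as T; unfold theta in T; lra. }
  pose proof H as [U N G12 G23 G34 G14 G13 G24 GB1 GB2 GB3 GB4 _].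
  destruct s, t; intros Nst; try congruence; rewrite ?(mink_sym _ (e FB)),
    ?(mink_sym (e F2) (e F1)), ?(mink_sym (e F3) (e F1)), ?(mink_sym (e F4) (e F1)),
    ?(mink_sym (e F3) (e F2)), ?(mink_sym (e F4) (e F2)), ?(mink_sym (e F4) (e F3)); auto;
    left; eauto.
Qed.

Let VI f g mf mg := vertex_inverts e x0 e_unit pd_angle e_neg f g mf mg.
Let VL f g mf mg := vertex_lser e x0 e_unit pd_angle e_neg f g mf mg.
Let VD f g mf mg := vertex_degenerate e x0 e_unit pd_angle e_neg f g mf mg.
Let OD s t U := opposite_degenerate e x0 e_unit pd_angle e_neg s t U.

Definition vertex_series (f g : facet) (mf mg : nat) : ser :=
  if spherical mf mg then vser e [FB; f; g] else scst 1.

Definition pyramid_series : list ser :=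
  [vser e []; vser e [F4]; vser e [F3]; vser e [F3; F4]; vser e [F2]; vser e [F2; F3];
   vser e [F1]; vser e [F1; F4]; vser e [F1; F2]; vser e [FB];
   vser e [FB; F4]; vser e [FB; F3]; vertex_series F3 F4 c d; vser e [FB; F2];
   vertex_series F2 F3 b c; vser e [FB; F1]; vertex_series F1 F4 a d; vertex_series F1 F2 a b].

Lemma vertex_term_inverts f g mf mg :
  (spherical mf mg = true -> inverts (t3 mf mg) (vser e [FB; f; g])) ->
  inverts (vertex_term mf mg) (vertex_series f g mf mg).
Proof.
  unfold vertex_term, vertex_series; destruct (spherical mf mg); auto; intros _.
  unfold inverts; vm_compute cyc; rewrite ps_cons, ps_nil; ring.
Qed.

Lemma vertex_term_value f g mf mg :
  (spherical mf mg = true -> lser e x0 [FB; f; g] = sX (triple_len mf mg)) ->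
  (spherical mf mg = false -> lser e x0 [FB; f; g] = scst 0) ->
  smul (scst (-1)) (smul (lser e x0 [FB; f; g]) (vser e [FB; f; g])) =
  smul (scst (fst (fst (vertex_term mf mg)))) (smul (sX (snd (fst (vertex_term mf mg))))
    (vertex_series f g mf mg)).
Proof.
  unfold vertex_term, vertex_series; destruct (spherical mf mg); intros H1 H2.
  - rewrite H1 by auto; reflexivity.
  - rewrite H2 by auto; simpl; ring.
Qed.

Lemma pyramid_growth :
  vser e facets = tsum (pyramid_terms a b c d) pyramid_series /\
  Forall2 inverts (pyramid_terms a b c d) pyramid_series.
Proof.
  destruct (admissible_iff _ _ _ _ (pd_adm _ _ _ _ _ _ H))
    as [Ra [Rb [Rc [Rd [Pab [Pbc [Pcd Pad]]]]]]].
  pose proof H as [U N G12 G23 G34 G14 G13 G24 GB1 GB2 GB3 GB4 _].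
  destruct (VI F1 F2 a b Ra Rb Pab G12 GB1 GB2) as [IB [I1 [I2 [I12 [IB1 [IB2 IB12]]]]]].
  destruct (VI F2 F3 b c Rb Rc Pbc G23 GB2 GB3) as [_ [_ [I3 [I23 [_ [IB3 IB23]]]]]].
  destruct (VI F3 F4 c d Rc Rd Pcd G34 GB3 GB4) as [_ [_ [I4 [I34 [_ [IB4 IB34]]]]]].
  destruct (VI F1 F4 a d Ra Rd Pad G14 GB1 GB4) as [_ [_ [_ [I14 [_ [_ IB14]]]]]].
  destruct (VL F1 F2 a b Ra Rb Pab G12 GB1 GB2) as [LB [L1 [L2 [L12 [LB1 [LB2 LB12]]]]]].
  destruct (VL F2 F3 b c Rb Rc Pbc G23 GB2 GB3) as [_ [_ [L3 [L23 [_ [LB3 LB23]]]]]].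
  destruct (VL F3 F4 c d Rc Rd Pcd G34 GB3 GB4) as [_ [_ [L4 [L34 [_ [LB4 LB34]]]]]].
  destruct (VL F1 F4 a d Ra Rd Pad G14 GB1 GB4) as [_ [_ [_ [L14 [_ [_ LB14]]]]]].
  split.
  - rewrite (growth_inverse e x0 e_unit pd_angle e_neg facets).
    unfold facets; cbn [sublists app map ssum fold_right].
    unfold parity; cbn [length Nat.even].
    rewrite (vertex_term_value F1 F2 a b) by
      (auto; intros; apply (VD F1 F2 a b); auto using incl_refl).
    rewrite (vertex_term_value F2 F3 b c) by
      (auto; intros; apply (VD F2 F3 b c); auto using incl_refl).
    rewrite (vertex_term_value F3 F4 c d) by
      (auto; intros; apply (VD F3 F4 c d); auto using incl_refl).
    rewrite (vertex_term_value F1 F4 a d) by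
      (auto; intros; apply (VD F1 F4 a d); auto using incl_refl).
    (* Opposite sides generate an infinite dihedral group, so subsets containing both drop out. *)
    assert (Z13 : forall V, In F1 V -> In F3 V -> lser e x0 V = scst 0).
    { intros V H1 H3; apply (OD F1 F3); auto; intros y [<-|[<-|[]]]; auto. }
    assert (Z24 : forall V, In F2 V -> In F4 V -> lser e x0 V = scst 0).
    { intros V H1 H3; apply (OD F2 F4); auto; intros y [<-|[<-|[]]]; auto. }
    repeat match goal with
    | |- context [lser e x0 ?V] =>
      first [rewrite (Z13 V) by (simpl; tauto) | rewrite (Z24 V) by (simpl; tauto)]
    end.
    rewrite (lser_nil e x0 e_unit pd_angle e_neg), LB, L1, L2, L3, L4, L12, L23, L34, L14,
      LB1, LB2, LB3, LB4.
    unfold tsum, pyramid_terms, pyramid_series.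
    cbn [combine fold_right fst snd].
    change (fst one_term) with (1%Z, 0%nat); change (fst t1) with ((-1)%Z, 1%nat).
    repeat match goal with |- context [fst (t2 ?m)] => change (fst (t2 m)) with (1%Z, m) end.
    cbn [fst snd].
    ring.
  - pose proof (inverts_nil e x0 e_unit pd_angle e_neg).
    unfold pyramid_terms, pyramid_series.
    repeat (apply Forall2_cons; [auto using vertex_term_inverts|]); constructor.
Qed.

Lemma pyramid_growth_rational L : divides_check L (pyramid_terms a b c d) = true ->
  smul (wser e facets) (ps (numer L (pyramid_terms a b c d))) = ps (cyc L).
Proof.
  intros C; destruct pyramid_growth as [E F].
  rewrite <- (tsum_numer L _ _ C F), <- E.
  transitivity (smul (ps (cyc L)) (smul (wser e facets) (vser e facets))); [ring|].
  rewrite wser_vser; ring.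
Qed.

End PyramidGrowth.

(** * Recurrence coefficients and their finite verification *)

Fixpoint partial_sums (acc : Z) (l : list Z) : list Z :=
  match l with [] => [] | x :: l' => (acc + x)%Z :: partial_sums (acc + x) l' end.

Fixpoint dot (x y : list Z) : Z :=
  match x, y with x1 :: x', y1 :: y' => (x1 * y1 + dot x' y')%Z | _, _ => 0%Z end.

Fixpoint unroll (P bs : list Z) (n : nat) : list Z :=
  match n with
  | O => []
  | S k => let l := unroll P bs k in (nth k P 0 + dot bs l)%Z :: l
  end.

Fixpoint consecutive (l : list Z) : bool :=
  match l with
  | x :: l' => (Z.ltb 0 x && Z.ltb 0 (hd 0%Z l')) || consecutive l'
  | [] => false
  end.

(* (1 - t) times the growth series is P / (1 - sum_k b_k t^(k+1)) with b_k >= 0, two consecutive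
   b_k are positive, and the initial coefficients of that quotient are positive. *)
Definition growth_check (P bs : list Z) : bool :=
  forallb (Z.leb 0) bs && Z.ltb 1 (fold_right Z.add 0%Z bs) && consecutive bs &&
  forallb (Z.ltb 0) (unroll P bs (length P + length bs)).

(** Division by 1 - t amounts to partial sums. The last one, the value at 1, should be 0 and is
    dropped; the first one should be the constant term 1. Both are confirmed by [pyramid_check]. *)
Definition pyramid_bs (a b c d : nat) : list Z :=
  let ts := pyramid_terms a b c d in
  map Z.opp (tl (removelast (partial_sums 0 (numer (exps_lcm ts) ts)))).

Definition pyramid_check (a b c d : nat) : bool :=
  let ts := pyramid_terms a b c d in
  let L := exps_lcm ts in
  let bs := pyramid_bs a b c d in
  divides_check L ts &&
  peqb (numer L ts) (pmul [1; -1]%Z (1%Z :: map Z.opp bs)) &&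
  growth_check (cyc L) bs.

Lemma pyramid_check_all : forallb (fun a => forallb (fun b => forallb (fun c => forallb (fun d =>
  implb (admissible a b c d) (pyramid_check a b c d)) (seq 2 5)) (seq 2 5)) (seq 2 5)) (seq 2 5)
  = true.
Proof. vm_compute; reflexivity. Qed.

Lemma admissible_pyramid_check a b c d : admissible a b c d = true -> pyramid_check a b c d = true.
Proof.
  intros A; destruct (admissible_iff _ _ _ _ A) as [Ra [Rb [Rc [Rd _]]]].
  assert (S : forall m, inrange m = true -> In m (seq 2 5)).
  { intros m Hm; apply in_seq; destruct (inrange_cases m Hm); lia. }
  pose proof pyramid_check_all as C.
  rewrite forallb_forall in C; specialize (C a (S a Ra)); cbv beta in C.
  rewrite forallb_forall in C; specialize (C b (S b Rb)); cbv beta in C.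
  rewrite forallb_forall in C; specialize (C c (S c Rc)); cbv beta in C.
  rewrite forallb_forall in C; specialize (C d (S d Rd)); cbv beta in C.
  rewrite A in C; exact C.
Qed.

Theorem pyramid_recurrence e x0 a b c d : pyramid_data e x0 a b c d ->
  exists P bs, growth_check P bs = true /\
    smul (ps (1%Z :: map Z.opp bs)) (smul (ps [1; -1]%Z) (wser e facets)) = ps P.
Proof.
  intros H; pose proof (admissible_pyramid_check _ _ _ _ (pd_adm _ _ _ _ _ _ H)) as C.
  unfold pyramid_check in C.
  apply Bool.andb_true_iff in C as [C C3]; apply Bool.andb_true_iff in C as [C1 C2].
  exists (cyc (exps_lcm (pyramid_terms a b c d))), (pyramid_bs a b c d); split; auto.
  rewrite <- (pyramid_growth_rational e x0 a b c d H _ C1), (peqb_ps _ _ C2), ps_mul; ring.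
Qed.

(** * Growth rate of a sequence with a positive linear recurrence *)

(** Latest value first, which turns a convolution into [dot]. *)
Fixpoint hist (d : ser) (n : nat) : list Z :=
  match n with O => [] | S k => d k :: hist d k end.

Lemma smul_dot bs d n : smul (ps bs) d n = dot bs (hist d (S n)).
Proof.
  revert bs; induction n as [|n IH]; intros [|b bs]; try (rewrite ps_nil, smul_cst; reflexivity).
  - rewrite smul_0; unfold ps; cbn; destruct bs; cbn; ring.
  - rewrite smul_S; change (stl (ps (b :: bs))) with (ps bs); rewrite IH; reflexivity.
Qed.

Lemma dot_opp x y : dot (map Z.opp x) y = (- dot x y)%Z.
Proof.
  revert y; induction x as [|a x IH]; intros [|b y]; simpl; auto; rewrite IH; ring.
Qed.

Lemma recurrence_of_series bs d P : smul (ps (1%Z :: map Z.opp bs)) d = ps P ->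
  forall n, d n = (nth n P 0 + dot bs (hist d n))%Z.
Proof.
  intros E n; pose proof (f_equal (fun s => s n) E) as En; cbv beta in En.
  rewrite smul_dot in En; cbn [dot hist] in En; rewrite dot_opp in En.
  change (ps P n) with (nth n P 0%Z) in En; lia.
Qed.

Section PositiveRecurrence.

Variables (P bs : list Z) (d : ser).
Hypothesis rec : forall n, d n = (nth n P 0 + dot bs (hist d n))%Z.
Hypothesis check : growth_check P bs = true.

Lemma check_parts : (forall x, In x bs -> (0 <= x)%Z) /\ (1 < fold_right Z.add 0 bs)%Z /\
  consecutive bs = true /\ (forall n, (n < length P + length bs)%nat -> (0 < d n)%Z).
Proof.
  pose proof check as C; unfold growth_check in C.
  apply Bool.andb_true_iff in C as [C C4]; apply Bool.andb_true_iff in C as [C C3];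
    apply Bool.andb_true_iff in C as [C1 C2].
  rewrite forallb_forall in C1; apply Z.ltb_lt in C2; repeat split; auto.
  - intros x Hx; apply Z.leb_le, C1, Hx.
  - assert (E : forall n, unroll P bs n = hist d n).
    { induction n as [|n IH]; simpl; auto; rewrite IH, <- rec; reflexivity. }
    rewrite E in C4; generalize dependent (length P + length bs)%nat; intros N C4 n Hn.
    induction N as [|N IH]; [lia|]; cbn [hist forallb] in C4.
    apply Bool.andb_true_iff in C4 as [C4 C5]; apply Z.ltb_lt in C4.
    destruct (Nat.eq_dec n N) as [->|]; auto; apply IH; auto; lia.
Qed.

Lemma continuity_peval l : continuity (peval l).
Proof.
  induction l as [|c l IH].
  - apply (continuity_const (fun _ => 0)); intros x y; reflexivity.
  - apply (continuity_plus (fun _ => IZR c) (fun x => x * peval l x)).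
    + apply continuity_const; intros x y; reflexivity.
    + apply (continuity_mult id (peval l)); auto.
      apply derivable_continuous, derivable_id.
Qed.

Lemma peval_1 l : peval l 1 = IZR (fold_right Z.add 0%Z l).
Proof. induction l as [|c l IH]; simpl; [reflexivity|]; rewrite IH, plus_IZR; ring. Qed.

Lemma reciprocal_root : exists t, 0 < t < 1 /\ t * peval bs t = 1.
Proof.
  destruct check_parts as [_ [C2 _]].
  destruct (IVT (fun t => t * peval bs t - 1) 0 1) as [t [[T0 T1] Ht]].
  - apply (continuity_minus (fun t => t * peval bs t) (fun _ => 1)).
    + apply (continuity_mult id (peval bs)); [apply derivable_continuous, derivable_id|].
      apply continuity_peval.
    + apply continuity_const; intros x y; reflexivity.
  - lra.
  - lra.
  - rewrite peval_1; apply IZR_lt in C2; lra.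
  - assert (E : t * peval bs t = 1) by lra.
    exists t; split; auto; split.
    + destruct T0 as [|<-]; auto; lra.
    + destruct T1 as [|T1]; auto; exfalso; subst t.
      rewrite peval_1 in E; apply IZR_lt in C2; lra.
Qed.

Variable t : R.
Hypothesis t_range : 0 < t < 1.
Hypothesis t_root : t * peval bs t = 1.

(** After rescaling by t^i the coefficient at position k acts with weight t^(k+1); the weights are
    nonnegative with total t * [peval] l t, which is 1 for [bs]. *)
Lemma dot_bound l lo hi n : (forall c, In c l -> (0 <= c)%Z) -> (length l <= n)%nat ->
  (forall i, (n - length l <= i < n)%nat -> lo <= IZR (d i) * t ^ i <= hi) ->
  lo * (t * peval l t) <= IZR (dot l (hist d n)) * t ^ n <= hi * (t * peval l t).
Proof.
  revert n; induction l as [|c l IH]; intros n Hl Hn Hd; [simpl; lra|].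
  destruct n as [|n]; [simpl in Hn; lia|].
  cbn [hist dot peval fold_right]; fold (peval l t); rewrite plus_IZR, mult_IZR.
  simpl in Hn; destruct (IH n) as [I1 I2]; [intros; apply Hl; right; auto|lia| |].
  { intros i Hi; apply Hd; simpl; lia. }
  destruct (Hd n) as [D1 D2]; [simpl; lia|].
  assert (Hc : 0 <= IZR c) by (apply IZR_le, Hl; left; auto).
  set (X := IZR (d n) * t ^ n) in *; set (Y := IZR (dot l (hist d n)) * t ^ n) in *.
  replace ((IZR c * IZR (d n) + IZR (dot l (hist d n))) * t ^ S n) with (t * (IZR c * X + Y))
    by (unfold X, Y; simpl; ring).
  assert (IZR c * lo <= IZR c * X <= IZR c * hi) by (split; apply Rmult_le_compat_l; auto).
  split.
  - replace (lo * (t * (IZR c + t * peval l t))) with (t * (IZR c * lo + lo * (t * peval l t))) by ring.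
    apply Rmult_le_compat_l; lra.
  - replace (hi * (t * (IZR c + t * peval l t))) with (t * (IZR c * hi + hi * (t * peval l t))) by ring.
    apply Rmult_le_compat_l; lra.
Qed.

(* d_n t^n is eventually a weighted mean of its predecessors. *)
Lemma normalized_bounds : exists lo hi, 0 < lo /\ forall n, lo <= IZR (d n) * t ^ n <= hi.
Proof.
  destruct check_parts as [C1 [_ [_ C4]]].
  assert (init : forall N, (N <= length P + length bs)%nat -> exists lo hi, 0 < lo /\
            forall n, (n < N)%nat -> lo <= IZR (d n) * t ^ n <= hi).
  { induction N as [|N IH]; intros HN; [exists 1, 1; split; [lra|intros; lia]|].
    destruct (IH ltac:(lia)) as [lo [hi [Hlo Hb]]].
    assert (0 < IZR (d N) * t ^ N).
    { apply Rmult_lt_0_compat; [apply IZR_lt, C4; lia|apply pow_lt; lra]. }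
    exists (Rmin lo (IZR (d N) * t ^ N)), (Rmax hi (IZR (d N) * t ^ N)); split.
    - apply Rmin_glb_lt; auto.
    - intros n Hn; destruct (Nat.eq_dec n N) as [->|].
      + split; [apply Rmin_r|apply Rmax_r].
      + destruct (Hb n ltac:(lia)); split.
        * eapply Rle_trans; [apply Rmin_l|auto].
        * eapply Rle_trans; [|apply Rmax_l]; auto. }
  destruct (init _ (Nat.le_refl _)) as [lo [hi [Hlo Hb]]]; exists lo, hi; split; auto.
  intros n; induction n as [n IH] using (well_founded_induction Wf_nat.lt_wf).
  destruct (Nat.lt_ge_cases n (length P + length bs)) as [L|L]; auto.
  rewrite rec, nth_overflow by lia.
  pose proof (dot_bound bs lo hi n C1 ltac:(lia) ltac:(intros; apply IH; lia)) as B.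
  rewrite t_root in B; rewrite Z.add_0_l; lra.
Qed.

End PositiveRecurrence.

(** The values of w are the partial sums of d, which grows geometrically with ratio 1/t > 1, so that
    summation changes only the constant. *)
Lemma growth_bounds (w : ser) P bs t : (forall n, (0 <= w n)%Z) ->
  smul (ps (1%Z :: map Z.opp bs)) (smul (ps [1; -1]%Z) w) = ps P ->
  growth_check P bs = true -> 0 < t < 1 -> t * peval bs t = 1 ->
  exists lo hi, 0 < lo /\ forall n, lo * (/ t) ^ n <= IZR (w n) <= hi * (/ t) ^ n.
Proof.
  intros Hw E C T Ht; set (d := smul (ps [1; -1]%Z) w) in *.
  pose proof (recurrence_of_series bs d P E) as rec.
  destruct (normalized_bounds P bs d rec C t T Ht) as [lo [hi [Hlo Hb]]].
  assert (d0 : d O = w O) by (unfold d; rewrite smul_0; unfold ps; simpl; destruct (w O); reflexivity).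
  assert (dS : forall n, d (S n) = (w (S n) - w n)%Z).
  { intros n; unfold d; rewrite smul_dot; cbn [dot hist]; destruct n; cbn [hist dot]; ring. }
  assert (Hd : forall n, lo * (/ t) ^ n <= IZR (d n) <= hi * (/ t) ^ n).
  { intros n; specialize (Hb n).
    assert (0 < t ^ n) by (apply pow_lt; lra).
    assert (Ed : IZR (d n) = IZR (d n) * t ^ n * (/ t) ^ n)
      by (rewrite pow_inv; field; lra).
    assert (0 < (/ t) ^ n) by (apply pow_lt, Rinv_0_lt_compat; lra).
    rewrite Ed; split; apply Rmult_le_compat_r; lra. }
  assert (Hhi : 0 < hi) by (pose proof (Hb O); lra).
  (* The solution of hi + K t = K, which makes the induction on partial sums close. *)
  set (K := hi / (1 - t)).
  assert (HK : hi <= K).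
  { unfold K; apply (Rmult_le_reg_r (1 - t)); [lra|].
    replace (hi / (1 - t) * (1 - t)) with hi by (field; lra); nra. }
  exists lo, K; split; auto; intros n; split.
  - destruct n as [|n]; [rewrite <- d0; apply Hd|].
    eapply Rle_trans; [apply Hd|]; apply IZR_le; rewrite dS; specialize (Hw n); lia.
  - induction n as [|n IH].
    + rewrite <- d0; destruct (Hd O); simpl in *; lra.
    + replace (w (S n)) with (d (S n) + w n)%Z by (rewrite dS; lia); rewrite plus_IZR.
      destruct (Hd (S n)) as [_ H2].
      replace (K * (/ t) ^ S n) with (hi * (/ t) ^ S n + K * (/ t) ^ n); [lra|].
      unfold K; simpl; field; lra.
Qed.

(** * From exponential bounds to the growth rate *)

Lemma ln_le x y : 0 < x -> x <= y -> ln x <= ln y.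
Proof. intros Hx [L| ->]; [left; apply ln_increasing; auto|apply Rle_refl]. Qed.

(** The logarithm of u(k) differs from k ln tau by at most the constant M, so its quotient by k
    tends to ln tau; then exp is continuous. *)
Lemma kth_root_limit (u : nat -> nat) lo hi tau : 0 < lo -> 0 < tau ->
  (forall n, lo * tau ^ n <= INR (u n) <= hi * tau ^ n) ->
  forall eps, 0 < eps -> exists N, forall k, (N <= k)%nat -> Rabs (kth_root k (u k) - tau) < eps.
Proof.
  intros Hlo Ht Hu eps Heps.
  assert (Hhi : 0 < hi) by (pose proof (Hu O) as H; simpl in H; lra).
  assert (cont : continuity_pt exp (ln tau)) by apply derivable_continuous_pt, derivable_pt_exp.
  destruct (cont eps Heps) as [del [Hdel Hc]].
  set (M := Rabs (ln lo) + Rabs (ln hi)).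
  destruct (INR_unbounded (M / del)) as [N HN].
  exists (S N); intros k Hk.
  assert (Kpos : 0 < INR k) by (apply lt_0_INR; lia).
  assert (Kbig : M / del < INR k) by (apply (Rlt_trans _ (INR N)); auto; apply lt_INR; lia).
  assert (Pt : 0 < tau ^ k) by (apply pow_lt; auto).
  destruct (Hu k) as [U1 U2].
  assert (Upos : 0 < INR (u k)) by (eapply Rlt_le_trans; [|exact U1]; apply Rmult_lt_0_compat; auto).
  assert (Er : kth_root k (u k) = exp (/ INR k * ln (INR (u k)))).
  { unfold kth_root; destruct (u k); [simpl in Upos; lra|reflexivity]. }
  assert (lnpow : ln (tau ^ k) = INR k * ln tau) by (apply ln_pow; auto).
  assert (L1 : ln lo + INR k * ln tau <= ln (INR (u k))).
  { rewrite <- lnpow, <- ln_mult by auto; apply ln_le; auto; apply Rmult_lt_0_compat; auto. }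
  assert (L2 : ln (INR (u k)) <= ln hi + INR k * ln tau).
  { rewrite <- lnpow, <- ln_mult by auto; apply ln_le; auto. }
  rewrite Er; rewrite <- (exp_ln tau) at 1 by auto.
  set (x := / INR k * ln (INR (u k))).
  assert (Hx : Rabs (x - ln tau) < del).
  { replace (x - ln tau) with ((ln (INR (u k)) - INR k * ln tau) / INR k)
      by (unfold x; field; lra).
    unfold Rdiv; rewrite Rabs_mult, (Rabs_right (/ INR k)) by
      (apply Rle_ge; left; apply Rinv_0_lt_compat; auto).
    assert (B : Rabs (ln (INR (u k)) - INR k * ln tau) <= M).
    { unfold M; apply Rabs_le; pose proof (Rle_abs (ln lo)); pose proof (Rle_abs (ln hi)).
      pose proof (Rle_abs (- ln lo)) as A; rewrite Rabs_Ropp in A.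
      pose proof (Rabs_pos (ln lo)); pose proof (Rabs_pos (ln hi)); lra. }
    apply (Rmult_lt_reg_r (INR k)); auto.
    rewrite Rmult_assoc, Rinv_l, Rmult_1_r by lra.
    eapply Rle_lt_trans; [exact B|].
    apply (Rmult_lt_reg_r (/ del)); [apply Rinv_0_lt_compat; lra|].
    replace (del * INR k * / del) with (INR k) by (field; lra); exact Kbig. }
  destruct (Req_dec x (ln tau)) as [->|Nx].
  { rewrite Rminus_diag, Rabs_R0; auto. }
  apply Hc; split; [split; [exact I|auto]|exact Hx].
Qed.

Lemma limsup_unique u l tau : is_limsup u l ->
  (forall eps, 0 < eps -> exists N, forall k, (N <= k)%nat -> Rabs (u k - tau) < eps) -> l = tau.
Proof.
  intros HL HT; apply Rminus_diag_uniq; apply NNPP; intros N.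
  set (eps := Rabs (l - tau) / 3).
  assert (E : 0 < eps) by (unfold eps; pose proof (Rabs_pos_lt _ N); lra).
  destruct (HL eps E) as [H1 [N2 H2]]; destruct (HT eps E) as [N1 H3].
  destruct (H1 (Nat.max N1 N2)) as [k [Hk K1]].
  specialize (H2 k ltac:(lia)); specialize (H3 k ltac:(lia)).
  assert (Rabs (l - tau) < 2 * eps).
  { replace (l - tau) with ((l - u k) + (u k - tau)) by ring.
    eapply Rle_lt_trans; [apply Rabs_triang|].
    assert (Rabs (l - u k) < eps) by (apply Rabs_def1; lra); lra. }
  unfold eps in *; lra.
Qed.

Lemma sphere_size_wser e k n : sphere_size e k n -> Z.of_nat n = wser e facets k.
Proof.
  intros [l [Nl [Hl <-]]]; rewrite wser_length; f_equal.
  apply NoDup_same_length; auto using sph_NoDup.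
  intros g; rewrite Hl, in_sph.
  assert (all : forall w, incl w facets) by (intros w s _; destruct s; simpl; auto 10).
  split.
  - intros [[w [Lw Ew]] Hm].
    assert (Hg : inG e facets g) by (exists w; auto).
    split; auto; destruct (ell_spec e facets g Hg) as [[w' [_ [Ew' Lw']]] Hm'].
    specialize (Hm' w (all w) Ew); specialize (Hm w' Ew'); lia.
  - intros [Hg <-]; destruct (ell_spec e facets g Hg) as [[w' [_ [Ew' Lw']]] Hm'].
    split; [exists w'; auto|auto].
Qed.

Theorem growth_rate_root e tau P bs : growth_rate e tau ->
  smul (ps (1%Z :: map Z.opp bs)) (smul (ps [1; -1]%Z) (wser e facets)) = ps P ->
  growth_check P bs = true -> exists t, 0 < t < 1 /\ t * peval bs t = 1 /\ tau = / t.
Proof.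
  intros [a [Ha Hsup]] E C.
  pose proof (recurrence_of_series bs _ P E) as rec.
  destruct (reciprocal_root P bs _ rec C) as [t [T Ht]]; exists t; repeat split; try tauto.
  assert (W : forall n, wser e facets n = Z.of_nat (a n)) by (intros n; symmetry; apply sphere_size_wser, Ha).
  destruct (growth_bounds (wser e facets) P bs t) as [lo [hi [Hlo Hb]]]; auto.
  { intros n; rewrite W; lia. }
  apply (limsup_unique _ _ _ Hsup).
  apply (kth_root_limit a lo hi); auto; [apply Rinv_0_lt_compat; lra|].
  intros n; specialize (Hb n); rewrite W, <- INR_IZR_INZ in Hb; auto.
Qed.

(** * The reciprocal polynomial and its complex roots *)

Definition cneg (z : R * R) : R * R := (- fst z, - snd z).
Definition csub (z w : R * R) : R * R := (fst z - fst w, snd z - snd w).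

Lemma complex_ring : ring_theory (0, 0) (1, 0) cadd cmul csub cneg eq.
Proof.
  constructor; intros; unfold cadd, cmul, csub, cneg; repeat match goal with z : R * R |- _ => destruct z end;
    simpl; f_equal; ring.
Qed.

Add Ring complex_ring_inst : complex_ring.

Fixpoint cpow (z : R * R) (n : nat) : R * R :=
  match n with O => (1, 0) | S k => cmul z (cpow z k) end.

Definition cnorm2 (z : R * R) : R := fst z * fst z + snd z * snd z.

Lemma cnorm2_mul z w : cnorm2 (cmul z w) = cnorm2 z * cnorm2 w.
Proof. unfold cnorm2, cmul; simpl; ring. Qed.

Lemma cnorm2_nonneg z : 0 <= cnorm2 z.
Proof. unfold cnorm2; nra. Qed.

Lemma cpow_bound w t n : 0 < t -> cnorm2 w <= t * t -> cnorm2 (cpow w n) <= t ^ n * t ^ n.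
Proof.
  intros Ht H; induction n as [|n IH]; simpl; [unfold cnorm2; simpl; lra|].
  rewrite cnorm2_mul; replace (t * t ^ n * (t * t ^ n)) with ((t * t) * (t ^ n * t ^ n)) by ring.
  apply Rmult_le_compat; auto using cnorm2_nonneg.
Qed.

Lemma real_part_bound z r : 0 < r -> cnorm2 z <= r * r ->
  fst z <= r /\ (r <= fst z -> z = (r, 0)).
Proof.
  intros Hr H; unfold cnorm2 in H; destruct z as [x y]; simpl in *.
  assert (x <= r) by nra; split; auto; intros H1.
  assert (x = r) by lra; subst x; f_equal; nra.
Qed.

Lemma cpeval_cons a l z : cpeval (a :: l) z = cadd (IZR a, 0) (cmul z (cpeval l z)).
Proof. reflexivity. Qed.

Lemma cpeval_app l a z :
  cpeval (l ++ [a]) z = cadd (cpeval l z) (cmul (cpow z (length l)) (IZR a, 0)).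
Proof.
  induction l as [|b l IH]; cbn [app length cpow].
  - cbn [cpeval fold_right]; ring.
  - rewrite !cpeval_cons, IH; ring.
Qed.

(** The length of a list exceeds its formal degree by one, whence the factor z on the right. *)
Lemma cpeval_rev l z w : cmul z w = (1, 0) ->
  cmul (cpow z (length l)) (cpeval l w) = cmul z (cpeval (rev l) z).
Proof.
  intros E; induction l as [|a l IH]; cbn [rev length cpow].
  - cbn [cpeval fold_right]; ring.
  - rewrite cpeval_app, length_rev, cpeval_cons.
    transitivity (cadd (cmul (cmul z (cpow z (length l))) (IZR a, 0))
      (cmul (cmul z w) (cmul (cpow z (length l)) (cpeval l w)))); [ring|].
    rewrite E, IH; ring.
Qed.

Lemma cpeval_opp l z : cpeval (map Z.opp l) z = cneg (cpeval l z).
Proof.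
  induction l as [|a l IH]; cbn [map].
  - unfold cneg; simpl; f_equal; ring.
  - rewrite !cpeval_cons, IH, opp_IZR.
    replace (- IZR a, 0) with (cneg (IZR a, 0)) by (unfold cneg; simpl; f_equal; ring); ring.
Qed.

Lemma cpeval_real l x : cpeval l (x, 0) = (peval l x, 0).
Proof.
  induction l as [|a l IH]; cbn [cpeval peval fold_right]; auto.
  fold (cpeval l (x, 0)) (peval l x); rewrite IH; unfold cadd, cmul; simpl; f_equal; ring.
Qed.

(** Real parts are compared term by term; if the sums agree, each power of w with a positive
    coefficient equals that power of t. The factor w^j carries the position in the list through the
    induction. *)
Lemma triangle_equality bs t w j : 0 < t -> cnorm2 w <= t * t ->
  (forall c, In c bs -> (0 <= c)%Z) ->
  fst (cmul (cpow w j) (cpeval bs w)) <= t ^ j * peval bs t /\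
  (t ^ j * peval bs t <= fst (cmul (cpow w j) (cpeval bs w)) ->
   forall k, (0 < nth k bs 0)%Z -> cpow w (j + k) = (t ^ (j + k), 0)).
Proof.
  intros Ht Hw; revert j; induction bs as [|b bs IH]; intros j Hb.
  - split; [cbn; lra|]; intros _ [|k]; simpl; lia.
  - cbn [cpeval peval fold_right]; fold (cpeval bs w) (peval bs t).
    destruct (IH (S j)) as [I1 I2]; [intros; apply Hb; right; auto|].
    assert (Hb0 : 0 <= IZR b) by (apply IZR_le, Hb; left; auto).
    pose proof (pow_lt t j Ht) as Pt.
    destruct (real_part_bound (cpow w j) (t ^ j) Pt (cpow_bound w t j Ht Hw)) as [R1 R2].
    assert (E : fst (cmul (cpow w j) (cadd (IZR b, 0) (cmul w (cpeval bs w)))) =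
      IZR b * fst (cpow w j) + fst (cmul (cpow w (S j)) (cpeval bs w)))
      by (cbn [cpow]; unfold cadd, cmul; simpl; ring).
    assert (F : t ^ j * (IZR b + t * peval bs t) = IZR b * t ^ j + t ^ S j * peval bs t)
      by (simpl; ring).
    assert (IZR b * fst (cpow w j) <= IZR b * t ^ j) by (apply Rmult_le_compat_l; auto).
    rewrite E, F; split; [lra|]; intros G [|k] Hk.
    + rewrite Nat.add_0_r; apply R2; simpl in Hk; apply IZR_lt in Hk.
      apply (Rmult_le_reg_l (IZR b)); auto; lra.
    + simpl in Hk; replace (j + S k)%nat with (S j + k)%nat by lia; apply I2; auto; lra.
Qed.

Lemma consecutive_positions l : consecutive l = true ->
  exists k, (0 < nth k l 0)%Z /\ (0 < nth (S k) l 0)%Z.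
Proof.
  induction l as [|x l IH]; [discriminate|]; cbn [consecutive]; intros H.
  apply Bool.orb_true_iff in H as [H|H].
  - apply Bool.andb_true_iff in H as [H1 H2]; apply Z.ltb_lt in H1, H2.
    exists O; split; auto; destruct l; auto.
  - destruct (IH H) as [k Hk]; exists (S k); auto.
Qed.

Definition recip_poly (bs : list Z) : list Z := rev (1%Z :: map Z.opp bs).

Lemma recip_poly_inverse bs z w : cmul z w = (1, 0) ->
  cmul z (cpeval (recip_poly bs) z) =
  cmul (cpow z (S (length bs))) (csub (1, 0) (cmul w (cpeval bs w))).
Proof.
  intros E; unfold recip_poly; rewrite <- (cpeval_rev _ z w E).
  cbn [length]; rewrite length_map; f_equal.
  cbn [cpeval fold_right]; fold (cpeval (map Z.opp bs) w); rewrite cpeval_opp; ring.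
Qed.

Lemma cmul_cancel z w x : cmul z w = (1, 0) -> cmul z x = (0, 0) -> x = (0, 0).
Proof.
  intros E H; transitivity (cmul w (cmul z x)); [|rewrite H; ring].
  transitivity (cmul (cmul z w) x); [rewrite E|]; ring.
Qed.

Lemma recip_poly_root bs t : 0 < t -> t * peval bs t = 1 -> peval (recip_poly bs) (/ t) = 0.
Proof.
  intros Ht E.
  assert (I : cmul (/ t, 0) (t, 0) = (1, 0)) by (unfold cmul; simpl; f_equal; field; lra).
  assert (Z : cpeval (recip_poly bs) (/ t, 0) = (0, 0)).
  { apply (cmul_cancel (/ t, 0) (t, 0)); auto; rewrite (recip_poly_inverse bs _ _ I), cpeval_real.
    replace (cmul (t, 0) (peval bs t, 0)) with (1, 0)
      by (unfold cmul; simpl; f_equal; lra).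
    ring. }
  rewrite cpeval_real in Z; congruence.
Qed.

(** A root with |z| >= 1/t has an inverse w with |w| <= t and w b(w) = 1 = t b(t), where b is the
    polynomial [bs]. The equality case gives w^(k+1) = t^(k+1) and w^(k+2) = t^(k+2) for some k, and
    the quotient is w = t. *)
Lemma recip_poly_dominant bs t z : 0 < t -> t * peval bs t = 1 ->
  (forall c, In c bs -> (0 <= c)%Z) -> consecutive bs = true ->
  cpeval (recip_poly bs) z = (0, 0) -> z <> (/ t, 0) -> cabs z < / t.
Proof.
  intros Ht E Hb Hc Hz Nz; apply Rnot_le_lt; intros L; apply Nz.
  assert (Pt : 0 < / t) by (apply Rinv_0_lt_compat; auto).
  assert (N2 : / t * / t <= cnorm2 z).
  { replace (cnorm2 z) with (cabs z * cabs z) by (apply sqrt_sqrt, cnorm2_nonneg).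
    apply Rmult_le_compat; lra. }
  assert (Nz2 : 0 < cnorm2 z) by nra.
  set (w := (fst z / cnorm2 z, - snd z / cnorm2 z)).
  assert (I : cmul z w = (1, 0)) by (unfold w, cmul; simpl; f_equal; unfold cnorm2 in *; field; lra).
  assert (Nw : cnorm2 w <= t * t).
  { assert (P : cnorm2 z * cnorm2 w = 1) by (rewrite <- cnorm2_mul, I; unfold cnorm2; simpl; ring).
    assert (Q : cnorm2 w = / cnorm2 z) by (apply (Rmult_eq_reg_l (cnorm2 z)); [rewrite P; field|]; lra).
    rewrite Q; replace (t * t) with (/ (/ t * / t)) by (field; lra).
    apply Rinv_le_contravar; auto; apply Rmult_lt_0_compat; auto. }
  assert (I' : cmul w z = (1, 0)) by (rewrite <- I; ring).
  assert (Sz : csub (1, 0) (cmul w (cpeval bs w)) = (0, 0)).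
  { assert (G : forall n, cmul (cpow w n) (cpow z n) = (1, 0)).
    { induction n as [|n IH]; cbn [cpow]; [ring|].
      transitivity (cmul (cmul w z) (cmul (cpow w n) (cpow z n))); [ring|rewrite I', IH; ring]. }
    apply (cmul_cancel (cpow z (S (length bs))) (cpow w (S (length bs)))).
    - rewrite <- (G (S (length bs))); ring.
    - rewrite <- (recip_poly_inverse bs z w I), Hz; ring. }
  destruct (triangle_equality bs t w 1 Ht Nw Hb) as [_ T].
  assert (T' : forall k, (0 < nth k bs 0)%Z -> cpow w (1 + k) = (t ^ (1 + k), 0)).
  { apply T; rewrite pow_1, E; cbn [cpow].
    replace (cmul (cmul w (1, 0)) (cpeval bs w)) with (1, 0); [simpl; lra|].
    transitivity (cadd (csub (1, 0) (cmul w (cpeval bs w))) (cmul w (cpeval bs w))); [ring|].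
    rewrite Sz; ring. }
  destruct (consecutive_positions bs Hc) as [k [K1 K2]].
  apply T' in K1, K2.
  change (cpow w (1 + S k)) with (cmul w (cpow w (1 + k))) in K2; rewrite K1 in K2.
  change (t ^ (1 + S k)) with (t * t ^ (1 + k)) in K2.
  pose proof (pow_lt t (1 + k) Ht) as Pk; set (r := t ^ (1 + k)) in *.
  assert (Ew : w = (t, 0)).
  { destruct w as [x y]; unfold cmul in K2; simpl in K2; injection K2 as K3 K4.
    f_equal; apply (Rmult_eq_reg_r r); lra. }
  transitivity (cmul z (cmul (t, 0) (/ t, 0))).
  - replace (cmul (t, 0) (/ t, 0)) with (1, 0) by (unfold cmul; simpl; f_equal; field; lra); ring.
  - rewrite <- Ew; transitivity (cmul (cmul z w) (/ t, 0)); [ring|rewrite I; ring].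
Qed.

(** * Gauss's lemma for coefficient lists *)

Module Gauss.

Import all_boot all_algebra ssrZ.
Import ssrZ.Instances.
Import GRing.Theory.

Local Open Scope ring_scope.

(** A list determines its polynomial only up to trailing zeros, so results return as equalities of
    [ps]. *)
Definition toP (l : seq Z) : {poly int} := Poly (map int_of_Z l).
Definition fromP (p : {poly int}) : seq Z := map Z_of_int p.

Lemma fromPK p : toP (fromP p) = p.
Proof.
rewrite /toP /fromP -map_comp (eq_map Z_of_intK) map_id.
exact: polyseqK.
Qed.

Lemma toP_cons x l : toP (x :: l) = toP l * 'X + (int_of_Z x)%:P.
Proof. by rewrite /toP /= cons_poly_def. Qed.

Lemma coef_toP l i : (toP l)`_i = int_of_Z (ps l i).
Proof.
rewrite /toP coef_Poly /ps; elim: l i => [|x l IH] [|i] //=.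
Qed.

Lemma toP_inj a b : toP a = toP b -> ps a = ps b.
Proof.
move=> E; apply: functional_extensionality => i.
by apply: (can_inj int_of_ZK); rewrite -!coef_toP E.
Qed.

Lemma toP_add a b : toP (padd a b) = toP a + toP b.
Proof.
apply/polyP => i; rewrite coefD !coef_toP ps_add -rmorphD //.
Qed.

Lemma toP_scale c a : toP (pscale c a) = int_of_Z c *: toP a.
Proof.
apply/polyP => i; rewrite coefZ !coef_toP ps_scale smul_cst -rmorphM //.
Qed.

Lemma toP_mul a b : toP (pmul a b) = toP a * toP b.
Proof.
elim: a => [|x a IH] /=; first by rewrite /toP /= mul0r.
rewrite toP_add toP_scale toP_cons IH toP_cons mulrDl /= addr0 addrC.
by rewrite mul_polyC -!mulrA (mulrC 'X).
Qed.

Lemma size_toP l : (size (toP l) <= length l)%N.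
Proof. by apply: leq_trans (size_Poly _) _; rewrite size_map. Qed.

Lemma last_fromP p : List.last (fromP p) Z0 = Z_of_int (lead_coef p).
Proof.
rewrite /fromP lead_coefE -[p in RHS]polyseqK.
rewrite polyseqK; elim: (polyseq p) => [|x [|y s] IH] //.
Qed.

Lemma last_ps l : List.last l Z0 = ps l (size l).-1.
Proof. by elim: l => [|x [|y s] IH]. Qed.

Lemma lead_toP l : List.last l Z0 = Zpos xH -> lead_coef (toP l) = 1.
Proof.
move=> H; have l1 : (toP l)`_(size l).-1 = 1 by rewrite coef_toP -last_ps H.
have sz : size (toP l) = size l.
  apply/eqP; rewrite eqn_leq size_toP /=.
  case: l {H} l1 => [|x l] //= l1; rewrite ltnNge; apply/negP => Hs.
  by move: l1; rewrite nth_default.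
by rewrite lead_coefE sz.
Qed.

Lemma toP_eq0 l : toP l = 0 -> forall c, List.In c l -> c = Z0.
Proof.
move=> E c /(List.In_nth _ _ Z0) [i [_ <-]].
by apply: (can_inj int_of_ZK); rewrite -[List.nth i l Z0]/(ps l i) -coef_toP E coef0.
Qed.

(** The last hypothesis makes the remainder of the pseudo-division of l by q vanish, so q divides l
    over the rationals. By Gauss's lemma the primitive part of q divides l over the integers; its
    leading coefficient divides 1 and is positive by the normalization of [zprimitive]. *)
Lemma monic_factor (l q : list Z) : List.last l Z0 = Zpos xH ->
  (exists c, List.In c q /\ c <> Z0) ->
  (forall k u r, ps (pscale k l) = ps (padd (pmul u q) r) -> (length r < length q)%coq_nat ->
     forall c, List.In c r -> c = Z0) ->
  exists q' r', List.last q' Z0 = Zpos xH /\ (length q' <= length q)%coq_nat /\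
    (exists j, j <> Z0 /\ ps q = ps (pscale j q')) /\ ps l = ps (pmul q' r').
Proof.
move=> /lead_toP lead_l [c [qc nz_c]] min_q.
have nz_q : toP q != 0 by apply/eqP => /toP_eq0 /(_ c qc).
have div_q : toP q %| toP l.
  apply/eqP; rewrite -[LHS]fromPK; set r := fromP _.
  suff r0 : forall c, List.In c r -> c = Z0.
    apply/polyP => i; rewrite coef_toP coef0 /ps.
    case: (List.nth_in_or_default i r Z0) => [/r0 -> //| -> //].
  apply: (min_q (Z_of_int (lead_coef (toP q) ^+ scalp (toP l) (toP q)))
    (fromP (toP l %/ toP q))).
    apply: toP_inj; rewrite toP_scale Z_of_intK toP_add toP_mul !fromPK.
    exact: Pdiv.Idomain.divp_eq.
  apply/ltP; apply: leq_trans (size_toP q).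
  by rewrite -[length r]/(size r) size_map Pdiv.Idomain.ltn_modp.
have [r E] := dvdpP_int div_q.
exists (fromP (zprimitive (toP q))), (fromP r); split; last split; last split.
- rewrite last_fromP.
  have: lead_coef (zprimitive (toP q)) * lead_coef r = 1 by rewrite -lead_coefM -E.
  have: sgz (lead_coef (zprimitive (toP q))) = 1 by rewrite sgz_lead_primitive nz_q.
  set x := lead_coef _; move=> sx xr.
  move/(f_equal absz): xr; rewrite abszM => /eqP; rewrite muln_eq1 => /andP[/eqP ax _].
  by case: x sx ax => [[|[|n]]|[|n]].
- apply/leP; rewrite -[length (fromP _)]/(size (fromP _)) size_map size_zprimitive.
  exact: size_toP.
- exists (Z_of_int (zcontents (toP q))); split.
    move=> /(f_equal int_of_Z); rewrite Z_of_intK => /eqP; rewrite -/(0 : int).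
    by rewrite zcontents_eq0 (negbTE nz_q).
  by apply: toP_inj; rewrite toP_scale Z_of_intK fromPK -zpolyEprim.
- by apply: toP_inj; rewrite toP_mul !fromPK.
Qed.

End Gauss.

(** * Minimal polynomials *)

Lemma cpeval_ps a b z : ps a = ps b -> cpeval a z = cpeval b z.
Proof.
  assert (uncons : forall x l y l', ps (x :: l) = ps (y :: l') -> x = y /\ ps l = ps l').
  { intros x l y l' E; split; [exact (f_equal (fun s => s O) E)|].
    apply functional_extensionality; intros n; exact (f_equal (fun s => s (S n)) E). }
  assert (nil_zero : ps [] = ps [0%Z])
    by (apply functional_extensionality; intros [|[|n]]; reflexivity).
  assert (zero : forall l, ps l = ps [] -> cpeval l z = (0, 0)).
  { induction l as [|x l IH]; intros E; auto; rewrite nil_zero in E.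
    apply uncons in E as [-> E]; rewrite cpeval_cons, IH by auto; ring. }
  revert b; induction a as [|x a IH]; intros [|y b] E.
  - reflexivity.
  - symmetry; apply zero; auto.
  - apply zero, E.
  - apply uncons in E as [-> E]; rewrite !cpeval_cons, (IH b E); reflexivity.
Qed.

Lemma cpeval_add a b z : cpeval (padd a b) z = cadd (cpeval a z) (cpeval b z).
Proof.
  revert b; induction a as [|x a IH]; intros [|y b]; cbn [padd]; try (cbn [cpeval fold_right]; ring).
  rewrite !cpeval_cons, IH, plus_IZR.
  replace (IZR x + IZR y, 0) with (cadd (IZR x, 0) (IZR y, 0)) by (unfold cadd; simpl; f_equal; ring).
  ring.
Qed.

Lemma cpeval_scale c a z : cpeval (pscale c a) z = cmul (IZR c, 0) (cpeval a z).
Proof.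
  induction a as [|x a IH]; [cbn [pscale map cpeval fold_right]; ring|].
  change (pscale c (x :: a)) with ((c * x)%Z :: pscale c a); rewrite !cpeval_cons, IH, mult_IZR.
  replace (IZR c * IZR x, 0) with (cmul (IZR c, 0) (IZR x, 0)) by (unfold cmul; simpl; f_equal; ring).
  ring.
Qed.

Lemma cpeval_mul a b z : cpeval (pmul a b) z = cmul (cpeval a z) (cpeval b z).
Proof.
  induction a as [|x a IH]; cbn [pmul]; [cbn [cpeval fold_right]; ring|].
  rewrite cpeval_add, cpeval_scale, !cpeval_cons, IH; ring.
Qed.

Lemma peval_zero_iff l x : peval l x = 0 <-> cpeval l (x, 0) = (0, 0).
Proof. rewrite cpeval_real; split; congruence. Qed.

(** For a shortest nonzero integer polynomial q vanishing at tau, the pseudo-remainder of l by q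
    also vanishes at tau and is shorter, hence zero; the primitive part of q is then a monic divisor
    of l. *)
Lemma monic_minimal_polynomial tau l : last l 0%Z = 1%Z -> peval l tau = 0 ->
  exists p, p <> nil /\ last p 0%Z = 1%Z /\ peval p tau = 0 /\
    (forall q, (exists c, In c q /\ c <> 0%Z) -> peval q tau = 0 -> (length p <= length q)%nat) /\
    (forall z, cpeval p z = (0, 0) -> cpeval l z = (0, 0)).
Proof.
  intros Ll El.
  pose (Q := fun n => exists q, length q = n /\ (exists c, In c q /\ c <> 0%Z) /\ peval q tau = 0).
  assert (Q0 : Q (length l)).
  { exists l; repeat split; auto; exists 1%Z; split; [|lia].
    assert (Nl : l <> []) by (intros ->; discriminate).
    rewrite (app_removelast_last 0%Z Nl), Ll; apply in_or_app; right; left; reflexivity. }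
  destruct (least_witness Q _ Q0) as [n [_ [[q [Lq [Nq Eq]]] Hmin]]].
  destruct (Gauss.monic_factor l q Ll Nq) as [p [r [Lp [Sp [[j [Nj Ej]] Er]]]]].
  { intros k u r E Lr c Hc; apply NNPP; intros Nc.
    assert (peval r tau = 0).
    { apply peval_zero_iff; apply (cpeval_ps _ _ (tau, 0)) in E.
      rewrite cpeval_scale, cpeval_add, cpeval_mul in E.
      rewrite (proj1 (peval_zero_iff q tau) Eq), (proj1 (peval_zero_iff l tau) El) in E.
      transitivity (cmul (IZR k, 0) (0, 0)); [rewrite E|]; ring. }
    assert (n <= length r)%nat by (apply Hmin; exists r; repeat split; eauto); lia. }
  exists p; repeat split.
  - intros ->; discriminate.
  - auto.
  - apply peval_zero_iff; apply (cpeval_ps _ _ (tau, 0)) in Ej.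
    rewrite (proj1 (peval_zero_iff q tau) Eq), cpeval_scale in Ej.
    apply (cmul_cancel (IZR j, 0) (/ IZR j, 0)); auto.
    apply IZR_neq in Nj; unfold cmul; simpl; f_equal; field; auto.
  - intros q' Nq' Eq'; assert (n <= length q')%nat by (apply Hmin; exists q'; auto); lia.
  - intros z Hz; rewrite (cpeval_ps _ _ z Er), cpeval_mul, Hz; ring.
Qed.

Theorem mainTheorem2 (e : facet -> Vec4) (v : vertex -> Vec4) (tau : R) :
  is_coxeter_pyramid e v -> growth_rate e tau -> Perron tau.
Proof.
  intros HP HG.
  destruct (pyramid_classification e v HP) as [x0 [a [b [c [d HD]]]]].
  destruct (pyramid_recurrence e x0 a b c d HD) as [P [bs [HC HS]]].
  destruct (growth_rate_root e tau P bs HG HS HC) as [t [T [Ht ->]]].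
  destruct (check_parts P bs _ (recurrence_of_series bs _ P HS) HC) as [Hpos [_ [Hcon _]]].
  assert (Hlast : last (recip_poly bs) 0%Z = 1%Z).
  { unfold recip_poly; cbn [rev]; apply last_last. }
  destruct (monic_minimal_polynomial (/ t) (recip_poly bs) Hlast)
    as [p [Np [Lp [Ep [Mp Rp]]]]].
  { apply recip_poly_root; tauto. }
  split.
  - rewrite <- Rinv_1; apply Rinv_lt_contravar; lra.
  - exists p; repeat split; auto.
    intros z Hz Nz; apply (recip_poly_dominant bs t z); auto; tauto.
Qed.
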